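(* Given a bipartite graph $G=(A\cup B,E)$ in which every node has a strict ranking of its neighbors, and edge costs in $\{0,1\}$, it is NP-hard to compute a minimum-cost Pareto-optimal matching in $G$; moreover, it is NP-hard to approximate the minimum cost of a Pareto-optimal matching within any multiplicative factor.
   Context: Node $u$ prefers matching $M$ to $N$ if $u$ is matched in $M$ and unmatched in $N$, or matched in both and prefers its partner in $M$; $\phi(M,N)$ is the number of nodes preferring $M$ to $N$. A matching $M$ is Pareto-optimal if there is no matching $N$ with $\phi(N,M)>0$ and $\phi(M,N)=0$. The cost of a matching is the sum of the costs of its edges. *)

(* Defs.v *)
From mathcomp Require Import all_boot all_order all_algebra.

Set Implicit Arguments.
Unset Strict Implicit.
Unset Printing Implicit Defensive.

(** * Deterministic multi-tape Turing machines with an oracle *)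

Section Tape.

Variable C : Type.
Variable blank : C.

(* A two-way infinite tape.  [right_of t] starts with the scanned cell,
   [left_of t] lists the cells to the left of the head, nearest first; the
   cells beyond both lists are blank. *)
Record tape := Tape { left_of : seq C; right_of : seq C }.

Inductive dir := MoveL | MoveR | Stay.

Definition scan (t : tape) : C := head blank (right_of t).

Definition write_move (t : tape) (c : C) (d : dir) : tape :=
  let r := c :: behead (right_of t) in
  match d with
  | Stay => Tape (left_of t) r
  | MoveR => Tape (c :: left_of t) (behead r)
  | MoveL => Tape (behead (left_of t)) (head blank (left_of t) :: r)
  end.

End Tape.

(* The tape alphabet consists of a blank [None], the two bits [Some (inl b)]
   and finitely many machine-specific symbols [Some (inr s)]. *)
Definition cell (S : finType) := option (bool + S).

Inductive action (Q S : finType) (k : nat) :=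
| Halt of bool
| Query of Q
| Trans of ({ffun 'I_k -> cell S} -> Q * {ffun 'I_k -> cell S * dir}).
Arguments Halt {Q S k}.
Arguments Query {Q S k}.

Record machine := Machine {
  mstate : finType;
  msymb : finType;
  mtapes : nat;
  mstart : mstate;
  maction : mstate -> action mstate msymb mtapes;
  input_tape : 'I_mtapes;
  query_tape : 'I_mtapes;
  answer_tape : 'I_mtapes
}.

Definition oracle_free (M : machine) : Prop :=
  forall q q' : mstate M, maction q <> Query q'.

Section Run.

Variables (oracle : seq bool -> seq bool) (M : machine).

Local Notation mcell := (cell (msymb M)).

Record config := Config {
  cstate : mstate M;
  ctapes : {ffun 'I_(mtapes M) -> tape mcell}
}.

Definition tape_of_bits (x : seq bool) : tape mcell :=
  Tape [::] [seq Some (inl b) | b <- x].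

Fixpoint leading_bits (s : seq mcell) : seq bool :=
  if s is Some (inl b) :: s' then b :: leading_bits s' else [::].

Definition init (x : seq bool) : config :=
  Config (mstart M)
    [ffun i => tape_of_bits (if i == input_tape M then x else [::])].

(* A query takes one step: the string that starts at the head of the query
   tape is submitted, and the answer replaces the content of the answer tape. *)
Definition step (c : config) : config :=
  match maction (cstate c) with
  | Halt _ => c
  | Query q =>
      let x := leading_bits (right_of (ctapes c (query_tape M))) in
      Config q [ffun i => if i == answer_tape M then tape_of_bits (oracle x)
                          else ctapes c i]
  | Trans f =>
      let qw := f [ffun i => scan None (ctapes c i)] in
      Config qw.1
        [ffun i => write_move None (ctapes c i) (qw.2 i).1 (qw.2 i).2]
  end.

Definition verdict (c : config) : option bool :=
  if maction (cstate c) is Halt b then Some b else None.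

Definition decides_within (L : seq bool -> Prop) (p : {poly nat}) : Prop :=
  forall x, exists2 b : bool,
    verdict (iter (p.[size x])%R step (init x)) = Some b & (b <-> L x).

End Run.

(** * P, NP and NP-hardness *)

Definition language := seq bool -> Prop.

Definition in_P (L : language) : Prop :=
  exists (M : machine) (p : {poly nat}),
    oracle_free M /\ decides_within (fun=> [::]) M L p.

(* Every bit of [x] is doubled; the first unequal pair ends [x]. *)
Definition pair_bits (x w : seq bool) : seq bool :=
  flatten [seq [:: b; b] | b <- x] ++ [:: false, true & w].

Definition in_NP (L : language) : Prop :=
  exists (V : language) (p : {poly nat}), in_P V /\
    forall x, L x <->
      exists2 w : seq bool, size w <= (p.[size x])%R & V (pair_bits x w).

(* [S x y] means that [y] is a correct answer to the input [x]. *)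
Definition search_problem := seq bool -> seq bool -> Prop.

Definition solves (oracle : seq bool -> seq bool) (S : search_problem) : Prop :=
  forall x, (exists y, S x y) -> S x (oracle x).

(* Hardness under polynomial-time Turing reductions, the usual notion for
   problems that are not decision problems: one oracle machine and one time
   bound must work for all oracles that solve [S]. *)
Definition NP_hard (S : search_problem) : Prop :=
  forall L : language, in_NP L ->
    exists (M : machine) (p : {poly nat}),
      forall oracle, solves oracle S -> decides_within oracle M L p.

(** * Pareto-optimal matchings *)

(* Preference lists are ordered from most to least preferred.  Costs of
   non-edges are irrelevant. *)
Record instance := Instance {
  nA : nat;
  nB : nat;
  edge : 'I_nA -> 'I_nB -> bool;
  prefA : 'I_nA -> seq 'I_nB;
  prefB : 'I_nB -> seq 'I_nA;
  cost01 : 'I_nA -> 'I_nB -> bool;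
  prefA_uniq : forall a, uniq (prefA a);
  prefB_uniq : forall b, uniq (prefB b);
  mem_prefA : forall a b, (b \in prefA a) = edge a b;
  mem_prefB : forall a b, (a \in prefB b) = edge a b
}.

Section Matchings.

Variable G : instance.

Definition edge_set := {set 'I_(nA G) * 'I_(nB G)}.

Implicit Types M N : edge_set.

Definition is_matching M : Prop :=
  (forall e, e \in M -> edge e.1 e.2) /\
  (forall e f, e \in M -> f \in M -> e.1 = f.1 \/ e.2 = f.2 -> e = f).

Definition partnerA M (a : 'I_(nA G)) : option 'I_(nB G) :=
  [pick b | (a, b) \in M].

Definition partnerB M (b : 'I_(nB G)) : option 'I_(nA G) :=
  [pick a | (a, b) \in M].

Definition better (T : eqType) (pref : seq T) (p q : option T) : bool :=
  match p, q with
  | Some x, Some y => index x pref < index y pref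
  | Some _, None => true
  | None, _ => false
  end.

Definition prefers (u : 'I_(nA G) + 'I_(nB G)) M N : bool :=
  match u with
  | inl a => better (prefA a) (partnerA M a) (partnerA N a)
  | inr b => better (prefB b) (partnerB M b) (partnerB N b)
  end.

Definition phi M N : nat := #|[pred u | prefers u M N]|.

Definition pareto_optimal M : Prop :=
  is_matching M /\
  ~ exists N, [/\ is_matching N, 0 < phi N M & phi M N = 0].

Definition cost M : nat := \sum_(e in M) cost01 e.1 e.2.

Definition min_cost_pareto M : Prop :=
  pareto_optimal M /\ forall N, pareto_optimal N -> cost M <= cost N.

End Matchings.

(** * Encodings and the two computational problems *)

Definition enc_nat (n : nat) : seq bool := rcons (nseq n true) false.

Definition enc_seq (T : Type) (enc : T -> seq bool) (s : seq T) : seq bool :=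
  flatten [seq true :: enc x | x <- s] ++ [:: false].

(* Node indices are written in unary; as every node has its own entry, this is
   polynomially equivalent to writing them in binary. *)
Definition enc_instance (G : instance) : seq bool :=
  enc_seq (fun a : 'I_(nA G) =>
             enc_seq (fun b : 'I_(nB G) => enc_nat b ++ [:: cost01 a b])
                     (prefA a))
          (enum 'I_(nA G)) ++
  enc_seq (fun b : 'I_(nB G) =>
             enc_seq (fun a : 'I_(nA G) => enc_nat a) (prefB b))
          (enum 'I_(nB G)).

Definition enc_edge_set (G : instance) (M : edge_set G) : seq bool :=
  enc_seq (fun e : 'I_(nA G) * 'I_(nB G) => enc_nat e.1 ++ enc_nat e.2)
          (enum M).

Fixpoint enc_positive (p : BinNums.positive) : seq bool :=
  match p with
  | BinNums.xH => [:: true]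
  | BinNums.xO p' => false :: enc_positive p'
  | BinNums.xI p' => true :: enc_positive p'
  end.

(* Binary, least significant bit first; 0 is the empty string. *)
Definition enc_binary (n : nat) : seq bool :=
  if bin_of_nat n is BinNums.Npos p then enc_positive p else [::].

Definition min_cost_pareto_problem : search_problem := fun x y =>
  exists (G : instance) (M : edge_set G),
    [/\ x = enc_instance G, y = enc_edge_set M & min_cost_pareto M].

(* The factor may depend on the number of nodes.  As the optimum is an integer,
   restricting the answers [v] to integers is no loss: a real answer may be
   rounded down. *)
Definition approx_min_cost_pareto_problem
    (R : realFieldType) (alpha : nat -> R) : search_problem := fun x y =>
  exists (G : instance) (M : edge_set G) (v : nat),
    [/\ x = enc_instance G, y = enc_binary v, min_cost_pareto M,
        cost M <= v
      & (v%:R <= alpha (nA G + nB G)%N * (cost M)%:R)%R].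

(* Main.v *)
Require Import Defs.
From HB Require Import structures.
From mathcomp Require Import all_boot all_order all_algebra.
From mathcomp Require Import zify.
From Stdlib Require Import Classical_Prop FunctionalExtensionality.

Set Implicit Arguments.
Unset Strict Implicit.
Unset Printing Implicit Defensive.

(** Let [V] be a polynomial-time verifier for a language [L].  Whether [V]
    accepts [x] with some short witness is expressed by local constraints on a
    tableau of the run: cells [v] of a torus carry letters, and each constraint
    concerns the cells [v - 1], [v], [v + 1] and [v + W], with [W] the width of
    a row.  Coding letters by bits, each constraint becomes a family of clauses,
    each of which forbids one bit pattern.

    Every bit becomes an even cycle of edges of cost 0, with its two perfect
    matchings as truth values, in which [A]-nodes and [B]-nodes have opposite
    preferences; all other pairs of the cycle are joined by edges of cost 1 that
    both ends like least.  Thus a Pareto-optimal matching of cost 0 is perfect on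
    each cycle.  A clause becomes a ring of edges of cost 1, liked best by both
    ends, that link the matching edges which stand for the forbidden values of
    its bits.  If these are all matched, switching to the ring improves every
    node it meets; conversely, only a full ring can improve a matching of cost 0
    that is perfect on each cycle.  Hence the minimum cost is 0 iff [x] is in
    [L], and no approximation factor helps to tell 0 from positive values.

    The instance is written by a program over unary counters, which is compiled
    to an oracle machine. *)

(** * A while language over unary counters *)

(** Working with a tableau on a torus gives every cell the same clauses; only the forced bits vary.
    Node numbers can then be printed in unary relative to the current cell, by counters that advance
    modulo the number of cells. The edges of cost 1 inside a cycle make Pareto-optimality yield
    perfection: a free node on one side meets an adjacent free node on the other, and adding that
    edge harms nobody. Opposite preferences keep a cycle from switching its value, as one side would
    lose. An oracle speaks about some instance with the queried encoding, which may differ in the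
    costs of non-edges; so equal encodings must be shown to have the same answers. In the exact
    problem the machine itself must find out whether the answer has cost 0; hence cost 0 is made
    visible in the slots of the two ends, and a finite automaton can check it. *)

Section Language.

Variable V : finType.

Record store := Store {
  reg : {ffun V -> nat};
  inleft : seq bool;
  inright : seq bool;
  out : seq bool
}.

Inductive op := Inc of V | Dec of V | Emit of bool | InL | InR.

Inductive test := TReg of V | TIn | TInB.

Inductive cmd :=
| Op of op
| Skip
| Seq of cmd & cmd
| If of test & cmd & cmd
| While of test & cmd.

Definition upd (g : {ffun V -> nat}) (r : V) (m : nat) : {ffun V -> nat} :=
  [ffun r' => if r' == r then m else g r'].

Definition opsem (o : op) (s : store) : option store :=
  let: Store g l r w := s in
  match o with
  | Inc x => Some (Store (upd g x (g x).+1) l r w)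
  | Dec x => if g x is m.+1 then Some (Store (upd g x m) l r w) else None
  | Emit b => Some (Store g l r (rcons w b))
  | InL => if l is b :: l' then Some (Store g l' (b :: r) w) else None
  | InR => if r is b :: r' then Some (Store g (b :: l) r' w) else None
  end.

Definition holds (t : test) (s : store) : bool :=
  match t with
  | TReg x => reg s x != 0
  | TIn => inright s != [::]
  | TInB => head false (inright s)
  end.

(* The numbers are the exact running times of the compiled code. *)
Inductive exec : cmd -> store -> nat -> store -> Prop :=
| ExOp o s s' : opsem o s = Some s' -> exec (Op o) s 1 s'
| ExSkip s : exec Skip s 0 s
| ExSeq c1 c2 s t1 s1 t2 s2 :
    exec c1 s t1 s1 -> exec c2 s1 t2 s2 -> exec (Seq c1 c2) s (t1 + t2) s2
| ExIfT b c1 c2 s t s' :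
    holds b s -> exec c1 s t s' -> exec (If b c1 c2) s (t.+1 + 1) s'
| ExIfF b c1 c2 s t s' :
    ~~ holds b s -> exec c2 s t s' -> exec (If b c1 c2) s t.+1 s'
| ExWhileF b c s : ~~ holds b s -> exec (While b c) s 1 s
| ExWhileT b c s t1 s1 t2 s2 :
    holds b s -> exec c s t1 s1 -> exec (While b c) s1 t2 s2 ->
    exec (While b c) s (t1.+1 + 1 + t2) s2.

Inductive instr := IOp of op | IBr of test & nat | IJmp of nat.

Fixpoint csize (c : cmd) : nat :=
  match c with
  | Op _ => 1
  | Skip => 0
  | Seq c1 c2 => csize c1 + csize c2
  | If _ c1 c2 => csize c1 + csize c2 + 2
  | While _ c => csize c + 2
  end.

Fixpoint compile (c : cmd) (p : nat) : seq instr :=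
  match c with
  | Op o => [:: IOp o]
  | Skip => [::]
  | Seq c1 c2 => compile c1 p ++ compile c2 (p + csize c1)
  | If b c1 c2 =>
      IBr b (p + csize c1 + 2) :: compile c1 p.+1 ++
      IJmp (p + csize c1 + csize c2 + 2) :: compile c2 (p + csize c1 + 2)
  | While b c =>
      IBr b (p + csize c + 2) :: compile c p.+1 ++ [:: IJmp p]
  end.

Lemma size_compile c p : size (compile c p) = csize c.
Proof.
elim: c p => //= [c1 IH1 c2 IH2|b c1 IH1 c2 IH2|b c IH] p;
  rewrite ?size_cat /= ?IH1 ?IH2 ?IH ?size_cat; lia.
Qed.

(** * Flat code with jumps, and correctness of the compiler *)

Section Flat.

Variable code : seq instr.

Definition fstep (ps : nat * store) : option (nat * store) :=
  let: (p, s) := ps in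
  match onth code p with
  | Some (IOp o) => omap (pair p.+1) (opsem o s)
  | Some (IBr b q) => Some (if holds b s then p.+1 else q, s)
  | Some (IJmp q) => Some (q, s)
  | None => None
  end.

Fixpoint fsteps (n : nat) (ps ps' : nat * store) : Prop :=
  if n is m.+1 then exists2 ps1, fstep ps = Some ps1 & fsteps m ps1 ps'
  else ps = ps'.

Lemma fsteps_add m n ps1 ps2 ps3 :
  fsteps m ps1 ps2 -> fsteps n ps2 ps3 -> fsteps (m + n) ps1 ps3.
Proof.
elim: m ps1 => [|m IH] ps1 /=; first by move=> ->.
by case=> ps E H1 H2; exists ps => //; apply: IH.
Qed.

Definition code_at (p : nat) (c : seq instr) : Prop :=
  exists pre post, code = pre ++ c ++ post /\ p = size pre.

Lemma code_at_cat p c1 c2 :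
  code_at p (c1 ++ c2) -> code_at p c1 /\ code_at (p + size c1) c2.
Proof.
case=> pre [post [E ->]]; split.
  by exists pre, (c2 ++ post); rewrite E -catA.
by exists (pre ++ c1), post; rewrite E size_cat -!catA.
Qed.

Lemma code_at_cons p i c :
  code_at p (i :: c) -> onth code p = Some i /\ code_at p.+1 c.
Proof.
move=> H; split.
  by case: H => pre [post [-> ->]]; rewrite onthE map_cat nth_cat size_map ltnn subnn.
by have [_] := code_at_cat (H : code_at p ([:: i] ++ c)); rewrite addn1.
Qed.

(** Induction on the execution, for arbitrary [p]: jump targets are absolute, so [code_at] records
    where the block sits in the whole code. The step count is exact, since a loop round or the first
    branch of an [If] pays for its test and one closing jump. *)
Lemma compile_correct c s t s' : exec c s t s' ->
  forall p, code_at p (compile c p) -> fsteps t (p, s) (p + csize c, s').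
Proof.
elim=> {c s t s'} /=.
- move=> o s s' E p /code_at_cons [Ei _].
  by exists (p.+1, s'); rewrite ?addn1 // /fstep Ei E.
- by move=> s p _; rewrite addn0.
- move=> c1 c2 s t1 s1 t2 s2 _ IH1 _ IH2 p /code_at_cat [/IH1 H1].
  rewrite size_compile => /IH2 H2; rewrite addnA.
  exact: fsteps_add H1 H2.
- move=> b c1 c2 s t s' hb _ IH p /code_at_cons [E /code_at_cat [/IH H1 H2]].
  exists (p.+1, s); first by rewrite /fstep E hb.
  apply: fsteps_add H1 _.
  rewrite size_compile in H2; have [E2 _] := code_at_cons H2.
  eexists; first by rewrite /fstep E2.
  by congr pair; lia.
- move=> b c1 c2 s t s' hb _ IH p /code_at_cons [E /code_at_cat [_]].
  rewrite size_compile => /code_at_cons [_ H2].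
  exists (p + csize c1 + 2, s); first by rewrite /fstep E (negPf hb).
  have /IH : code_at (p + csize c1 + 2) (compile c2 (p + csize c1 + 2)).
    by move: H2; have -> : (p.+1 + csize c1).+1 = p + csize c1 + 2 by lia.
  by have -> : p + csize c1 + 2 + csize c2 = p + (csize c1 + csize c2 + 2) by lia.
- move=> b c s hb p /code_at_cons [E _].
  by eexists; [rewrite /fstep E (negPf hb)|rewrite addnA].
- move=> b c s t1 s1 t2 s2 hb _ IH1 _ IH2 p H.
  have [E /code_at_cat [/IH1 H1]] := code_at_cons H.
  rewrite size_compile => /code_at_cons [E2 _].
  exists (p.+1, s); first by rewrite /fstep E hb.
  rewrite -addnA; apply: fsteps_add H1 _.
  exists (p, s1); first by rewrite /fstep E2.
  exact: IH2.
Qed.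

(** Each unit of time emits at most one bit. The bound pays for rewinding the output tape before the
    query. *)
Lemma size_out_exec c s t s' : exec c s t s' -> size (out s') <= size (out s) + t.
Proof.
elim=> {c s t s'}; try by move=> *; lia.
move=> o [g l r w] s' /=; case: o => [x|x|b||] /=.
- by case=> <- /=; lia.
- by case: (g x) => [|m] // [<-] /=; lia.
- by case=> <- /=; rewrite size_rcons; lia.
- by case: l => [|b l] // [<-] /=; lia.
- by case: r => [|b r] // [<-] /=; lia.
Qed.

End Flat.

End Language.

Arguments Emit {V}.
Arguments InL {V}.
Arguments InR {V}.
Arguments TIn {V}.
Arguments TInB {V}.
Arguments Skip {V}.

(** * Machines that compute a query, ask it, and scan the answer *)

Section Scanner.

Variables (D : Type) (next : D -> bool -> D + bool) (fin : D -> bool).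

(* [next d b] is [inr v] if the verdict [v] is reached early. *)
Fixpoint scan_verdict (d : D) (y : seq bool) : bool :=
  if y is b :: y' then
    match next d b with inl d' => scan_verdict d' y' | inr v => v end
  else fin d.

Fixpoint scan_time (d : D) (y : seq bool) : nat :=
  if y is b :: y' then
    if next d b is inl d' then (scan_time d' y').+1 else 1
  else 1.

Lemma scan_time_le d y : scan_time d y <= (size y).+1.
Proof. by elim: y d => //= b y IH d; case: (next d b) => // d'; rewrite ltnS. Qed.

End Scanner.

Section QueryMachine.

Variable V : finType.
Variable c : cmd V.
Variables (D : finType) (d0 : D) (next : D -> bool -> D + bool) (fin : D -> bool).

Local Notation ntapes := (3 + #|V|).
Local Notation sym := (cell void).

Definition bit (b : bool) : sym := Some (inl b).
Definition itape : 'I_ntapes := lshift _ (inord 0).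
Definition otape : 'I_ntapes := lshift _ (inord 1).
Definition atape : 'I_ntapes := lshift _ (inord 2).
Definition rtape (x : V) : 'I_ntapes := rshift 3 (enum_rank x).

Lemma itape_neq_otape : itape == otape = false.
Proof. by rewrite -val_eqE /= !inordK. Qed.
Lemma otape_neq_itape : otape == itape = false.
Proof. by rewrite -val_eqE /= !inordK. Qed.
Lemma rtape_neq_itape x : rtape x == itape = false.
Proof. by rewrite -val_eqE /= !inordK. Qed.
Lemma itape_neq_rtape x : itape == rtape x = false.
Proof. by rewrite -val_eqE /= !inordK. Qed.
Lemma rtape_neq_otape x : rtape x == otape = false.
Proof. by rewrite -val_eqE /= !inordK. Qed.
Lemma otape_neq_rtape x : otape == rtape x = false.
Proof. by rewrite -val_eqE /= !inordK. Qed.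
Lemma eq_rtape x y : (rtape x == rtape y) = (x == y).
Proof.
by rewrite /rtape; apply/eqP/eqP => [/rshift_inj/enum_rank_inj|->].
Qed.

Definition tapeE := (itape_neq_otape, otape_neq_itape, rtape_neq_itape,
  itape_neq_rtape, rtape_neq_otape, otape_neq_rtape, eq_rtape, eqxx).

Definition code := compile c 0.
Local Notation L := (size code).

(** ['I_L.+1] includes the position [L] just behind the code, where [pc_trans] finds no instruction
    and starts to rewind the output tape. *)
Definition qstate : finType :=
  ((unit + 'I_L.+1) + (bool + (unit + (D + bool))))%type.

Definition qinit : qstate := inl (inl tt).
Definition qpc (p : nat) : qstate := inl (inr (inord p)).
Definition qrewind (b : bool) : qstate := inr (inl b).
Definition qquery : qstate := inr (inr (inl tt)).
Definition qscan (d : D) : qstate := inr (inr (inr (inl d))).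
Definition qdone (b : bool) : qstate := inr (inr (inr (inr b))).

Definition op_move (o : op V) (i : 'I_ntapes) (a : sym) : sym * dir :=
  match o with
  | Inc x => if i == rtape x then (a, MoveR) else (a, Stay)
  | Dec x => if i == rtape x then (a, MoveL) else (a, Stay)
  | Emit b => if i == otape then (bit b, MoveR) else (a, Stay)
  | InL => if i == itape then (a, MoveL) else (a, Stay)
  | InR => if i == itape then (a, MoveR) else (a, Stay)
  end.

(* Counters carry the mark [bit true] in their origin cell, and the value of a
   counter is the position of its head. *)
Definition test_scan (b : test V) (a : {ffun 'I_ntapes -> sym}) : bool :=
  match b with
  | TReg x => a (rtape x) != bit true
  | TIn => a itape != None
  | TInB => a itape == bit true
  end.

Definition stay (a : {ffun 'I_ntapes -> sym}) : {ffun 'I_ntapes -> sym * dir} :=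
  [ffun i => (a i, Stay)].

Definition pc_trans (p : nat) (a : {ffun 'I_ntapes -> sym}) :
    qstate * {ffun 'I_ntapes -> sym * dir} :=
  match onth code p with
  | Some (IOp o) => (qpc p.+1, [ffun i => op_move o i (a i)])
  | Some (IBr b q) => (if test_scan b a then qpc p.+1 else qpc q, stay a)
  | Some (IJmp q) => (qpc q, stay a)
  | None => (qrewind false,
             [ffun i => (a i, if i == otape then MoveL else Stay)])
  end.

Definition qaction (q : qstate) : action qstate void ntapes :=
  match q with
  | inl (inl _) => Trans (fun a =>
      (qpc 0, [ffun i => ((if (i == itape) || (i == otape) then a i
                           else bit true), Stay)]))
  | inl (inr p) => Trans (pc_trans p)
  | inr (inl false) => Trans (fun a =>
      if a otape == None
      then (qrewind true,
            [ffun i => (a i, if i == otape then MoveR else Stay)])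
      else (qrewind false,
            [ffun i => (a i, if i == otape then MoveL else Stay)]))
  | inr (inl true) => Trans (fun a => (qquery, stay a))
  | inr (inr (inl _)) => Query (qscan d0)
  | inr (inr (inr (inl d))) => Trans (fun a =>
      (if a atape is Some (inl b)
       then match next d b with inl d' => qscan d' | inr v => qdone v end
       else qdone (fin d),
       [ffun i => (a i, MoveR)]))
  | inr (inr (inr (inr b))) => Halt b
  end.

Definition query_machine : machine :=
  @Machine qstate void ntapes qinit qaction itape otape atape.

(** * Simulation of the code by the machine *)

Definition counter_tape (m k : nat) : tape sym :=
  if m is m'.+1 then Tape (rcons (nseq m' None) (bit true)) (nseq k None)
  else Tape [::] (bit true :: nseq k None).

(** Machine steps turn implicit blanks into listed ones, and equality of tapes sees the difference;
    so tapes are described only up to a number of trailing blanks. *)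
Definition represents (s : store V) (ts : {ffun 'I_ntapes -> tape sym}) : Prop :=
  [/\ exists k, ts itape = Tape (map bit (inleft s))
                                (map bit (inright s) ++ nseq k None),
      exists k, ts otape = Tape (map bit (rev (out s))) (nseq k None)
    & forall x, exists k, ts (rtape x) = counter_tape (reg s x) k].

Lemma write_move_stay_blank (l r : seq sym) k :
  exists k', write_move None (Tape l (r ++ nseq k None))
               (scan None (Tape l (r ++ nseq k None))) Stay
             = Tape l (r ++ nseq k' None).
Proof.
case: r => [|a r]; last by exists k.
by case: k => [|k]; [exists 1|exists k.+1].
Qed.

Lemma counter_stay m k :
  exists k', write_move None (counter_tape m k) (scan None (counter_tape m k)) Stay
             = counter_tape m k'.
Proof.
case: m => [|m]; first by exists k.
by case: (write_move_stay_blank (rcons (nseq m None) (bit true)) [::] k) => k' ?;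
  exists k'.
Qed.

Lemma counter_right m k :
  exists k', write_move None (counter_tape m k) (scan None (counter_tape m k)) MoveR
             = counter_tape m.+1 k'.
Proof.
case: m => [|m]; first by exists k.
by exists k.-1; case: k.
Qed.

Lemma counter_left m k :
  exists k', write_move None (counter_tape m.+1 k)
               (scan None (counter_tape m.+1 k)) MoveL = counter_tape m k'.
Proof.
by case: m => [|m]; [exists k.-1.+1|exists k.-1.+2]; case: k.
Qed.

Lemma scan_counter m k : (scan None (counter_tape m k) != bit true) = (m != 0).
Proof. by case: m => [|m] //=; case: k. Qed.

Lemma scan_input l (r : seq bool) k :
  (scan None (Tape l (map bit r ++ nseq k None)) != None) = (r != [::]).
Proof. by case: r => [|b r] //=; case: k. Qed.

Lemma scan_input_bit l (r : seq bool) k :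
  (scan None (Tape l (map bit r ++ nseq k None)) == bit true) = head false r.
Proof. by case: r => [|[] r] //=; case: k. Qed.

Lemma represents_stay s ts : represents s ts ->
  represents s
    [ffun i => write_move None (ts i) (scan None (ts i)) Stay].
Proof.
case=> [[k Ei] [k' Eo] Er]; split.
- by rewrite ffunE Ei; apply: write_move_stay_blank.
- by rewrite ffunE Eo; apply: (write_move_stay_blank _ [::]).
- by move=> x; rewrite ffunE; case: (Er x) => k2 ->; apply: counter_stay.
Qed.

Lemma represents_op o s s' ts : opsem o s = Some s' -> represents s ts ->
  represents s'
    [ffun i => write_move None (ts i) (op_move o i (scan None (ts i))).1
                                      (op_move o i (scan None (ts i))).2].
Proof.
case: s => g l r w /= E [/= [k Ei] [k' Eo] Er].
have stayI (r0 : seq bool) :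
    exists k1, write_move None (Tape (map bit l) (map bit r0 ++ nseq k None))
      (scan None (Tape (map bit l) (map bit r0 ++ nseq k None))) Stay
      = Tape (map bit l) (map bit r0 ++ nseq k1 None).
  exact: write_move_stay_blank.
have stayO := write_move_stay_blank (map bit (rev w)) [::] k'.
case: o E => [x|x|b||] /=.
- case=> <-; split=> /=; first by rewrite ffunE /= tapeE Ei; apply: stayI.
    by rewrite ffunE /= tapeE Eo; apply: stayO.
  move=> y; rewrite ffunE /= tapeE ffunE; case: (Er y) => k2 ->.
  by case: eqP => [->|_]; [apply: counter_right|apply: counter_stay].
- case Eg: (g x) => [|m] // [<-]; split=> /=.
  + by rewrite ffunE /= tapeE Ei; apply: stayI.
  + by rewrite ffunE /= tapeE Eo; apply: stayO.
  move=> y; rewrite ffunE /= tapeE ffunE; case: (Er y) => k2 ->.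
  by case: eqP => [->|_]; [rewrite Eg; apply: counter_left|apply: counter_stay].
- case=> <-; split=> /=; first by rewrite ffunE /= tapeE Ei; apply: stayI.
    rewrite ffunE /= tapeE Eo /= rev_rcons; exists k'.-1; by case: k' {Eo stayO}.
  move=> y; rewrite ffunE /= tapeE; case: (Er y) => k2 ->.
  exact: counter_stay.
- case: l Ei stayI => [|b l] // Ei stayI [<-]; split=> /=.
  + rewrite ffunE /= tapeE Ei; case: r {stayI Ei} => [|b' r] /=.
      by exists k.-1.+1; case: k.
    by exists k.
  + by rewrite ffunE /= tapeE Eo; apply: stayO.
  + by move=> y; rewrite ffunE /= tapeE; case: (Er y) => k2 ->; apply: counter_stay.
- case: r Ei => [|b r] // Ei [<-]; split=> /=.
  + by rewrite ffunE /= tapeE Ei; exists k.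
  + by rewrite ffunE /= tapeE Eo; apply: stayO.
  + by move=> y; rewrite ffunE /= tapeE; case: (Er y) => k2 ->; apply: counter_stay.
Qed.

Lemma test_scan_holds b s ts : represents s ts ->
  test_scan b [ffun i => scan None (ts i)] = holds b s.
Proof.
case: s => g l r w [/= [k Ei] _ Er]; case: b => [x||] /=; rewrite ffunE.
- by case: (Er x) => k' ->; rewrite scan_counter.
- by rewrite Ei scan_input.
- by rewrite Ei scan_input_bit.
Qed.

Variable oracle : seq bool -> seq bool.

Local Notation mstep := (step oracle (M := query_machine)).
Local Notation mconfig q ts := (@Config query_machine q ts).

Lemma fstep_mstep p s p' s' ts : p < L ->
  fstep code (p, s) = Some (p', s') -> represents s ts ->
  exists2 ts', mstep (mconfig (qpc p) ts) = mconfig (qpc p') ts'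
             & represents s' ts'.
Proof.
move=> ltp; rewrite /fstep /step /= /pc_trans inordK ?ltnS 1?ltnW //.
case E: (onth code p) => [[o|b q|q]|] //=.
- case Eo: (opsem o s) => [s1|] //= [<- <-] Hs.
  eexists; last exact: represents_op Eo Hs.
  by congr Config; apply/ffunP => i; rewrite !ffunE.
- case=> <- <- Hs; eexists; last exact: represents_stay Hs.
  rewrite (test_scan_holds _ Hs) (fun_if qpc); congr Config.
  by apply/ffunP => i; rewrite !ffunE.
- case=> <- <- Hs; eexists; last exact: represents_stay Hs.
  by congr Config; apply/ffunP => i; rewrite !ffunE.
Qed.

Lemma fsteps_mstep n p s s' ts :
  fsteps code n (p, s) (L, s') -> represents s ts ->
  exists2 ts', iter n mstep (mconfig (qpc p) ts) = mconfig (qpc L) ts'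
             & represents s' ts'.
Proof.
elim: n p s ts => [|n IH] p s ts; first by move=> [-> ->] Hs; exists ts.
case=> [[p1 s1] E1 H1] Hs.
have ltp : p < L.
  move: E1; rewrite /fstep; case E: (onth code p) => [i|] // _.
  by rewrite ltnNge; apply/negP => le; rewrite onth_default in E.
have [ts1 Ets1 Hs1] := fstep_mstep ltp E1 Hs.
have [ts' Ets' Hs'] := IH _ _ _ H1 Hs1.
by exists ts' => //; rewrite iterSr Ets1.
Qed.

Lemma leading_bits_map (w : seq bool) k :
  leading_bits (M := query_machine) (map bit w ++ nseq k None) = w.
Proof. by elim: w => [|b w IH] /=; [case: k|rewrite IH]. Qed.

(** The induction moves one bit per step from [v], the bits left of the head, to [w], those already
    passed; the last step meets the blank in front of the word and returns to its first bit. *)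
Lemma rewind_mstep (v w : seq bool) k ts :
  ts otape = Tape (map bit v) (map bit w ++ nseq k None) ->
  exists2 ts', iter (size v).+1 mstep
                 (mconfig (qrewind false)
                   [ffun i => write_move None (ts i) (scan None (ts i))
                                (if i == otape then MoveL else Stay)])
               = mconfig (qrewind true) ts'
             & exists k', ts' otape = Tape [:: None] (map bit (catrev v w) ++ nseq k' None).
Proof.
elim: v w k ts => [|b v IH] w k ts Ets.
  eexists.
    rewrite /= /step /= !ffunE eqxx Ets /=.
    by congr Config.
  rewrite !ffunE eqxx Ets /=.
  case: w {Ets} => [|b w]; last by exists k.
  by exists k.-1.+1; case: k.
have Ew : write_move None (ts otape) (scan None (ts otape)) MoveL
          = Tape (map bit v) (map bit (b :: w) ++ nseq (if w is [::] then k.-1.+1 else k) None).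
  by rewrite Ets /=; case: w {Ets} => //=; case: k.
set ts1 := [ffun i => _].
have [|ts' H1 H2] := IH (b :: w) (if w is [::] then k.-1.+1 else k) ts1.
  by rewrite ffunE eqxx Ew.
exists ts' => //; rewrite -H1 iterSr; congr iter.
by rewrite /step /= [X in X == None]ffunE /ts1 ffunE eqxx Ew /=;
  congr Config; apply/ffunP => i; rewrite !ffunE.
Qed.

Lemma scan_mstep d y (ts : {ffun 'I_ntapes -> tape sym}) : right_of (ts atape) = map bit y ->
  exists ts', iter (scan_time next d y) mstep (mconfig (qscan d) ts)
              = mconfig (qdone (scan_verdict next fin d y)) ts'.
Proof.
elim: y d ts => [|b y IH] d ts Ets.
  by eexists; rewrite /= /step /= ffunE /scan Ets.
rewrite /=; case En: (next d b) => [d'|v].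
  rewrite iterSr {2}/step /= ffunE /scan Ets /= En.
  by apply: IH; rewrite !ffunE /= Ets.
by eexists; rewrite /= /step /= ffunE /scan Ets /= En.
Qed.

Definition empty_store (x : seq bool) : store V := Store [ffun=> 0] [::] x [::].

(** The program runs for [t] steps and emits at most [t] bits, which rewinding crosses again: hence
    [t.*2]. The 5 counts the marking of the counters, the exit from the code, the step on the blank
    before the word, the entry to the query state and the query. *)
Lemma query_machine_correct x t s :
  exec c (empty_store x) t s ->
  forall m, t.*2 + scan_time next d0 (oracle (out s)) + 5 <= m ->
  verdict (iter m mstep (init query_machine x))
  = Some (scan_verdict next fin d0 (oracle (out s))).
Proof.
move=> Hex m Hm.
have [ts0 E0 R0] : exists2 ts0, mstep (init query_machine x) = mconfig (qpc 0) ts0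
    & represents (empty_store x) ts0.
  eexists; first by reflexivity.
  split=> /=.
  - rewrite !ffunE eqxx /tape_of_bits /=.
    by case: x {Hex} => [|b x]; [exists 1|exists 0; rewrite cats0].
  - by rewrite !ffunE otape_neq_itape eqxx; exists 1.
  - by move=> r; rewrite !ffunE rtape_neq_itape rtape_neq_otape; exists 0.
have H1 : code_at code 0 (compile c 0).
  by exists [::], [::]; rewrite cats0.
have := compile_correct Hex H1.
rewrite add0n -(size_compile c 0) => /fsteps_mstep /(_ R0) [ts1 E1 [_ [k Eo] _]].
have [] := @rewind_mstep (rev (out s)) [::] k ts1; first by rewrite Eo.
move=> ts2 E2 [k2 Eo2].
set ts3 := [ffun i => if i == atape then tape_of_bits query_machine (oracle (out s))
   else write_move None (ts2 i) (scan None (ts2 i)) Stay].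
have E3 : iter (1 + (1 + (size (rev (out s))).+1 + 1) + t + 1) mstep
            (init query_machine x) = mconfig (qscan d0) ts3.
  rewrite iterD [iter 1 _ _]/= E0 iterD E1 iterD iterD [iter 1 _ (mconfig (qpc L) ts1)]/=.
  have -> : mstep (mconfig (qpc L) ts1) =
     mconfig (qrewind false) [ffun i => write_move None (ts1 i) (scan None (ts1 i))
                                (if i == otape then MoveL else Stay)].
    rewrite /step /= /pc_trans inordK // onth_default //.
    by congr Config; apply/ffunP => i; rewrite !ffunE.
  rewrite iterD E2 /= {2}/step /= /step /=.
  congr Config; apply/ffunP => i; rewrite /ts3 !ffunE; case: eqP => // _.
  - congr (tape_of_bits _ (oracle _)).
    rewrite Eo2 catrevE cats0 revK.
    by case: (out s) => [|b w] /=; [case: (k2)|rewrite leading_bits_map].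
have Ea : right_of (ts3 atape) = map bit (oracle (out s)).
  by rewrite ffunE eqxx.
have [ts4 E4] := scan_mstep d0 Ea.
have Hlen := size_out_exec Hex; rewrite /= add0n in Hlen.
have [e ->] : exists e, m = e + (scan_time next d0 (oracle (out s)) +
    (1 + (1 + (size (rev (out s))).+1 + 1) + t + 1)).
  exists (m - (scan_time next d0 (oracle (out s)) +
    (1 + (1 + (size (rev (out s))).+1 + 1) + t + 1))).
  move: Hm; rewrite size_rev -addnn; lia.
rewrite iterD iterD E3 E4.
suff -> : iter e mstep (mconfig (qdone (scan_verdict next fin d0 (oracle (out s)))) ts4)
          = mconfig (qdone (scan_verdict next fin d0 (oracle (out s)))) ts4 by [].
by elim: e => //= e ->.
Qed.

End QueryMachine.

(** * Polynomially bounded functions *)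

Definition poly_bounded (f : nat -> nat) : Prop :=
  exists p : {poly nat}, forall n, f n <= p.[n]%R.

Lemma poly_bounded_le f g :
  (forall n, f n <= g n) -> poly_bounded g -> poly_bounded f.
Proof. by move=> H [p Hp]; exists p => n; apply: leq_trans (H n) (Hp n). Qed.

Lemma poly_bounded_const k : poly_bounded (fun=> k).
Proof. by exists (k%:P)%R => n; rewrite hornerC. Qed.

Lemma poly_bounded_id : poly_bounded id.
Proof. by exists 'X%R => n; rewrite hornerX. Qed.

Lemma poly_bounded_horner (p : {poly nat}) : poly_bounded (fun n => p.[n]%R).
Proof. by exists p. Qed.

Lemma poly_boundedD f g :
  poly_bounded f -> poly_bounded g -> poly_bounded (fun n => f n + g n).
Proof.
by move=> [p Hp] [q Hq]; exists (p + q)%R => n; rewrite hornerD; apply: leq_add.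
Qed.

Lemma poly_boundedM f g :
  poly_bounded f -> poly_bounded g -> poly_bounded (fun n => f n * g n).
Proof.
by move=> [p Hp] [q Hq]; exists (p * q)%R => n; rewrite hornerM; apply: leq_mul.
Qed.

Lemma poly_bounded_horner_rec (s : seq nat) :
  poly_bounded (fun n => horner_rec s n).
Proof.
elim: s => [|a s IH] /=; first exact: poly_bounded_const.
exact: (poly_boundedD (poly_boundedM IH poly_bounded_id) (poly_bounded_const a)).
Qed.

Ltac poly_bound := repeat first
  [ assumption
  | exact: poly_bounded_const
  | exact: poly_bounded_id
  | exact: poly_bounded_horner
  | exact: poly_bounded_horner_rec
  | apply: poly_boundedD
  | apply: poly_boundedM ].

(** * Running times *)

Section Run.

Variable V : finType.
Implicit Types (c : cmd V) (s : store V).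

Definition run c s (T : nat) s' : Prop := exists2 t, t <= T & exec c s t s'.

Lemma run_le c s T T' s' : run c s T s' -> T <= T' -> run c s T' s'.
Proof. by case=> t Ht He HT; exists t => //; apply: leq_trans HT. Qed.

Lemma run_eq c s T s1 s2 : run c s T s1 -> s1 = s2 -> run c s T s2.
Proof. by move=> H <-. Qed.

Lemma run_op o s s' : opsem o s = Some s' -> run (Op o) s 1 s'.
Proof. by move=> H; exists 1 => //; apply: ExOp. Qed.

Lemma run_skip s : run Skip s 0 s.
Proof. by exists 0 => //; apply: ExSkip. Qed.

Lemma run_seq c1 c2 s T1 s1 T2 s2 :
  run c1 s T1 s1 -> run c2 s1 T2 s2 -> run (Seq c1 c2) s (T1 + T2) s2.
Proof.
move=> [t1 H1 E1] [t2 H2 E2]; exists (t1 + t2); first exact: leq_add.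
exact: ExSeq E1 E2.
Qed.

Lemma run_if b c1 c2 s T s' :
  run (if holds b s then c1 else c2) s T s' -> run (If b c1 c2) s T.+2 s'.
Proof.
case: ifP => hb [t Ht E]; first by exists (t.+1 + 1); [lia|apply: ExIfT].
by exists t.+1; [lia|apply: ExIfF; rewrite ?hb].
Qed.

Lemma run_while b c (S : nat -> store V) m T :
  (forall i, i < m -> holds b (S i) /\ run c (S i) T (S i.+1)) ->
  ~~ holds b (S m) -> run (While b c) (S 0) (m * (T + 2) + 1) (S m).
Proof.
elim: m S => [|m IH] S H Hm; first by exists 1 => //; apply: ExWhileF.
have [h0 [t1 Ht1 E1]] := H 0 (ltn0Sn _).
have [t2 Ht2 E2] := IH (fun i => S i.+1) (fun i (h : i < m) => H i.+1 h) Hm.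
exists (t1.+1 + 1 + t2); last exact: ExWhileT E1 E2.
rewrite mulSn; lia.
Qed.

Lemma run_dec_while x c (S S' : nat -> store V) m T :
  (forall i, i < m -> reg (S i) x != 0 /\ opsem (Dec x) (S i) = Some (S' i)) ->
  (forall i, i < m -> run c (S' i) T (S i.+1)) ->
  reg (S m) x = 0 ->
  run (While (TReg x) (Seq (Op (Dec x)) c)) (S 0) (m * (T + 3) + 1) (S m).
Proof.
move=> H1 H2 Hm.
apply: run_le (run_while (T := 1 + T) _ _) _; last 1 first.
- by rewrite leq_add2r leq_mul2l; apply/orP; right; lia.
- move=> i lt; have [h1 h2] := H1 i lt; split=> //.
  by apply: run_seq (run_op h2) (H2 i lt).
- by rewrite /holds Hm.
Qed.

Definition emits (bs : seq bool) : cmd V := foldr (fun b => Seq (Op (Emit b))) Skip bs.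

Lemma run_emits bs g l r w :
  run (emits bs) (Store g l r w) (size bs) (Store g l r (w ++ bs)).
Proof.
elim: bs w => [|b bs IH] w /=; first by rewrite cats0; apply: run_skip.
rewrite -cat_rcons; apply: (run_seq (T1 := 1)); last exact: IH.
exact: run_op.
Qed.

End Run.

(** * The emission program *)

Section Emission.

Variable E : finType.

(** Besides the counter pairs [rf e], [rg e] there are four registers: [rn] keeps the input length,
    [rc] receives the value of a polynomial and then controls a loop, [ra] and [rt] are scratch and
    return to 0. *)
Definition var : finType := ((bool * bool) + (E * bool))%type.
Definition rn : var := inl (false, false).
Definition rc : var := inl (false, true).
Definition ra : var := inl (true, false).
Definition rt : var := inl (true, true).
Definition rf e : var := inr (e, true).
Definition rg e : var := inr (e, false).

Definition mkreg (n c a t : nat) (f g : E -> nat) : {ffun var -> nat} :=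
  [ffun x : var => match x with
   | inl (false, false) => n
   | inl (false, true) => c
   | inl (true, false) => a
   | inl (true, true) => t
   | inr (e, true) => f e
   | inr (e, false) => g e
   end].

Definition updf (f : E -> nat) e m : E -> nat := fun e' => if e' == e then m else f e'.

Lemma mkreg_rn n c a t f g : mkreg n c a t f g rn = n. Proof. by rewrite ffunE. Qed.
Lemma mkreg_rc n c a t f g : mkreg n c a t f g rc = c. Proof. by rewrite ffunE. Qed.
Lemma mkreg_ra n c a t f g : mkreg n c a t f g ra = a. Proof. by rewrite ffunE. Qed.
Lemma mkreg_rt n c a t f g : mkreg n c a t f g rt = t. Proof. by rewrite ffunE. Qed.
Lemma mkreg_rf n c a t f g e : mkreg n c a t f g (rf e) = f e.
Proof. by rewrite ffunE. Qed.
Lemma mkreg_rg n c a t f g e : mkreg n c a t f g (rg e) = g e.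
Proof. by rewrite ffunE. Qed.

Lemma upd_rn n c a t f g m : upd (mkreg n c a t f g) rn m = mkreg m c a t f g.
Proof. by apply/ffunP => -[[[] []]|[e []]]; rewrite !ffunE. Qed.
Lemma upd_rc n c a t f g m : upd (mkreg n c a t f g) rc m = mkreg n m a t f g.
Proof. by apply/ffunP => -[[[] []]|[e []]]; rewrite !ffunE. Qed.
Lemma upd_ra n c a t f g m : upd (mkreg n c a t f g) ra m = mkreg n c m t f g.
Proof. by apply/ffunP => -[[[] []]|[e []]]; rewrite !ffunE. Qed.
Lemma upd_rt n c a t f g m : upd (mkreg n c a t f g) rt m = mkreg n c a m f g.
Proof. by apply/ffunP => -[[[] []]|[e []]]; rewrite !ffunE. Qed.
Lemma eq_inr (e e' : E) (b b' : bool) :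
  ((inr (e', b') : var) == inr (e, b)) = (e' == e) && (b' == b).
Proof. by apply/eqP/andP => [[-> ->]|[/eqP -> /eqP ->]]. Qed.
Lemma upd_rf n c a t f g e m :
  upd (mkreg n c a t f g) (rf e) m = mkreg n c a t (updf f e m) g.
Proof.
by apply/ffunP => -[[[] []]|[e' []]]; rewrite !ffunE // eq_inr ?andbT ?andbF.
Qed.
Lemma upd_rg n c a t f g e m :
  upd (mkreg n c a t f g) (rg e) m = mkreg n c a t f (updf g e m).
Proof.
by apply/ffunP => -[[[] []]|[e' []]]; rewrite !ffunE // eq_inr ?andbT ?andbF.
Qed.

Lemma eq_mkreg n c a t f f' g g' :
  f =1 f' -> g =1 g' -> mkreg n c a t f g = mkreg n c a t f' g'.
Proof. by move=> Hf Hg; apply/ffunP => -[[[] []]|[e []]]; rewrite !ffunE. Qed.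

Definition mkregE := (mkreg_rn, mkreg_rc, mkreg_ra, mkreg_rt, mkreg_rf, mkreg_rg,
  upd_rn, upd_rc, upd_ra, upd_rt, upd_rf, upd_rg).

Lemma updf_same f e m : updf f e m e = m.
Proof. by rewrite /updf eqxx. Qed.

Lemma updf_upd f e m m' : updf (updf f e m) e m' =1 updf f e m'.
Proof. by move=> e'; rewrite /updf; case: eqP. Qed.

Lemma updf_id f e : updf f e (f e) =1 f.
Proof. by move=> e'; rewrite /updf; case: eqP => [->|]. Qed.

Definition loop (x : var) (c : cmd var) : cmd var :=
  While (TReg x) (Seq (Op (Dec x)) c).

(** A counter can only be read by emptying it, so [rt] collects its value and the second loop puts
    it back. *)
Definition emit_block (k : nat) (e : E) : cmd var :=
  Seq (loop (rf e) (Seq (Op (Inc rt)) (emits _ (nseq k true))))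
      (loop rt (Op (Inc (rf e)))).

Lemma run_emit_block k e n c f g l r w :
  run (emit_block k e) (Store (mkreg n c 0 0 f g) l r w) (f e * (k + 8) + 2)
      (Store (mkreg n c 0 0 f g) l r (w ++ nseq (f e * k) true)).
Proof.
pose m := f e.
pose S1 i := Store (mkreg n c 0 i (updf f e (m - i)) g) l r (w ++ nseq (i * k) true).
have H1 : run (loop (rf e) (Seq (Op (Inc rt)) (emits _ (nseq k true)))) (S1 0)
              (m * (1 + k + 3) + 1) (S1 m).
  apply: (run_dec_while (S' := fun i =>
    Store (mkreg n c 0 i (updf f e (m - i.+1)) g) l r (w ++ nseq (i * k) true))).
  - move=> i lt; rewrite /= !mkregE updf_same -(subnSK lt) /= ?mkregE; split=> //.
    by congr (Some (Store _ _ _ _)); apply: eq_mkreg => //; apply: updf_upd.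
  - move=> i lt; apply: run_seq.
      by apply: run_op; rewrite /= !mkregE.
    rewrite /S1 mulSn addnC nseqD catA -[X in _ X _](size_nseq k true).
    exact: run_emits.
  - by rewrite /= !mkregE updf_same subnn.
pose S2 i := Store (mkreg n c 0 (m - i) (updf f e i) g) l r (w ++ nseq (m * k) true).
have H2 : run (loop rt (Op (Inc (rf e)))) (S2 0) (m * (1 + 3) + 1) (S2 m).
  apply: (run_dec_while (S' := fun i =>
    Store (mkreg n c 0 (m - i.+1) (updf f e i) g) l r (w ++ nseq (m * k) true))).
  - by move=> i lt; rewrite /= !mkregE -(subnSK lt) /= ?mkregE.
  - move=> i lt; apply: run_op; rewrite /= !mkregE updf_same.
    by congr (Some (Store _ _ _ _)); apply: eq_mkreg => //; apply: updf_upd.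
  - by rewrite /= !mkregE subnn.
have E0 : S1 0 = Store (mkreg n c 0 0 f g) l r w.
  rewrite /S1 subn0 cats0; congr Store; apply: eq_mkreg => //; exact: updf_id.
have E1 : S1 m = S2 0 by rewrite /S1 /S2 subnn subn0.
have E2 : S2 m = Store (mkreg n c 0 0 f g) l r (w ++ nseq (m * k) true).
  by rewrite /S2 subnn; congr Store; apply: eq_mkreg => //; apply: updf_id.
rewrite E0 E1 in H1; rewrite E2 in H2.
apply: run_le (run_seq H1 H2) _; rewrite /m; lia.
Qed.

(* Computes [rc := rc * rn]. *)
Definition mul_rn : cmd var :=
  Seq (loop rc (Seq (loop rn (Seq (Op (Inc rt)) (Op (Inc ra)))) (loop rt (Op (Inc rn)))))
      (loop ra (Op (Inc rc))).

Lemma run_mul_rn n c f g l r w :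
  run mul_rn (Store (mkreg n c 0 0 f g) l r w) (c * (n * 14 + 5) + 2)
      (Store (mkreg n (c * n) 0 0 f g) l r w).
Proof.
have H1 c' a : run (loop rn (Seq (Op (Inc rt)) (Op (Inc ra))))
    (Store (mkreg n c' a 0 f g) l r w) (n * (2 + 3) + 1)
    (Store (mkreg 0 c' (a + n) n f g) l r w).
  pose S i := Store (mkreg (n - i) c' (a + i) i f g) l r w.
  have := @run_dec_while _ rn (Seq (Op (Inc rt)) (Op (Inc ra))) S (fun i =>
    Store (mkreg (n - i.+1) c' (a + i) i f g) l r w) n 2.
  rewrite /S subn0 addn0 subnn; apply.
  - by move=> i lt; rewrite /= !mkregE -(subnSK lt) /= ?mkregE.
  - move=> i lt; apply: (@run_seq _ _ _ _ 1 _ 1); apply: run_op; rewrite /= !mkregE //.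
    by rewrite addnS.
  - by rewrite /= mkregE.
have H2 c' a : run (loop rt (Op (Inc rn))) (Store (mkreg 0 c' a n f g) l r w)
    (n * (1 + 3) + 1) (Store (mkreg n c' a 0 f g) l r w).
  pose S i := Store (mkreg i c' a (n - i) f g) l r w.
  have := @run_dec_while _ rt (Op (Inc rn)) S (fun i =>
    Store (mkreg i c' a (n - i.+1) f g) l r w) n 1.
  rewrite /S subn0 subnn; apply.
  - by move=> i lt; rewrite /= !mkregE -(subnSK lt) /= ?mkregE.
  - by move=> i lt; apply: run_op; rewrite /= !mkregE.
  - by rewrite /= mkregE.
have H3 : run (loop rc (Seq (loop rn (Seq (Op (Inc rt)) (Op (Inc ra))))
    (loop rt (Op (Inc rn))))) (Store (mkreg n c 0 0 f g) l r w)
    (c * (n * 9 + 2 + 3) + 1) (Store (mkreg n 0 (c * n) 0 f g) l r w).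
  pose S i := Store (mkreg n (c - i) (i * n) 0 f g) l r w.
  have := @run_dec_while _ rc (Seq (loop rn (Seq (Op (Inc rt)) (Op (Inc ra))))
    (loop rt (Op (Inc rn)))) S (fun i =>
    Store (mkreg n (c - i.+1) (i * n) 0 f g) l r w) c (n * 9 + 2).
  rewrite /S subn0 subnn; apply.
  - by move=> i lt; rewrite /= !mkregE -(subnSK lt) /= ?mkregE.
  - move=> i lt; apply: run_le (run_seq (H1 _ _) _) _.
      by rewrite mulSn [n + _]addnC; apply: H2.
    by lia.
  - by rewrite /= mkregE.
have H4 : run (loop ra (Op (Inc rc))) (Store (mkreg n 0 (c * n) 0 f g) l r w)
    (c * n * (1 + 3) + 1) (Store (mkreg n (c * n) 0 0 f g) l r w).
  pose S i := Store (mkreg n i (c * n - i) 0 f g) l r w.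
  have := @run_dec_while _ ra (Op (Inc rc)) S (fun i =>
    Store (mkreg n i (c * n - i.+1) 0 f g) l r w) (c * n) 1.
  rewrite /S subn0 subnn; apply.
  - by move=> i lt; rewrite /= !mkregE -(subnSK lt) /= ?mkregE.
  - by move=> i lt; apply: run_op; rewrite /= !mkregE.
  - by rewrite /= mkregE.
apply: run_le (run_seq H3 H4) _; nia.
Qed.

Fixpoint eval_rec (s : seq nat) : cmd var :=
  if s is a :: s' then
    Seq (eval_rec s') (Seq mul_rn (iter a (Seq (Op (Inc rc))) Skip))
  else Skip.

Fixpoint eval_time (s : seq nat) (n : nat) : nat :=
  if s is a :: s' then
    eval_time s' n + (horner_rec s' n * (n * 14 + 5) + 2 + a)
  else 0.

Lemma eval_time_bounded s : poly_bounded (eval_time s).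
Proof. by elim: s => [|a s IH] /=; poly_bound. Qed.

Lemma run_eval_rec s n f g l r w :
  run (eval_rec s) (Store (mkreg n 0 0 0 f g) l r w) (eval_time s n)
      (Store (mkreg n (horner_rec s n) 0 0 f g) l r w).
Proof.
elim: s => [|a s IH] /=; first exact: run_skip.
apply: (run_seq IH); apply: (run_seq (run_mul_rn _ _ _ _ _ _ _)).
have H : forall c, run (iter a (Seq (Op (Inc rc))) Skip)
   (Store (mkreg n c 0 0 f g) l r w) a (Store (mkreg n (c + a) 0 0 f g) l r w).
  elim: a => [|a IHa] c; first by rewrite addn0; apply: run_skip.
  rewrite addnS -addSn; apply: (run_seq (T1 := 1)); last exact: IHa.
  by apply: run_op; rewrite /= !mkregE.
exact: H.
Qed.

Definition eval (p : {poly nat}) := eval_rec p.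

Definition rewind_input : cmd var :=
  Seq (loop rn (Seq (Op (Inc rt)) (Op InL))) (loop rt (Op (Inc rn))).

Lemma run_rewind_input x f g w :
  run rewind_input (Store (mkreg (size x) 0 0 0 f g) (rev x) [::] w)
    (size x * 9 + 2) (Store (mkreg (size x) 0 0 0 f g) [::] x w).
Proof.
pose n := size x.
pose S1 i := Store (mkreg (n - i) 0 0 i f g) (rev (take (n - i) x)) (drop (n - i) x) w.
have E0 : S1 0 = Store (mkreg (size x) 0 0 0 f g) (rev x) [::] w.
  by rewrite /S1 subn0 take_size drop_size.
have H1 : run (loop rn (Seq (Op (Inc rt)) (Op InL))) (S1 0) (n * (2 + 3) + 1) (S1 n).
  apply: (run_dec_while (S' := fun i =>
    Store (mkreg (n - i.+1) 0 0 i f g) (rev (take (n - i) x)) (drop (n - i) x) w)).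
  - by move=> i lt; rewrite /= !mkregE -(subnSK lt) /= ?mkregE.
  - move=> i lt; apply: (@run_seq _ _ _ _ 1 _ 1); apply: run_op; rewrite /= ?mkregE //.
    rewrite -(subnSK lt) (take_nth false) ?rev_rcons; last by rewrite -/n; lia.
    by rewrite -drop_nth //; rewrite -/n; lia.
  - by rewrite /= mkregE subnn.
pose S2 i := Store (mkreg i 0 0 (n - i) f g) [::] x w.
have H2 : run (loop rt (Op (Inc rn))) (S2 0) (n * (1 + 3) + 1) (S2 n).
  apply: (run_dec_while (S' := fun i => Store (mkreg i 0 0 (n - i.+1) f g) [::] x w)).
  - by move=> i lt; rewrite /= !mkregE -(subnSK lt) /= ?mkregE.
  - by move=> i lt; apply: run_op; rewrite /= !mkregE.
  - by rewrite /= mkregE subnn.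
have E1 : S1 n = S2 0 by rewrite /S1 /S2 subnn subn0 take0 drop0.
have E2 : S2 n = Store (mkreg (size x) 0 0 0 f g) [::] x w by rewrite /S2 subnn.
rewrite E0 E1 in H1; rewrite E2 in H2.
apply: run_le (run_seq H1 H2) _; rewrite /n; lia.
Qed.

(** * Counters modulo the number of cells *)

Section Rotation.

(* The pair [rf e], [rg e] holds [h e] and [N - h e] with [h e < N]; rotating
   increments [h e] modulo [N]. *)
Variable N : nat.
Hypothesis N_gt0 : 0 < N.

Definition rstore n c (h : E -> nat) l r w :=
  Store (mkreg n c 0 0 h (fun e => N - h e)) l r w.

Lemma eq_rstore n c h h' l r w : h =1 h' -> rstore n c h l r w = rstore n c h' l r w.
Proof. by move=> H; congr Store; apply: eq_mkreg => // e; rewrite H. Qed.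

(** The only test on a counter is for zero. Reaching the modulus shows as the complement [rg e]
    becoming 0, and then the content of [rf e] is moved back to [rg e]. *)
Definition rotate (e : E) : cmd var :=
  Seq (Op (Inc (rf e))) (Seq (Op (Dec (rg e)))
    (If (TReg (rg e)) Skip (loop (rf e) (Op (Inc (rg e)))))).

Lemma run_rotate e n c h l r w : h e < N ->
  run (rotate e) (rstore n c h l r w) (N * 4 + 5)
      (rstore n c (updf h e ((h e).+1 %% N)) l r w).
Proof.
move=> lth; apply: run_le (run_seq (run_op _) (run_seq (run_op _) (run_if _))) _.
- by rewrite /= !mkregE.
- by rewrite /= !mkregE -(subnSK lth) /= ?mkregE.
- rewrite /= !mkregE updf_same; case: eqP => /= H; last first.
    have -> : rstore n c (updf h e ((h e).+1 %% N)) l r w =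
       Store (mkreg n c 0 0 (updf h e (h e).+1)
                (updf (fun e0 => N - h e0) e (N - (h e).+1))) l r w.
      congr Store; apply: eq_mkreg => e'; rewrite /updf; case: eqP => // _.
      - by rewrite modn_small //; lia.
      - by rewrite modn_small //; lia.
    by apply: run_le (run_skip _) _; exact: leq0n (N * 4 + 1).
  have EN : (h e).+1 = N by lia.
  rewrite EN modnn.
  pose S i := Store (mkreg n c 0 0 (updf h e (N - i))
                (updf (fun e0 => N - h e0) e i)) l r w.
  have E0 : S 0 = Store (mkreg n c 0 0 (updf h e N)
       (updf (fun e0 : E => N - h e0) e (N - N))) l r w.
    by rewrite /S subn0 subnn.
  have E1 : S N = rstore n c (updf h e 0) l r w.
    rewrite /S subnn; congr Store; apply: eq_mkreg => // e'; rewrite /updf.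
    by case: eqP; rewrite ?subn0.
  rewrite -E0 -E1.
  apply: (run_dec_while (S' := fun i => Store (mkreg n c 0 0 (updf h e (N - i.+1))
      (updf (fun e0 => N - h e0) e i)) l r w) (T := 1)).
  + move=> i lt; rewrite /= !mkregE updf_same -(subnSK lt) /= ?mkregE; split=> //.
    by congr (Some (Store _ _ _ _)); apply: eq_mkreg => // e'; apply: updf_upd.
  + move=> i lt; apply: run_op; rewrite /= !mkregE updf_same.
    by congr (Some (Store _ _ _ _)); apply: eq_mkreg => // e'; apply: updf_upd.
  + by rewrite /= !mkregE updf_same subnn.
- lia.
Qed.

Definition rotate_all : cmd var := foldr (fun e => Seq (rotate e)) Skip (enum E).

Lemma run_rotate_all n c h l r w : (forall e, h e < N) ->
  run rotate_all (rstore n c h l r w) (#|E| * (N * 4 + 5))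
      (rstore n c (fun e => (h e).+1 %% N) l r w).
Proof.
move=> lth; rewrite /rotate_all cardE.
suff H (s : seq E) (q : E -> nat) : uniq s -> (forall e, q e < N) ->
  run (foldr (fun e => Seq (rotate e)) Skip s) (rstore n c q l r w)
    (size s * (N * 4 + 5))
    (rstore n c (fun e => if e \in s then (q e).+1 %% N else q e) l r w).
  apply: run_eq (H (enum E) h (enum_uniq _) lth) _.
  by apply: eq_rstore => e; rewrite mem_enum.
elim: s q => [|e s IH] q /=; first by move=> _ _; apply: run_skip.
move=> /andP [He Hs] Hq; rewrite mulSn; apply: run_seq (run_rotate _ _ _ _ _ (Hq e)) _.
apply: run_eq (IH _ Hs _) _.
  by move=> e'; rewrite /updf; case: eqP => // _; rewrite ltn_mod.
apply: eq_rstore => e'; rewrite inE /updf; case: eqP => [->|] //=.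
by rewrite (negPf He).
Qed.

Variable offset : E -> nat.
(** While cell [v] is written, the counter of [e] holds the number of the cell at distance
    [offset e] on the torus. *)
Definition rot_pos (v : nat) (e : E) : nat := (v + offset e) %% N.

Lemma rot_pos_lt v e : rot_pos v e < N. Proof. by rewrite ltn_mod. Qed.

Lemma rot_posS v e : (rot_pos v e).+1 %% N = rot_pos v.+1 e.
Proof. by rewrite /rot_pos -addn1 modnDml addn1 addSn. Qed.

Lemma rot_pos_period v e : rot_pos (N + v) e = rot_pos v e.
Proof. by rewrite /rot_pos -addnA modnDl. Qed.

Variable blk : nat.

(* An item [inl b] is a literal bit, and [inr e] stands for [blk * h e] ones. *)
Definition emit_items (its : seq (bool + E)) : cmd var :=
  foldr (fun it => Seq (match it with
                        | inl b => Op (Emit b)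
                        | inr e => emit_block blk e
                        end)) Skip its.

Definition items_out (h : E -> nat) (its : seq (bool + E)) : seq bool :=
  flatten [seq match it with
               | inl b => [:: b]
               | inr e => nseq (h e * blk) true
               end | it <- its].

Lemma run_emit_items its n c h l r w : (forall e, h e < N) ->
  run (emit_items its) (rstore n c h l r w) (size its * (N * (blk + 8) + 2))
      (rstore n c h l r (w ++ items_out h its)).
Proof.
move=> lth; elim: its w => [|it its IH] w /=; first by rewrite cats0; apply: run_skip.
rewrite mulSn /items_out /= catA; apply: run_seq; last exact: IH.
case: it => [b|e].
  by rewrite cats1; apply: (run_le (T := 1)); [apply: run_op|lia].
apply: run_le (run_emit_block _ _ _ _ _ _ _ _ _) _.
by rewrite leq_add2r leq_mul2r ltnW ?orbT.
Qed.

Variable K : finType.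
Variable cell : K -> seq (bool + E).

Definition emit_cell (k : K) : cmd var := Seq (emit_items (cell k)) rotate_all.

Definition cell_time : nat :=
  (\max_k size (cell k)) * (N * (blk + 8) + 2) + #|E| * (N * 4 + 5).

Definition vstore n c v l r w := rstore n c (rot_pos v) l r w.

Fixpoint cells_out (v : nat) (ks : seq K) : seq bool :=
  if ks is k :: ks' then items_out (rot_pos v) (cell k) ++ cells_out v.+1 ks'
  else [::].

Lemma cells_out_cat v ks ks' :
  cells_out v (ks ++ ks') = cells_out v ks ++ cells_out (v + size ks) ks'.
Proof.
elim: ks v => [|k ks IH] v /=; first by rewrite addn0.
by rewrite IH catA addnS.
Qed.

(** After [N] cells each counter is back at its start, so the second pass, over the other side of
    the graph, can follow without a reset. *)
Lemma cells_out_period v ks : cells_out (N + v) ks = cells_out v ks.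
Proof.
elim: ks v => [|k ks IH] v //=; rewrite -addnS IH; congr (_ ++ _).
rewrite /items_out; congr flatten; apply: eq_map => -[b|e] //.
by rewrite rot_pos_period.
Qed.

Lemma run_emit_cell k n c v l r w :
  run (emit_cell k) (vstore n c v l r w) cell_time
      (vstore n c v.+1 l r (w ++ cells_out v [:: k])).
Proof.
rewrite /= cats0; apply: run_le (run_seq (run_emit_items _ _ _ _ _ _ _) _) _.
- exact: rot_pos_lt.
- apply: run_eq (run_rotate_all _ _ _ _ _ _) _; first exact: rot_pos_lt.
  by apply: eq_rstore => e; apply: rot_posS.
- by rewrite leq_add2r leq_mul2r (leq_bigmax k) orbT.
Qed.

Definition emit_rep (pk : {poly nat} * K) : cmd var :=
  Seq (eval pk.1) (loop rc (emit_cell pk.2)).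

Lemma run_emit_rep p k n v l r w :
  run (emit_rep (p, k)) (vstore n 0 v l r w)
      (eval_time p n + (p.[n]%R * (cell_time + 3) + 1))
      (vstore n 0 (v + p.[n]%R) l r (w ++ cells_out v (nseq p.[n]%R k))).
Proof.
apply: run_seq; first exact: run_eval_rec.
set m := (p.[n])%R.
pose S i := vstore n (m - i) (v + i) l r (w ++ cells_out v (nseq i k)).
have E0 : S 0 = vstore n m v l r w by rewrite /S subn0 addn0 cats0.
have E1 : S m = vstore n 0 (v + m) l r (w ++ cells_out v (nseq m k)) by rewrite /S subnn.
rewrite /= -E1 -[Store _ _ _ _]E0.
apply: (run_dec_while (S' := fun i =>
  vstore n (m - i.+1) (v + i) l r (w ++ cells_out v (nseq i k)))).
- by move=> i lt; rewrite /= !mkregE -(subnSK lt) /= ?mkregE.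
- move=> i lt; rewrite /S addnS -addn1 nseqD cells_out_cat size_nseq catA.
  exact: run_emit_cell.
- by rewrite /= !mkregE subnn.
Qed.

Definition emit_reps (pks : seq ({poly nat} * K)) : cmd var :=
  foldr (fun pk => Seq (emit_rep pk)) Skip pks.

Definition reps_word (n : nat) (pks : seq ({poly nat} * K)) : seq K :=
  flatten [seq nseq pk.1.[n]%R pk.2 | pk <- pks].

Definition reps_time (n : nat) (pks : seq ({poly nat} * K)) : nat :=
  foldr (fun (pk : {poly nat} * K) t => eval_time pk.1 n + (pk.1.[n]%R * (cell_time + 3) + 1) + t) 0 pks.

Lemma run_emit_reps pks n v l r w :
  run (emit_reps pks) (vstore n 0 v l r w) (reps_time n pks)
      (vstore n 0 (v + size (reps_word n pks)) l r
         (w ++ cells_out v (reps_word n pks))).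
Proof.
elim: pks v w => [|[p k] pks IH] v w /=; first by rewrite addn0 cats0; apply: run_skip.
apply: run_eq (run_seq (run_emit_rep _ _ _ _ _ _ _) (IH _ _)) _.
by rewrite /reps_word /= size_cat cells_out_cat size_nseq catA addnA.
Qed.

Definition emit_cells (ks : seq K) : cmd var :=
  foldr (fun k => Seq (emit_cell k)) Skip ks.

Lemma run_emit_cells ks n v c l r w :
  run (emit_cells ks) (vstore n c v l r w) (size ks * cell_time)
      (vstore n c (v + size ks) l r (w ++ cells_out v ks)).
Proof.
elim: ks v w => [|k ks IH] v w /=; first by rewrite addn0 cats0; apply: run_skip.
rewrite catA addnS -addSn mulSn; apply: run_seq (IH _ _).
by have := run_emit_cell k n c v l r w; rewrite /= cats0.
Qed.

Variables (pks1 pks2 : seq ({poly nat} * K)) (inkinds : bool -> seq K).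

Definition word (x : seq bool) : seq K :=
  reps_word (size x) pks1 ++ flatten (map inkinds x) ++ reps_word (size x) pks2.

Definition emit_input : cmd var :=
  Seq (While TIn (Seq (If TInB (emit_cells (inkinds true)) (emit_cells (inkinds false)))
                      (Op InR)))
      rewind_input.

Definition input_time n :=
  n * ((size (inkinds true) + size (inkinds false)) * cell_time + 5) + n * 9 + 3.

Lemma run_emit_input x v w :
  run emit_input (vstore (size x) 0 v [::] x w) (input_time (size x))
    (vstore (size x) 0 (v + size (flatten (map inkinds x))) [::] x
       (w ++ cells_out v (flatten (map inkinds x)))).
Proof.
pose n := size x; pose kx i := flatten (map inkinds (take i x)).
pose S i := vstore n 0 (v + size (kx i)) (rev (take i x)) (drop i x)
              (w ++ cells_out v (kx i)).
have H1 : run (While TIn (Seq (If TInB (emit_cells (inkinds true))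
    (emit_cells (inkinds false))) (Op InR))) (S 0)
    (n * ((size (inkinds true) + size (inkinds false)) * cell_time + 2 + 1 + 2) + 1) (S n).
  apply: run_while; last by rewrite /= drop_size.
  move=> i lt; split; first by rewrite /= (drop_nth false).
  apply: run_seq.
    rewrite addn2; apply: run_if; rewrite /= (drop_nth false) //=.
    apply: run_le.
      by rewrite (_ : (if _ then _ else _) = emit_cells (inkinds (nth false x i)));
        [exact: run_emit_cells|case: nth].
    by rewrite leq_mul2r; apply/orP; right; case: nth; lia.
  apply: run_op.
  rewrite /= (drop_nth false) //=; congr (Some _).
  rewrite /S /kx (take_nth false) // rev_rcons map_rcons flatten_rcons size_cat.
  by rewrite cells_out_cat catA addnA.
have E0 : S 0 = vstore (size x) 0 v [::] x w.
  by rewrite /S /kx take0 drop0 addn0 cats0.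
rewrite E0 in H1.
apply: run_le (run_seq H1 _) _.
  by rewrite /S /kx take_size drop_size; apply: run_rewind_input.
by rewrite /input_time /n -!addnA !leq_add2l; lia.
Qed.

Definition sweep : cmd var := Seq (emit_reps pks1) (Seq emit_input (emit_reps pks2)).

Definition sweep_time n := reps_time n pks1 + (input_time n + reps_time n pks2).

Lemma run_sweep x v w :
  run sweep (vstore (size x) 0 v [::] x w) (sweep_time (size x))
    (vstore (size x) 0 (v + size (word x)) [::] x (w ++ cells_out v (word x))).
Proof.
rewrite /word !size_cat !cells_out_cat !catA !addnA.
apply: run_seq (run_emit_reps _ _ _ _ _ _) _.
apply: run_seq (run_emit_input _ _ _) _.
exact: run_emit_reps.
Qed.

End Rotation.

(** * Loading the counters, and the whole emission *)

Section Setup.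

Variables (pN : {poly nat}) (poff : E -> {poly nat}).

Definition count_input : cmd var :=
  Seq (While TIn (Seq (Op (Inc rn)) (Op InR))) rewind_input.

Lemma run_count_input x f g w :
  run count_input (Store (mkreg 0 0 0 0 f g) [::] x w) (size x * 13 + 3)
    (Store (mkreg (size x) 0 0 0 f g) [::] x w).
Proof.
pose S i := Store (mkreg i 0 0 0 f g) (rev (take i x)) (drop i x) w.
have H1 : run (While TIn (Seq (Op (Inc rn)) (Op InR))) (S 0) (size x * (2 + 2) + 1)
              (S (size x)).
  apply: run_while; last by rewrite /= drop_size.
  move=> i lt; split; first by rewrite /= (drop_nth false).
  apply: (@run_seq _ _ _ _ 1 _ 1); apply: run_op; rewrite /= ?mkregE //.
  by rewrite (drop_nth false) //= /S (take_nth false) // rev_rcons.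
have E0 : S 0 = Store (mkreg 0 0 0 0 f g) [::] x w by rewrite /S take0 drop0.
rewrite E0 /S take_size drop_size in H1.
apply: run_le (run_seq H1 (run_rewind_input _ _ _ _)) _; lia.
Qed.

Definition inc_all : cmd var := foldr (fun e => Seq (Op (Inc (rg e)))) Skip (enum E).

Lemma run_inc_all n c f j l r w :
  run inc_all (Store (mkreg n c 0 0 f (fun=> j)) l r w) #|E|
              (Store (mkreg n c 0 0 f (fun=> j.+1)) l r w).
Proof.
rewrite /inc_all cardE.
suff H (s : seq E) (g : E -> nat) : uniq s ->
  run (foldr (fun e => Seq (Op (Inc (rg e)))) Skip s)
    (Store (mkreg n c 0 0 f g) l r w) (size s)
    (Store (mkreg n c 0 0 f (fun e => if e \in s then (g e).+1 else g e)) l r w).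
  apply: run_eq (H (enum E) (fun=> j) (enum_uniq _)) _.
  by congr Store; apply: eq_mkreg => // e; rewrite mem_enum.
elim: s g => [|e s IH] g /=; first by move=> _; apply: run_skip.
move=> /andP [He Hs]; apply: (run_seq (T1 := 1)).
  by apply: run_op; rewrite /= !mkregE.
apply: run_eq (IH (updf g e (g e).+1) Hs) _.
congr Store; apply: eq_mkreg => // e'; rewrite inE /updf; case: eqP => [->|] //=.
by rewrite (negPf He).
Qed.

Definition load_modulus : cmd var := Seq (eval pN) (loop rc inc_all).

Lemma run_load_modulus n l r w : let N := (pN.[n])%R in
  run load_modulus (Store (mkreg n 0 0 0 (fun=> 0) (fun=> 0)) l r w)
    (eval_time pN n + (N * (#|E| + 3) + 1)) (rstore N n 0 (fun=> 0) l r w).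
Proof.
move=> N; apply: run_seq; first exact: run_eval_rec.
pose S i := Store (mkreg n (N - i) 0 0 (fun=> 0) (fun=> i)) l r w.
have E0 : S 0 = Store (mkreg n (horner_rec pN n) 0 0 (fun=> 0) (fun=> 0)) l r w.
  by rewrite /S subn0.
have E1 : S N = rstore N n 0 (fun=> 0) l r w.
  by rewrite /S subnn; congr Store; apply: eq_mkreg => // e; rewrite subn0.
rewrite -E0 -E1; apply: (run_dec_while (S' := fun i =>
  Store (mkreg n (N - i.+1) 0 0 (fun=> 0) (fun=> i)) l r w)).
- by move=> i lt; rewrite /= !mkregE -(subnSK lt) /= ?mkregE.
- by move=> i lt; apply: run_inc_all.
- by rewrite /= !mkregE subnn.
Qed.

Definition load_offset (e : E) : cmd var := Seq (eval (poff e)) (loop rc (rotate e)).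

Lemma run_load_offset e n h l r w : let N := (pN.[n])%R in
  0 < N -> h e = 0 ->
  run (load_offset e) (rstore N n 0 h l r w)
    (eval_time (poff e) n + ((poff e).[n]%R * (N * 4 + 5 + 3) + 1))
    (rstore N n 0 (updf h e ((poff e).[n]%R %% N)) l r w).
Proof.
move=> N N0 he; apply: run_seq; first exact: run_eval_rec.
set m := ((poff e).[n])%R.
pose S i := rstore N n (m - i) (updf h e (i %% N)) l r w.
have E0 : S 0 = Store (mkreg n (horner_rec (poff e) n) 0 0 h (fun e => N - h e)) l r w.
  rewrite /S subn0 mod0n; apply: eq_rstore => e'.
  by rewrite /updf; case: eqP => // ->.
have E1 : S m = rstore N n 0 (updf h e (m %% N)) l r w by rewrite /S subnn.
rewrite -E0 -E1; apply: (run_dec_while (S' := fun i =>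
  rstore N n (m - i.+1) (updf h e (i %% N)) l r w)).
- by move=> i lt; rewrite /= !mkregE -(subnSK lt) /= ?mkregE.
- move=> i lt; apply: run_eq (run_rotate N0 _ _ _ _ _ _) _ => //.
    by rewrite updf_same ltn_mod.
  by apply: eq_rstore => e'; rewrite updf_upd updf_same -[(i %% N).+1]addn1 modnDml addn1.
- by rewrite /= !mkregE subnn.
Qed.

Definition load_offsets : cmd var :=
  foldr (fun e => Seq (load_offset e)) Skip (enum E).

Definition load_offsets_time n : nat :=
  foldr (fun (e : E) t => eval_time (poff e) n +
    ((poff e).[n]%R * (pN.[n]%R * 4 + 5 + 3) + 1) + t) 0 (enum E).

Lemma run_load_offsets n l r w : let N := (pN.[n])%R in 0 < N ->
  run load_offsets (rstore N n 0 (fun=> 0) l r w) (load_offsets_time n)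
    (vstore N (fun e => (poff e).[n]%R) n 0 0 l r w).
Proof.
move=> N N0; rewrite /load_offsets /load_offsets_time.
suff H (s : seq E) (h : E -> nat) : uniq s -> (forall e, e \in s -> h e = 0) ->
  run (foldr (fun e => Seq (load_offset e)) Skip s) (rstore N n 0 h l r w)
   (foldr (fun e t => eval_time (poff e) n +
    ((poff e).[n]%R * (N * 4 + 5 + 3) + 1) + t) 0 s)
   (rstore N n 0 (fun e => if e \in s then (poff e).[n]%R %% N else h e) l r w).
  apply: run_eq (H (enum E) (fun=> 0) (enum_uniq _) (fun _ _ => erefl)) _.
  by apply: eq_rstore => e; rewrite mem_enum.
elim: s h => [|e s IH] h /=; first by move=> _ _; apply: run_skip.
move=> /andP [He Hs] h0; apply: run_seq.
  by apply: run_load_offset => //; apply: h0; rewrite inE eqxx.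
apply: run_eq (IH _ Hs _) _.
  move=> e' He'; rewrite /updf; case: eqP He' => [->|_ He'].
    by rewrite (negPf He).
  by apply: h0; rewrite inE He' orbT.
apply: eq_rstore => e'; rewrite inE /updf; case: eqP => [->|] //=.
by rewrite (negPf He).
Qed.

Variables (blk : nat) (K : finType) (cellA cellB : K -> seq (bool + E)).
Variables (pks1 pks2 : seq ({poly nat} * K)) (inkinds : bool -> seq K).

Definition emission : cmd var :=
  Seq count_input (Seq load_modulus (Seq load_offsets
    (Seq (sweep blk cellA pks1 pks2 inkinds) (Seq (emits _ [:: false])
    (Seq (sweep blk cellB pks1 pks2 inkinds) (emits _ [:: false])))))).

Definition emission_time n : nat :=
  n * 13 + 3 + (eval_time pN n + (pN.[n]%R * (#|E| + 3) + 1) + (load_offsets_time n +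
  (sweep_time pN.[n]%R blk cellA pks1 pks2 inkinds n + (1 +
  (sweep_time pN.[n]%R blk cellB pks1 pks2 inkinds n + 1))))).

Local Notation W := (word pks1 pks2 inkinds).

Definition emission_out (x : seq bool) : seq bool :=
  let N := (pN.[size x])%R in let off := fun e => (poff e).[size x]%R in
  cells_out N off blk cellA 0 (W x) ++ [:: false] ++
  cells_out N off blk cellB 0 (W x) ++ [:: false].

Lemma run_emission x : 0 < pN.[size x]%R -> size (W x) = pN.[size x]%R ->
  exists2 s, out s = emission_out x
           & run emission (empty_store _ x) (emission_time (size x)) s.
Proof.
move=> N0 sW; eexists; last first.
  apply: (run_seq (s1 := Store (mkreg (size x) 0 0 0 (fun=> 0) (fun=> 0)) [::] x [::])).
    have -> : empty_store var x = Store (mkreg 0 0 0 0 (fun=> 0) (fun=> 0)) [::] x [::].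
      by congr Store; apply/ffunP => -[[[] []]|[e []]]; rewrite !ffunE.
    exact: run_count_input.
  apply: run_seq (run_load_modulus _ _ _ _) _.
  apply: run_seq (run_load_offsets _ _ _ N0) _.
  apply: run_seq (run_sweep _ _ _ _ _ _ _ _ _ _) _; first exact: N0.
  apply: (run_seq (T1 := 1)); first exact: run_emits.
  apply: run_seq (run_sweep _ _ _ _ _ _ _ _ _ _) _; first exact: N0.
  exact: run_emits.
(* The first pass writes exactly [N] cells, by [sW], so by periodicity the second one starts again
   from position 0. *)
rewrite /= /emission_out ?cat0s ?add0n sW -!catA; congr (_ ++ _).
by congr (_ ++ _); congr (_ ++ _); rewrite -[X in cells_out _ _ _ _ X _]addn0 cells_out_period.
Qed.

Lemma emission_time_bounded : poly_bounded emission_time.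
Proof.
have Ht (p : {poly nat}) := eval_time_bounded p.
have Hc cl : poly_bounded (fun n => cell_time pN.[n]%R blk cl) by rewrite /cell_time; poly_bound.
have Hr cl pks : poly_bounded (fun n => reps_time pN.[n]%R blk cl n pks).
  by elim: pks => [|[p k] pks IH] /=; poly_bound; first [exact: Ht|exact: Hc].
have Hl : poly_bounded load_offsets_time.
  rewrite /load_offsets_time; elim: (enum E) => [|e s IH] /=; poly_bound; exact: Ht.
by rewrite /emission_time; poly_bound; first [exact: Ht|exact: Hr].
Qed.

End Setup.

End Emission.

(** * Existence of minimum-cost Pareto-optimal matchings *)

Section Matchings.

Variable G : instance.
Implicit Types M N : edge_set G.

Lemma partnerAP M a b : is_matching M -> (a, b) \in M -> partnerA M a = Some b.
Proof.
move=> [_ HM] Hab; rewrite /partnerA; case: pickP => [b' Hb'|/(_ b)]; last by rewrite Hab.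
by have [->] := HM _ _ Hab Hb' (or_introl erefl).
Qed.

Lemma partnerBP M a b : is_matching M -> (a, b) \in M -> partnerB M b = Some a.
Proof.
move=> [_ HM] Hab; rewrite /partnerB; case: pickP => [a' Ha'|/(_ a)]; last by rewrite Hab.
by have [->] := HM _ _ Hab Ha' (or_intror erefl).
Qed.

Lemma partnerA_in M a b : partnerA M a = Some b -> (a, b) \in M.
Proof. by rewrite /partnerA; case: pickP => // b' Hb' [<-]. Qed.

Lemma partnerB_in M a b : partnerB M b = Some a -> (a, b) \in M.
Proof. by rewrite /partnerB; case: pickP => // b' Hb' [<-]. Qed.

Lemma phi_eq0 M N : phi M N = 0 <-> forall u, prefers u M N = false.
Proof.
split=> [/card0_eq H u|H]; first by have := H u; rewrite inE.
by apply: eq_card0 => u; rewrite inE H.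
Qed.

Lemma phi_gt0 M N : 0 < phi M N <-> exists u, prefers u M N.
Proof.
split=> [/card_gt0P [u Hu]|[u Hu]]; first by exists u; rewrite inE in Hu.
by apply/card_gt0P; exists u; rewrite inE.
Qed.

Definition utility (T : eqType) (pref : seq T) (p : option T) : nat :=
  if p is Some x then (size pref).+1 - index x pref else 0.

Lemma better_utility (T : eqType) (pref : seq T) p q :
  better pref p q -> utility pref q < utility pref p.
Proof.
case: p q => [x|] [y|] //=; last by have := index_size x pref; lia.
have := index_size y pref; lia.
Qed.

Lemma not_better_utility (T : eqType) (pref : seq T) p q :
  better pref p q = false -> utility pref p <= utility pref q.
Proof. by case: p q => [x|] [y|] //=; lia. Qed.

Definition node_utility M (u : 'I_(nA G) + 'I_(nB G)) : nat :=
  match u with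
  | inl a => utility (prefA a) (partnerA M a)
  | inr b => utility (prefB b) (partnerB M b)
  end.

(** A switch in which someone gains and no one loses strictly increases the total utility, which is
    bounded by [B]. *)
Lemma pareto_optimal_exists : exists M, pareto_optimal M.
Proof.
pose tot M := \sum_u node_utility M u.
pose B := \sum_(u : 'I_(nA G) + 'I_(nB G))
  (match u with inl a => (size (prefA a)).+1 | inr b => (size (prefB b)).+1 end).
have totB M : tot M <= B.
  apply: leq_sum => u _; rewrite /node_utility /utility.
  by case: u => [a|b]; [case: (partnerA M a)|case: (partnerB M b)] => // *; apply: leq_subr.
have lt M N : 0 < phi N M -> phi M N = 0 -> tot M < tot N.
  move=> /phi_gt0 [u0 Hu0] /phi_eq0 H2.
  rewrite /tot (bigD1 u0) //= [X in _ < X](bigD1 u0) //= -addSn; apply: leq_add.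
    by case: u0 Hu0 => [a|b] /=; apply: better_utility.
  apply: leq_sum => u _; have := H2 u.
  by case: u => [a|b] /=; apply: not_better_utility.
suff H k M : B - tot M < k -> is_matching M -> exists M', pareto_optimal M'.
  by apply: (H _ set0 (ltnSn _)); split=> [e|e f]; rewrite in_set0.
elim: k M => // k IH M Hk HM.
have [[N [HN H1 H2]]|H] := classic (exists N,
  [/\ is_matching N, 0 < phi N M & phi M N = 0]); last by exists M.
by apply: (IH N) HN; move: (lt _ _ H1 H2) (totB N); lia.
Qed.

(** [solves] binds the oracle only on inputs that have an answer; this provides one for every
    instance. *)
Lemma min_cost_pareto_exists : exists M, min_cost_pareto (G := G) M.
Proof.
have [M0 H0] := pareto_optimal_exists.
have [k] := ubnP (cost M0); elim: k M0 H0 => // k IH M H0 Hk.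
have [H|H] := classic (exists2 N : edge_set G, pareto_optimal N & cost N < cost M).
  by case: H => N HN lt; apply: (IH N HN); apply: leq_trans lt _; rewrite -ltnS.
exists M; split=> // N HN; rewrite leqNgt; apply/negP => lt.
by apply: H; exists N.
Qed.

End Matchings.

(** * The gadget graph *)

(** [next] runs through the enumeration as a single cycle. This drives the propagation arguments
    below, around variable cycles and clause rings. *)
Lemma next_enum_ind (T : finType) (P : T -> Prop) x0 :
  P x0 -> (forall x, P x -> P (next (enum T) x)) -> forall y, P y.
Proof.
move=> P0 Pn y.
have Hc := cycle_next (enum_uniq T).
have : fconnect (next (enum T)) x0 y by rewrite (fconnect_cycle Hc) mem_enum.
by move/iter_findex => <-; elim: (findex _ _ _) => //= n; apply: Pn.
Qed.

Lemma index_before (T : eqType) (z y : T) s1 s2 :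
  z \notin s1 -> index y (s1 ++ z :: s2) <= index z (s1 ++ z :: s2) ->
  y \in s1 \/ y = z.
Proof.
move=> Hz; rewrite !index_cat (negPf Hz) /= eqxx addn0.
case: ifP => [|_ ]; first by left.
by case: eqP => [->|_] H; [right|lia].
Qed.

Section Gadgets.

(** The clause at cell [u] reads bit [j] of the cells [u + delta d], and [eps d] represents
    [- delta d] modulo [N]. The patterns in [bad] are forbidden at every cell, and [forced] fixes
    single bits. *)
Variables (N : nat) (D J : finType) (delta eps : D -> nat).
Hypothesis delta_eps : forall d, (eps d + delta d) %% N = 0.
Hypothesis delta_inj : forall d d', delta d = delta d' %[mod N] -> d = d'.
Variable d1 : D.
Hypothesis card_lits : 1 < #|{: D * J}|.

Local Notation F := {ffun D * J -> bool}.
Variable bad : pred F.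
Variable forced : 'I_N -> J -> option bool.

Definition shift (v : 'I_N) (m : nat) : 'I_N :=
  Ordinal (ltn_pmod (v + m) (leq_ltn_trans (leq0n v) (ltn_ord v))).

Lemma shiftD v m m' : shift (shift v m) m' = shift v (m + m').
Proof. by apply: val_inj; rewrite /= modnDml addnA. Qed.

Lemma shift_eps v d m : shift v (eps d + delta d + m) = shift v m.
Proof. by apply: val_inj; rewrite /= addnCA -modnDml delta_eps add0n. Qed.

Lemma shift_id v d : shift v (eps d + delta d) = v.
Proof.
by apply: val_inj; rewrite /= -modnDmr delta_eps addn0 modn_small.
Qed.

Lemma shift_delta_inj v d d' : shift v (delta d) = shift v (delta d') -> d = d'.
Proof.
by move/(congr1 val) => /= /eqP; rewrite eqn_modDl => /eqP; apply: delta_inj.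
Qed.

Local Notation place := (F * D * bool)%type.
(** Bit [j] of cell [v] occurs, for each [f] and [d], as literal [(d, j)] of the clause with pattern
    [f] at cell [v - delta d]. Each occurrence owns two places, so different rings share no node. *)
Definition slot : finType := (J * place)%type.
Definition node : finType := ('I_N * slot)%type.

(* The cycle of the variable of cell [v] and index [j] visits the places
   [(c, false), (c, true), (next c, false), ...]; at each place sits a node of
   either side.  True joins the two nodes of each place, false joins the
   [B]-node of each place to the [A]-node of the following place. *)
Definition turn (p : place) : place :=
  let: (c, b) := p in if b then (next (enum {: F * D}) c, false) else (c, true).
Definition unturn (p : place) : place :=
  let: (c, b) := p in if b then (c, false) else (prev (enum {: F * D}) c, true).

Lemma turnK : cancel turn unturn.
Proof. by case=> c [] //=; rewrite prev_next ?enum_uniq. Qed.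
Lemma unturnK : cancel unturn turn.
Proof. by case=> c [] //=; rewrite next_prev ?enum_uniq. Qed.

Lemma turn_neq p : turn p != p.
Proof. by case: p => c []; rewrite /turn /= xpair_eqE andbF. Qed.

Lemma turn_ind (P : place -> Prop) p0 :
  P p0 -> (forall p, P p -> P (turn p)) -> forall p, P p.
Proof.
move=> P0 Pt.
have [c0 Pc0] : exists c, P (c, false).
  case: p0 P0 => c [] P0; last by exists c.
  by exists (next (enum {: F * D}) c); apply: (Pt (c, true)).
have Pf c : P (c, false).
  apply: (next_enum_ind (P := fun c => P (c, false)) Pc0) => c' H.
  by apply: (Pt (c', true)); apply: (Pt (c', false)).
by case=> c []; [apply: (Pt (c, false))|].
Qed.

Lemma unturn_ind (P : pred place) p0 :
  P p0 -> (forall p, P p -> P (unturn p)) -> forall p, P p.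
Proof.
move=> P0 Pu p; apply/negPn/negP => Hp.
suff : ~~ P p0 by rewrite P0.
apply: (turn_ind (P := fun q => ~~ P q) Hp) => q; apply: contra => /Pu.
by rewrite turnK.
Qed.

Definition fwd (x : node) : node := (x.1, (x.2.1, turn x.2.2)).
Definition bwd (x : node) : node := (x.1, (x.2.1, unturn x.2.2)).

Lemma fwdK : cancel fwd bwd.
Proof. by case=> v [j p]; rewrite /bwd /fwd /= turnK. Qed.
Lemma bwdK : cancel bwd fwd.
Proof. by case=> v [j p]; rewrite /bwd /fwd /= unturnK. Qed.
Lemma fwd_neq x : fwd x != x.
Proof. by case: x => v [j p]; rewrite /fwd !xpair_eqE !eqxx /= turn_neq. Qed.
Lemma bwd_neq x : bwd x != x.
Proof. by rewrite -{2}(bwdK x) eq_sym fwd_neq. Qed.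

Definition succ_lit (l : D * J) : D * J := next (enum {: D * J}) l.
Definition pred_lit (l : D * J) : D * J := prev (enum {: D * J}) l.

Lemma succ_litK : cancel succ_lit pred_lit.
Proof. by move=> l; rewrite /pred_lit prev_next ?enum_uniq. Qed.
Lemma pred_litK : cancel pred_lit succ_lit.
Proof. by move=> l; rewrite /succ_lit next_prev ?enum_uniq. Qed.

Lemma succ_lit_neq l : succ_lit l != l.
Proof.
apply/eqP => H.
have A (y : D * J) : y = l.
  by apply: (next_enum_ind (P := fun y => y = l) erefl) => x ->.
by move: card_lits; rewrite (eq_card1 (x := l)) // => y; rewrite !inE (A y) eqxx.
Qed.

(** The clause lies [eps d] further on, the next literal of its ring another [delta l.1]. The test
    on [b] picks the [A]-end of the matching edge for the forbidden value: the place of the [B]-node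
    for true, the following place for false. *)
Definition extA (x : node) : option node :=
  let: (v, (j, (f, d, b))) := x in
  if bad f && (b == ~~ f (d, j)) then
    let l := succ_lit (d, j) in
    Some (shift v (eps d + delta l.1), (l.2, (f, l.1, false)))
  else None.

Definition extB (y : node) : option node :=
  let: (v, (j, (f, d, b))) := y in
  if bad f && ~~ b then
    let l := pred_lit (d, j) in
    Some (shift v (eps d + delta l.1), (l.2, (f, l.1, ~~ f l)))
  else None.

(* The matching edge [occA u f l -- occB u f l] is present iff the variable of
   literal [l] of the clause [(u, f)] has the forbidden value [f l]. *)
Definition occA (u : 'I_N) (f : F) (l : D * J) : node :=
  (shift u (delta l.1), (l.2, (f, l.1, ~~ f l))).
Definition occB (u : 'I_N) (f : F) (l : D * J) : node :=
  (shift u (delta l.1), (l.2, (f, l.1, false))).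

Lemma extA_occ u f l : bad f -> extA (occA u f l) = Some (occB u f (succ_lit l)).
Proof.
case: l => d j bf; rewrite /extA /occA /= bf eqxx /=; congr (Some (_, _)).
by rewrite shiftD addnA [delta d + _]addnC shift_eps.
Qed.

Lemma extB_occ u f l : bad f -> extB (occB u f l) = Some (occA u f (pred_lit l)).
Proof.
case: l => d j bf; rewrite /extB /occB /= bf /=; congr (Some (_, _)).
by rewrite shiftD addnA [delta d + _]addnC shift_eps.
Qed.

Lemma extAP x y : extA x = Some y ->
  exists u f l, [/\ bad f, x = occA u f l & y = occB u f (succ_lit l)].
Proof.
case: x => v [j [[f d] b]] /=; case: ifP => // /andP [bf /eqP ->] [<-].
exists (shift v (eps d)), f, (d, j); split=> //.
  by rewrite /occA /= shiftD shift_id.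
by rewrite /occB /= shiftD.
Qed.

Lemma extBP x y : extB y = Some x ->
  exists u f l, [/\ bad f, x = occA u f l & y = occB u f (succ_lit l)].
Proof.
case: y => v [j [[f d] b]] /=; case: ifP => // /andP [bf /negPf ->] [<-].
exists (shift v (eps d)), f, (pred_lit (d, j)); split=> //.
  by rewrite /occA /= shiftD.
by rewrite /occB pred_litK /= shiftD shift_id.
Qed.

Lemma ext_sym x y : (extA x == Some y) = (extB y == Some x).
Proof.
apply/eqP/eqP => [/extAP|/extBP] [u [f [l [bf -> ->]]]].
  by rewrite extB_occ // succ_litK.
by rewrite extA_occ.
Qed.

(** Consecutive literals of a ring differ; if their cells agree, [delta_inj] makes the directions
    agree, so the bit indices differ. Thus ring edges never coincide with edges inside a gadget, and
    the preference lists have no repetitions. *)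
Lemma ext_gadget x y : extA x = Some y -> (x.1, x.2.1) != (y.1, y.2.1).
Proof.
move=> /extAP [u [f [l [_ -> ->]]]]; rewrite /occA /occB /=.
apply/eqP => -[H1 H2].
have Hd : l.1 = (succ_lit l).1 by apply: (@shift_delta_inj u); apply: val_inj.
have := succ_lit_neq l; rewrite (surjective_pairing (succ_lit l)) -Hd -H2.
by rewrite -surjective_pairing eqxx.
Qed.

Definition zero_slot (s s' : slot) : bool :=
  (s == s') || (s == (s'.1, turn s'.2)).

(** Zero cost is decided by the slots alone, so a ring edge must differ from cycle edges there. Its
    [B]-end has [b = false], and the zero-cost edges of such a node keep direction and bit index,
    one of which changes along the ring. *)
Lemma ext_slot x y : extA x = Some y -> ~~ zero_slot x.2 y.2.
Proof.
move=> /extAP [u [f [l [_ -> ->]]]]; rewrite /zero_slot /occA /occB /=.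
have := succ_lit_neq l; case: l (succ_lit l) => d j [d' j'] ne.
apply/norP; split; apply/eqP => -[E1 E2 _]; by move: ne; rewrite E1 E2 eqxx.
Qed.

(** A forced bit loses all cycle edges of the other truth value; this takes the place of unit
    clauses. *)
Definition allowT (x : node) : bool := forced x.1 x.2.1 != Some false.
Definition allowF (x : node) : bool := forced x.1 x.2.1 != Some true.

Definition gadget (x : node) : seq node :=
  [seq (x.1, (x.2.1, p)) | p <- enum {: place}].

Lemma mem_gadget x y : (y \in gadget x) = ((x.1, x.2.1) == (y.1, y.2.1)).
Proof.
apply/mapP/eqP => [[p _ ->] //|]; case: x y => v [j p] [v' [j' p']] /= [-> ->].
by exists p' => //; rewrite mem_enum.
Qed.

Lemma gadget_uniq x : uniq (gadget x).
Proof. by rewrite map_inj_uniq ?enum_uniq // => p p' []. Qed.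

Definition rest (x z : node) : seq node :=
  [seq y <- gadget x | (y != x) && (y != z)].

Definition listA (x : node) : seq node :=
  seq_of_opt (extA x) ++ (if allowT x then [:: x] else [::]) ++
  (if allowF x then [:: bwd x] else [::]) ++ rest x (bwd x).

Definition listB (y : node) : seq node :=
  seq_of_opt (extB y) ++ (if allowF y then [:: fwd y] else [::]) ++
  (if allowT y then [:: y] else [::]) ++ rest y (fwd y).

Definition inner (x y : node) : bool :=
  ((x.1, x.2.1) == (y.1, y.2.1)) &&
  (if x == y then allowT x else if x == fwd y then allowF x else true).

Lemma mem_listA x y : (y \in listA x) = (extA x == Some y) || inner x y.
Proof.
rewrite /listA !mem_cat; congr (_ || _).
  by case: (extA x) => [z|] //=; rewrite mem_seq1 eq_sym; apply/eqP/eqP => [->|[->]].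
rewrite mem_filter mem_gadget /inner.
have -> : (x == fwd y) = (y == bwd x).
  by apply/eqP/eqP => ->; rewrite ?fwdK ?bwdK.
case: (boolP (x == y)) => [/eqP <-|ne].
  rewrite !eqxx /=.
  by case: (allowT x); case: (allowF x); rewrite /= ?mem_seq1 ?eqxx ?(eq_sym x) ?(negPf (bwd_neq x)).
have ne' : y == x = false by rewrite eq_sym (negPf ne).
case: (boolP (y == bwd x)) => [/eqP ->|ne2].
  by rewrite /= eqxx andbF /= orbF; case: (allowT x); case: (allowF x);
    rewrite /= ?mem_seq1 ?eqxx // (negPf (bwd_neq x)).
by rewrite ne' /=; case: (allowT x); case: (allowF x);
  rewrite /= ?mem_seq1 ?ne' ?(negPf ne2) ?andbT.
Qed.

Lemma mem_listB x y : (x \in listB y) = (extA x == Some y) || inner x y.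
Proof.
rewrite ext_sym /listB !mem_cat; congr (_ || _).
  by case: (extB y) => [z|] //=; rewrite mem_seq1 eq_sym; apply/eqP/eqP => [->|[->]].
rewrite mem_filter mem_gadget /inner [(y.1, _) == _]eq_sym.
have [Eg|] := eqVneq (x.1, x.2.1) (y.1, y.2.1); last first.
  move=> ng; rewrite andbF orbF; apply/negbTE; apply: contra ng.
  case: (allowT y); case: (allowF y); rewrite /= ?mem_seq1.
  - by case/orP => /eqP ->.
  - by move/eqP => ->.
  - by rewrite orbF => /eqP ->.
  - by [].
have [aT aF] : allowT x = allowT y /\ allowF x = allowF y.
  by case: Eg => E1 E2; rewrite /allowT /allowF E1 E2.
rewrite andbT /= aT aF.
case: (boolP (x == y)) => [/eqP ->|ne].
  rewrite /=; case: (allowT y); case: (allowF y);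
    by rewrite /= ?mem_seq1 ?eqxx ?orbT // eq_sym (negPf (fwd_neq y)).
case: (boolP (x == fwd y)) => [/eqP ->|ne2] /=.
  case: (allowT y); case: (allowF y);
    by rewrite /= ?mem_seq1 ?eqxx // (negPf (fwd_neq y)).
by rewrite !orbT.
Qed.

Lemma listA_uniq x : uniq (listA x).
Proof.
rewrite /listA /rest.
have H1 : uniq ((if allowT x then [:: x] else [::]) ++
   (if allowF x then [:: bwd x] else [::]) ++
   [seq y <- gadget x | (y != x) && (y != bwd x)]).
  have U := filter_uniq (fun y => (y != x) && (y != bwd x)) (gadget_uniq x).
  case: (allowT x); case: (allowF x) => //=; rewrite ?inE ?mem_filter ?eqxx ?andbF //=;
    by rewrite U // eq_sym (negPf (bwd_neq x)).
case E: (extA x) => [z|] //=; rewrite H1 andbT.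
have := ext_gadget E; have := mem_listA x z; rewrite /listA E /= inE eqxx /=.
rewrite !mem_cat mem_filter mem_gadget => _ /negPf -> ; rewrite andbF orbF.
have ng := ext_gadget E.
by apply/norP; split; [case: (allowT x)|case: (allowF x)] => //=;
  rewrite mem_seq1; apply: contra ng => /eqP ->.
Qed.

Lemma listB_uniq y : uniq (listB y).
Proof.
rewrite /listB /rest.
have H1 : uniq ((if allowF y then [:: fwd y] else [::]) ++
   (if allowT y then [:: y] else [::]) ++
   [seq z <- gadget y | (z != y) && (z != fwd y)]).
  have U := filter_uniq (fun z => (z != y) && (z != fwd y)) (gadget_uniq y).
  case: (allowT y); case: (allowF y) => //=; rewrite ?inE ?mem_filter ?eqxx ?andbF //=;
    by rewrite U // (negPf (fwd_neq y)).
case E: (extB y) => [z|] //=; rewrite H1 andbT.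
have ng : (z.1, z.2.1) != (y.1, y.2.1).
  by apply: ext_gadget; apply/eqP; rewrite ext_sym E.
rewrite !mem_cat mem_filter mem_gadget [(y.1, _) == _]eq_sym (negPf ng) andbF orbF.
by apply/norP; split; [case: (allowF y)|case: (allowT y)] => //=;
  rewrite mem_seq1; apply: contra ng => /eqP ->.
Qed.

(** * The instance *)

Definition nslots : nat := #|slot|.

Lemma node_index_subproof (x : node) : x.1 * nslots + enum_rank x.2 < N * nslots.
Proof.
apply: (@leq_trans (x.1 * nslots + nslots)); first by rewrite ltn_add2l.
by rewrite addnC -mulSn leq_mul2r ltn_ord orbT.
Qed.

Definition code_node (x : node) : 'I_(N * nslots) := Ordinal (node_index_subproof x).

Lemma nslots_gt0 (a : 'I_(N * nslots)) : 0 < nslots.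
Proof. by have := leq_ltn_trans (leq0n a) (ltn_ord a); rewrite muln_gt0 => /andP []. Qed.

Lemma cell_of_subproof (a : 'I_(N * nslots)) : a %/ nslots < N.
Proof. by rewrite ltn_divLR ?(nslots_gt0 a). Qed.

Definition node_of (a : 'I_(N * nslots)) : node :=
  (Ordinal (cell_of_subproof a), enum_val (Ordinal (ltn_pmod a (nslots_gt0 a)))).

Lemma code_nodeK : cancel code_node node_of.
Proof.
case=> v s; rewrite /node_of /code_node; congr pair.
  apply: val_inj => /=; rewrite divnMDl ?(divn_small (ltn_ord (enum_rank s))) ?addn0 //.
  exact: leq_ltn_trans (ltn_ord (enum_rank s)).
rewrite -[RHS]enum_rankK; congr enum_val; apply: val_inj => /=.
by rewrite modnMDl modn_small //; apply: (ltn_ord (enum_rank s)).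
Qed.

Lemma node_ofK : cancel node_of code_node.
Proof.
by move=> a; apply: val_inj; rewrite /= enum_valK /= -divn_eq.
Qed.

Definition code_inj := can_inj code_nodeK.

Lemma mem_map_code (s : seq node) a : (a \in map code_node s) = (node_of a \in s).
Proof. by rewrite -{1}(node_ofK a) (mem_map code_inj). Qed.

Definition pareto_instance : instance.
Proof.
refine (@Instance (N * nslots) (N * nslots)
  (fun a b => node_of b \in listA (node_of a))
  (fun a => map code_node (listA (node_of a)))
  (fun b => map code_node (listB (node_of b)))
  (fun a b => ~~ zero_slot (node_of a).2 (node_of b).2) _ _ _ _).
- by move=> a; rewrite (map_inj_uniq code_inj) listA_uniq.
- by move=> b; rewrite (map_inj_uniq code_inj) listB_uniq.
- by move=> a b; rewrite mem_map_code.
- by move=> a b; rewrite mem_map_code mem_listA mem_listB.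
Defined.

Local Notation PG := pareto_instance.
Implicit Types (M : edge_set PG).

Definition satisfies (X : 'I_N -> J -> bool) : Prop :=
  (forall v j b, forced v j = Some b -> X v j = b) /\
  (forall u f, bad f -> exists l, X (shift u (delta l.1)) l.2 != f l).

Definition joined M (x y : node) : bool := (code_node x, code_node y) \in M.

(** * A satisfying assignment gives a Pareto-optimal matching of cost 0 *)

Section Soundness.

Variable X : 'I_N -> J -> bool.
Hypothesis HX : satisfies X.

Local Notation Xat x := (X x.1 x.2.1).

Definition mate (x : node) : node := if Xat x then x else bwd x.
Definition comate (y : node) : node := if Xat y then y else fwd y.

Lemma mateK : cancel mate comate.
Proof.
move=> x; rewrite /mate /comate; case E: (Xat x); rewrite ?E //=.
by rewrite bwdK.
Qed.

Lemma comateK : cancel comate mate.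
Proof.
move=> y; rewrite /mate /comate; case E: (Xat y); rewrite ?E //=.
by rewrite fwdK.
Qed.

Definition truth_matching : edge_set PG :=
  [set e | node_of e.2 == mate (node_of e.1)].

Lemma joined_truth x y : joined truth_matching x y = (y == mate x).
Proof. by rewrite /joined inE /= !code_nodeK. Qed.

Lemma inner_mate x : inner x (mate x).
Proof.
have [Hf _] := HX; rewrite /inner /mate; case E: (Xat x).
  by rewrite !eqxx /=; apply/eqP => /Hf; rewrite E.
rewrite bwdK eqxx /= eq_sym (negPf (bwd_neq x)) eqxx /=.
by apply/eqP => /Hf; rewrite E.
Qed.

Lemma truth_is_matching : is_matching truth_matching.
Proof.
split=> [[a b]|[a b] [a' b']] /=; rewrite !inE /=.
  by move=> /eqP ->; rewrite mem_listA inner_mate orbT.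
move=> /eqP Eb /eqP Eb' H.
have Ea : node_of a = node_of a'.
  case: H => [-> //|H]; apply: (can_inj mateK); rewrite -Eb -Eb'; by rewrite H.
have Ea' : a = a' by apply: (can_inj node_ofK).
by rewrite Ea'; congr pair; apply: (can_inj node_ofK); rewrite Eb Eb' Ea.
Qed.

Lemma zero_mate x : zero_slot x.2 (mate x).2.
Proof.
rewrite /zero_slot /mate; case: (Xat x); rewrite ?eqxx //=.
by rewrite unturnK -surjective_pairing eqxx orbT.
Qed.

Lemma cost_truth : cost truth_matching = 0.
Proof.
apply: big1 => -[a b]; rewrite inE => /eqP H.
have {}H : node_of b = mate (node_of a) by [].
rewrite -[LHS]/(nat_of_bool (~~ zero_slot (node_of a).2 (node_of b).2)).
by rewrite H zero_mate.
Qed.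

Lemma before_mate x y :
  index y (listA x) <= index (mate x) (listA x) ->
  [\/ extA x = Some y, y = x | y = mate x].
Proof.
move=> H; have Hm : mate x \in listA x by rewrite mem_listA inner_mate orbT.
suff : [\/ y \in seq_of_opt (extA x), y = x | y = mate x].
  case=> [Hy|Hy|Hy]; [apply: Or31|exact: Or32|exact: Or33].
  by case: (extA x) Hy => //= z; rewrite mem_seq1 => /eqP ->.
have aM : (if Xat x then allowT x else allowF x).
  have [Hf _] := HX; case E: (Xat x); by apply/eqP => /Hf; rewrite E.
have ne z : (x.1, x.2.1) = (z.1, z.2.1) -> z \notin seq_of_opt (extA x).
  move=> Ez; case Ex: (extA x) => [w|] //=; rewrite mem_seq1.
  by apply: contraNneq (ext_gadget Ex) => <-; apply/eqP.
move: H aM; rewrite /listA /mate; case E: (Xat x) => H aM.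
  rewrite aM /= in H; have [||] := index_before _ H; first exact: ne.
    by move=> ?; apply: Or31.
  by move=> ?; apply: Or32.
rewrite aM /= catA in H; have [||] := index_before _ H.
- rewrite mem_cat negb_or ne //=; case: (allowT x) => //=.
  by rewrite mem_seq1 bwd_neq.
- rewrite mem_cat => /orP [?|]; first exact: Or31.
  by case: (allowT x) => //=; rewrite mem_seq1 => /eqP; apply: Or32.
- by move=> ?; apply: Or33.
Qed.

(** When the bit is false, an [A]-node would like to move to its true edge; the [B]-node there would
    lose, as it ranks false before true. *)
Lemma before_comate x y : Xat y = false ->
  index x (listB y) <= index (comate y) (listB y) ->
  extB y = Some x \/ x = fwd y.
Proof.
move=> E; have [Hf _] := HX.
have aM : allowF y by apply/eqP => /Hf; rewrite E.
rewrite /comate E /listB aM /= => H; have [||] := index_before _ H.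
- case Ex: (extB y) => [w|] //=; rewrite mem_seq1.
  have : (w.1, w.2.1) != (y.1, y.2.1).
    by apply: ext_gadget; apply/eqP; rewrite ext_sym Ex.
  by apply: contraNneq => <-.
- by case: (extB y) => //= z; rewrite mem_seq1 => /eqP ->; left.
- by right.
Qed.

Lemma truth_partnerA x : partnerA truth_matching (code_node x) = Some (code_node (mate x)).
Proof.
by apply: partnerAP; [exact: truth_is_matching|rewrite -/(joined _ _ _) joined_truth].
Qed.

Lemma truth_partnerB y : partnerB truth_matching (code_node y) = Some (code_node (comate y)).
Proof.
apply: partnerBP; first exact: truth_is_matching.
by rewrite -/(joined _ _ _) joined_truth comateK.
Qed.

(** Let [M] make somebody better off and nobody worse off. All nodes are matched in the truth
    matching, hence in [M]. A cycle edge of the other value hurts one of its ends, so every changed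
    edge is a ring edge. The [B]-node of a ring edge has left its former partner, who must be
    matched again, once more by a ring edge; so the change runs around the whole ring, and all its
    literals have their forbidden values. *)
Lemma truth_pareto : pareto_optimal truth_matching.
Proof.
split; first exact: truth_is_matching.
case=> M [HM Hgt /phi_eq0 Heq].
have HA x : exists2 y, joined M x y & index y (listA x) <= index (mate x) (listA x).
  have := Heq (inl (code_node x)); rewrite /= truth_partnerA code_nodeK.
  case E: (partnerA M (code_node x)) => [b|] //.
  rewrite -(node_ofK b) /= !(index_map code_inj).
  move/negbT; rewrite -leqNgt => le; exists (node_of b) => //.
  by rewrite /joined node_ofK; apply: partnerA_in.
have HB y : exists2 x, joined M x y & index x (listB y) <= index (comate y) (listB y).
  have := Heq (inr (code_node y)); rewrite /= truth_partnerB code_nodeK.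
  case E: (partnerB M (code_node y)) => [a|] //.
  rewrite -(node_ofK a) /= !(index_map code_inj).
  move/negbT; rewrite -leqNgt => le; exists (node_of a) => //.
  by rewrite /joined node_ofK; apply: partnerB_in.
have funA x y y' : joined M x y -> joined M x y' -> y = y'.
  move=> H1 H2; have [_ /(_ _ _ H1 H2 (or_introl erefl)) E] := HM.
  exact: code_inj (congr1 snd E).
have funB x x' y : joined M x y -> joined M x' y -> x = x'.
  move=> H1 H2; have [_ /(_ _ _ H1 H2 (or_intror erefl)) E] := HM.
  exact: code_inj (congr1 fst E).
(* An edge of [M] off the truth matching must be a clause edge. *)
have Hext x y : joined M x y -> y != mate x -> extA x = Some y.
  move=> Hxy ne; have [y' Hy' le] := HA x.
  rewrite -{}(funA _ _ _ Hxy Hy') in le.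
  case: (before_mate le) => // Ey; last by rewrite Ey eqxx in ne.
  subst y; move: ne; rewrite /mate; case E: (Xat x); rewrite ?eqxx // => ne.
  have [x' Hx' le'] := HB x; rewrite -{}(funB _ _ _ Hxy Hx') in le'.
  case: (before_comate E le') => H; last by have := fwd_neq x; rewrite -H eqxx.
  by apply/eqP; rewrite ext_sym H.
have [x0 [y0 [H0 ne0]]] : exists x y, joined M x y /\ y != mate x.
  have [[a|b]] := (phi_gt0 _ _).1 Hgt; rewrite /prefers.
    rewrite -(node_ofK a) truth_partnerA; have [y Hy _] := HA (node_of a).
    rewrite (partnerAP HM Hy) => /= H; exists (node_of a), y; split=> //.
    by apply/eqP => E; rewrite E ltnn in H.
  rewrite -(node_ofK b) truth_partnerB; have [x Hx _] := HB (node_of b).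
  rewrite (partnerBP HM Hx) => /= H; exists x, (node_of b); split=> //.
  by apply/eqP => E; rewrite E mateK ltnn in H.
have [u [f [l0 [bf Ex0 Ey0]]]] := extAP (Hext _ _ H0 ne0).
pose Q l := joined M (occA u f l) (occB u f (succ_lit l)).
(* The old partner of the [B]-node can leave only along a ring edge, and such an edge starts at the
   [A]-end for the value [f (succ_lit l)]; this reveals the bit. *)
have step l : Q l -> X (shift u (delta (succ_lit l).1)) (succ_lit l).2 = f (succ_lit l)
                     /\ Q (succ_lit l).
  rewrite /Q; set y := occB u f (succ_lit l) => Hl.
  have Eext := extA_occ u l bf; rewrite -/y in Eext.
  have ney : y != mate (occA u f l).
    apply: contraNneq (ext_gadget Eext) => ->; rewrite /mate.
    by case: (Xat (occA u f l)).
  have nex : occA u f l != comate y.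
    by apply: contraNneq ney => ->; rewrite comateK.
  have [y' Hy' _] := HA (comate y).
  have ney' : y' != mate (comate y).
    rewrite comateK; apply: contraNneq nex => E; rewrite E in Hy'.
    by apply/eqP; apply: funB Hl Hy'.
  have Ex' := Hext _ _ Hy' ney'.
  have Xl : X (shift u (delta (succ_lit l).1)) (succ_lit l).2 = f (succ_lit l).
    move: Ex'; rewrite /comate /y /occB /=.
    case: (succ_lit l) => d j; case: (X _ _) => /=; case: ifP => // /andP [_ /eqP].
      by case: (f (d, j)).
    by case: (f (d, j)).
  split=> //.
  have Ec : comate y = occA u f (succ_lit l).
    rewrite /comate /y /occB /= Xl /occA; case: (f (succ_lit l)) => //=.
  rewrite -Ec; suff -> : occB u f (succ_lit (succ_lit l)) = y' by [].
  by move: Ex'; rewrite Ec extA_occ // => -[].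
have Qall l : Q l.
  apply: (next_enum_ind (P := Q) (x0 := l0)); first by rewrite /Q -Ex0 -Ey0.
  by move=> l' /step [].
have [_ /(_ u f bf) [l]] := HX.
by have [] := step _ (Qall (pred_lit l)); rewrite pred_litK => ->; rewrite eqxx.
Qed.

End Soundness.

(** * A Pareto-optimal matching of cost 0 gives a satisfying assignment *)

Section Completeness.

Variable M : edge_set PG.
Hypothesis HP : pareto_optimal M.
Hypothesis HC : cost M = 0.

Let HM : is_matching M := HP.1.

Lemma joined_inner x y : joined M x y ->
  (x = y /\ allowT x) \/ (x = fwd y /\ allowF x).
Proof.
move=> Hxy; have := HM.1 _ Hxy; rewrite /= !code_nodeK mem_listA.
have Hz : zero_slot x.2 y.2.
  rewrite -{1}(code_nodeK x) -{1}(code_nodeK y); move: HC => /eqP.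
  rewrite /cost sum_nat_eq0 => /forallP /(_ (code_node x, code_node y)) /implyP /(_ Hxy).
  by rewrite eqb0 => /negPn.
case/orP=> [/eqP /ext_slot|]; first by rewrite Hz.
case/andP => /eqP [E1 E2].
case: (x =P y) => [->|ne]; first by move=> h; left.
case: (x =P fwd y) => [->|ne2]; first by move=> h; right.
move=> _.
exfalso; move: Hz; rewrite /zero_slot; case/orP=> /eqP Es.
  by apply: ne; rewrite (surjective_pairing x) (surjective_pairing y) E1 Es.
by apply: ne2; rewrite /fwd (surjective_pairing x) E1 Es.
Qed.

Lemma joined_funA x y y' : joined M x y -> joined M x y' -> y = y'.
Proof.
move=> H1 H2; have [_ /(_ _ _ H1 H2 (or_introl erefl)) E] := HM.
exact: code_inj (congr1 snd E).
Qed.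

Lemma joined_funB x x' y : joined M x y -> joined M x' y -> x = x'.
Proof.
move=> H1 H2; have [_ /(_ _ _ H1 H2 (or_intror erefl)) E] := HM.
exact: code_inj (congr1 fst E).
Qed.

(** Adding the edge would help both ends and change nothing for the others. *)
Lemma unmatched_adjacent x y : inner x y ->
  (forall y', ~~ joined M x y') -> (forall x', ~~ joined M x' y) -> False.
Proof.
move=> Hxy Hx Hy; apply: HP.2.
have fx b : (code_node x, b) \notin M by rewrite -(node_ofK b); apply: Hx.
have fy a : (a, code_node y) \notin M by rewrite -(node_ofK a); apply: Hy.
pose N' : edge_set PG := (code_node x, code_node y) |: M.
have HN : is_matching N'.
  split=> [e|e e']; rewrite !inE.
    case/orP=> [/eqP ->|]; last exact: HM.1.
    by rewrite /= !code_nodeK mem_listA Hxy orbT.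
  case/orP=> [/eqP ->|He]; case/orP=> [/eqP ->|He'] //=.
  - by case=> E; move: He'; rewrite (surjective_pairing e') -E;
      [rewrite (negPf (fx _))|rewrite (negPf (fy _))].
  - by case=> E; move: He; rewrite (surjective_pairing e) E;
      [rewrite (negPf (fx _))|rewrite (negPf (fy _))].
  - exact: HM.2.
have pA a : partnerA N' a = if a == code_node x then Some (code_node y) else partnerA M a.
  case: eqP => [->|ne]; first by apply: partnerAP => //; rewrite !inE eqxx.
  apply: eq_pick => b; rewrite !inE /= xpair_eqE; by case: (a =P _) => // /ne.
have pB b : partnerB N' b = if b == code_node y then Some (code_node x) else partnerB M b.
  case: eqP => [->|ne]; first by apply: partnerBP => //; rewrite !inE eqxx.
  apply: eq_pick => a; rewrite !inE /= xpair_eqE; by case: (b =P _) => [/ne|]; rewrite ?andbF.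
have mA : partnerA M (code_node x) = None.
  by rewrite /partnerA; case: pickP => // b Hb; move: (fx b); rewrite Hb.
have mB : partnerB M (code_node y) = None.
  by rewrite /partnerB; case: pickP => // a Ha; move: (fy a); rewrite Ha.
have irr (T : eqType) (s : seq T) p : better s p p = false.
  by case: p => //= z; rewrite ltnn.
exists N'; split=> //.
  by apply/phi_gt0; exists (inl (code_node x)); rewrite /= pA eqxx mA.
apply/phi_eq0 => -[a|b] /=; [rewrite pA|rewrite pB]; case: eqP => [->|_];
  by rewrite ?mA ?mB ?irr.
Qed.

(** For a forced bit, [y] has a single cycle edge and so has its other end, which is then free as
    well. Otherwise some [A]-node of the same cycle is free, and the gadget contains an edge from it
    to [y]. *)
Lemma matchedB y : exists x, joined M x y.
Proof.
apply: NNPP => H.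
have Hy x : ~~ joined M x y by apply/negP => h; apply: H; exists x.
case Ef: (forced y.1 y.2.1) => [[]|].
- apply: (@unmatched_adjacent y y) => //; first by rewrite /inner !eqxx /= /allowT Ef.
  move=> y'; apply/negP => h; case: (joined_inner h) => [[E _]|[E]].
    by move: (Hy y); rewrite {2}E h.
  by rewrite /allowF Ef.
- apply: (@unmatched_adjacent (fwd y) y) => //.
    by rewrite /inner !eqxx /= (negPf (fwd_neq y)) /allowF /= Ef.
  move=> y'; apply/negP => h; case: (joined_inner h) => [[E]|[E _]].
    by rewrite /allowT /= Ef.
  by move: (Hy (fwd y)); rewrite {2}(can_inj fwdK E) h.
(* Were all [A]-nodes of the cycle matched, the one at the place of [y] would use its false edge,
   which takes the true partner of the preceding one, and so on around the cycle, until the [A]-node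
   after [y] is matched to [y]. *)
have [x [Hg Hx]] : exists x, (x.1, x.2.1) = (y.1, y.2.1) /\ forall y', ~~ joined M x y'.
  apply: NNPP => Hn.
  have Hall p : exists y', joined M (y.1, (y.2.1, p)) y'.
    apply: NNPP => h; apply: Hn; exists (y.1, (y.2.1, p)); split=> // y'.
    by apply/negP => h'; apply: h; exists y'.
  pose P p := joined M (y.1, (y.2.1, p)) (bwd (y.1, (y.2.1, p))).
  have Ey : y = (y.1, (y.2.1, y.2.2)) by case: (y) => ? [? ?].
  have P0 : P y.2.2.
    have [y' h] := Hall y.2.2; case: (joined_inner h) => [[E _]|[E _]].
      by rewrite -E -{2}Ey (negPf (Hy _)) in h.
    by rewrite /P E fwdK -E.
  have Pu p : P p -> P (unturn p).
    move=> hp; have [y' h] := Hall (unturn p); case: (joined_inner h) => [[E _]|[E _]].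
      rewrite -{}E in h; have := joined_funB h hp.
      by case=> Ep; have := turn_neq (unturn p); rewrite unturnK Ep eqxx.
    by rewrite /P E fwdK -E.
  have := unturn_ind P0 Pu (turn y.2.2).
  rewrite /P -[(_, (_, turn _))]/(fwd y) fwdK; by move: (Hy (fwd y)) => /negPf ->.
apply: (@unmatched_adjacent x y) => //.
rewrite /inner Hg eqxx /allowT /allowF /=; case: Hg => -> ->; rewrite Ef.
by case: ifP => // _; case: ifP.
Qed.

Definition truth_of (v : 'I_N) (j : J) : bool :=
  [exists p : place, joined M (v, (j, p)) (v, (j, p))].

(** If a true edge occurs at [q], the preceding [B]-node cannot use its false edge, whose [A]-end is
    taken; so true edges spread backwards over the cycle. If none occurs, every [B]-node, being
    matched, uses its false edge. *)
Lemma joined_truth_of v j p :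
  if truth_of v j then joined M (v, (j, p)) (v, (j, p))
  else joined M (v, (j, turn p)) (v, (j, p)).
Proof.
case: ifP => [/existsP [p0 H0]|/negbT H].
  apply: (unturn_ind (P := fun p => joined M (v, (j, p)) (v, (j, p))) H0) => q hq.
  have [x hx] := matchedB (v, (j, unturn q)).
  case: (joined_inner hx) => [[E _]|[E _]]; first by rewrite E in hx.
  rewrite E /fwd /= unturnK in hx; have := joined_funA hq hx.
  by case=> Ep; have := turn_neq (unturn q); rewrite unturnK -Ep eqxx.
have [x hx] := matchedB (v, (j, p)).
case: (joined_inner hx) => [[E _]|[E _]]; last by rewrite E in hx.
by case/existsP: H; exists p; rewrite E in hx.
Qed.

(** A forced value is obeyed since the gadget has no cycle edge of the other value. For a violated
    clause all occurrence edges would be in [M]; exchanging them for the ring edges gives both ends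
    their first choice and leaves all other partners alone. *)
Lemma truth_of_satisfies : satisfies truth_of.
Proof.
split=> [v j b Ef|u f bf].
  (* Any place of the cycle tells which value is used; [d1] ensures that there is one. *)
  have p : place := ([ffun=> false], d1, false).
  have := joined_truth_of v j p; case: ifP => _ h; case: (joined_inner h) => [[E]|[E]].
  - by rewrite /allowT /= Ef; case: (b).
  - by have := fwd_neq (v, (j, p)); rewrite -E eqxx.
  - by case: E => E; have := turn_neq p; rewrite E eqxx.
  - by rewrite /allowF /= Ef; case: (b).
apply: NNPP => Hn.
have Hf l : truth_of (shift u (delta l.1)) l.2 = f l.
  by case: (truth_of (shift u (delta l.1)) l.2 =P f l) => // /eqP h; case: Hn; exists l.
have Hocc l : joined M (occA u f l) (occB u f l).
  have := joined_truth_of (shift u (delta l.1)) l.2 (f, l.1, false).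
  by rewrite Hf /occA; case: (f l).
apply: HP.2.
pose isA x := [exists l, x == occA u f l].
have isAP x : reflect (exists l, x = occA u f l) (isA x).
  by apply: (iffP existsP) => -[l /eqP]; exists l => //; apply/eqP.
pose nj x y := if isA x then extA x == Some y else joined M x y.
pose N' : edge_set PG := [set e | nj (node_of e.1) (node_of e.2)].
have jN x y : joined N' x y = if isA x then extA x == Some y else joined M x y.
  by rewrite [joined N' x y]inE -[RHS]/(nj x y) !code_nodeK.
have NM a b : (a, b) \in N' = joined N' (node_of a) (node_of b).
  by rewrite /joined !node_ofK.
have MM a b : (a, b) \in M = joined M (node_of a) (node_of b).
  by rewrite /joined !node_ofK.
have fA x y y' : joined N' x y -> joined N' x y' -> y = y'.
  rewrite !jN; case: ifP => _; last exact: joined_funA.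
  by move=> /eqP -> /eqP [].
(* A [B]-node of the ring was matched in [M] to a ring [A]-node, so no kept edge collides with a new
   one. *)
have fB x x' y : joined N' x y -> joined N' x' y -> x = x'.
  rewrite !jN; case: (isAP x) => [[l Ex]|nx]; case: (isAP x') => [[l' Ex']|nx'].
  - by rewrite !ext_sym => /eqP -> /eqP [].
  - rewrite Ex extA_occ // => /eqP [Ey]; rewrite -Ey => h.
    by case: nx'; exists (succ_lit l); apply: joined_funB h (Hocc _).
  - rewrite Ex' extA_occ // => h /eqP [Ey]; rewrite -Ey in h.
    by case: nx; exists (succ_lit l'); apply: joined_funB h (Hocc _).
  - exact: joined_funB.
have HN : is_matching N'.
  split=> [[a b]|[a b] [a' b']]; rewrite !NM.
    rewrite jN /= mem_listA; case: ifP => [_ -> //|_ h].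
    by have := HM.1 (a, b); rewrite MM h /= mem_listA; apply.
  move=> h h' /= H.
  have Ea : a = a'.
    case: H => [//|Eb]; rewrite -Eb in h'.
    by apply: (can_inj node_ofK); apply: fB h h'.
  rewrite -Ea in h' *; congr pair; apply: (can_inj node_ofK).
  exact: fA h h'.
have irr (T : eqType) (s : seq T) p : better s p p = false.
  by case: p => //= z; rewrite ltnn.
have ltA l z : z != occB u f (succ_lit l) ->
    index (code_node (occB u f (succ_lit l))) (map code_node (listA (occA u f l)))
    < index (code_node z) (map code_node (listA (occA u f l))).
  move=> ne; rewrite !(index_map code_inj) /listA extA_occ //= eqxx.
  by rewrite eq_sym (negPf ne).
have leB l z :
    index (code_node (occA u f (pred_lit l))) (map code_node (listB (occB u f l)))
    <= index (code_node z) (map code_node (listB (occB u f l))).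
  rewrite !(index_map code_inj) /listB (extB_occ u l bf).
  by rewrite -[seq_of_opt _]/([:: _]) cat1s index_head.
have pA l : partnerA N' (code_node (occA u f l)) = Some (code_node (occB u f (succ_lit l))).
  apply: partnerAP => //; rewrite -/(joined _ _ _) jN extA_occ // eqxx.
  by case: isAP => // -[]; exists l.
have pAM l : partnerA M (code_node (occA u f l)) = Some (code_node (occB u f l)).
  by apply: partnerAP => //; apply: Hocc.
have neq l : occB u f l != occB u f (succ_lit l).
  apply: contraNneq (ext_gadget (extA_occ u l bf)) => <-; exact/eqP.
exists N'; split=> //.
  have [l0] : exists l0 : D * J, True.
    by case: (pickP (predT : pred (D * J))) => [l0 _|/eq_card0 E]; [exists l0|move: card_lits; rewrite E].
  move=> _; apply/phi_gt0; exists (inl (code_node (occA u f l0))).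
  rewrite /= pA pAM /= code_nodeK; exact: ltA.
apply/phi_eq0 => -[a|b] /=.
  rewrite -(node_ofK a) code_nodeK; case: (isAP (node_of a)) => [[l ->]|na].
    rewrite pA pAM /=; apply/negbTE; rewrite -leqNgt ltnW //; exact: ltA.
  have -> : partnerA N' (code_node (node_of a)) = partnerA M (code_node (node_of a)).
    apply: eq_pick => b; rewrite NM MM jN code_nodeK.
    by case: isAP.
  exact: irr.
rewrite -(node_ofK b) code_nodeK; move: (node_of b) => y.
have [x hx] := matchedB y.
rewrite (partnerBP HM hx); case: (isAP x) => [[l Ex]|nx].
  have Ey : y = occB u f l by apply: joined_funA hx _; rewrite Ex; apply: Hocc.
  rewrite (@partnerBP _ N' (code_node (occA u f (pred_lit l)))) //; last first.
    rewrite -/(joined _ _ _) jN extA_occ // pred_litK -Ey eqxx.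
    by case: isAP => // -[]; exists (pred_lit l).
  by rewrite Ey /=; apply/negbTE; rewrite -leqNgt; apply: leB.
rewrite (@partnerBP _ N' (code_node x)) //.
by rewrite -/(joined _ _ _) jN; case: isAP.
Qed.

End Completeness.

Theorem zero_cost_pareto_satisfiable M : min_cost_pareto M ->
  cost M = 0 <-> exists X, satisfies X.
Proof.
move=> [HP Hmin]; split=> [HC|[X HX]].
  by exists (truth_of M); apply: truth_of_satisfies.
by apply/eqP; rewrite -leqn0 -(cost_truth X); apply/Hmin/truth_pareto.
Qed.

End Gadgets.

(** * Encoding the gadget graph *)

Lemma map_enum_rank (T : finType) :
  [seq val (enum_rank x) | x <- enum T] = iota 0 #|T|.
Proof.
have [x0 _|T0] := pickP (predT : pred T); last first.
  have e0 : #|T| = 0 by apply: eq_card0.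
  by rewrite (size0nil (s := enum T)) -?cardE //= [in RHS]e0.
apply: (@eq_from_nth _ 0) => [|i]; rewrite size_map ?size_iota -cardE // => lti.
rewrite (nth_map x0) -?cardE // nth_iota // add0n.
have -> : nth x0 (enum T) i = enum_val (Ordinal lti) by rewrite (enum_val_nth x0).
by rewrite enum_valK.
Qed.

Lemma iota_blocks m n :
  flatten [seq [seq v * n + r | r <- iota 0 n] | v <- iota 0 m] = iota 0 (m * n).
Proof.
elim: m => //= m IH; rewrite -[in LHS](addn0 1) iotaDl.
have -> : iota 0 (m.+1 * n) = iota 0 (m * n) ++ iota (m * n) n.
  by rewrite mulSn addnC iotaD.
rewrite -IH; have : iota 0 m.+1 = rcons (iota 0 m) m by rewrite -addn1 iotaD cats1.
rewrite -[iota 0 m.+1]/(0 :: iota 1 m) -(addn0 1) iotaDl => H.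
rewrite -[LHS]/(flatten [seq [seq v * n + r | r <- iota 0 n] | v <- 0 :: [seq 1 + i | i <- iota 0 m]]).
by rewrite H map_rcons flatten_rcons -iotaDl addn0.
Qed.

Lemma cells_out_flatten (E K : finType) N (off : E -> nat) blk (cell : K -> seq (bool + E)) k0 v ks :
  cells_out N off blk cell v ks =
  flatten [seq items_out blk (rot_pos N off (v + i)) (cell (nth k0 ks i)) | i <- iota 0 (size ks)].
Proof.
elim: ks v => //= k ks IH v; rewrite addn0 IH -[in RHS](addn0 1) iotaDl -map_comp.
congr (_ ++ flatten _); apply: eq_map => i /=.
by rewrite add1n addSnnS.
Qed.

Lemma flatten_flatten T (sss : seq (seq (seq T))) :
  flatten (flatten sss) = flatten (map flatten sss).
Proof. by elim: sss => //= ss sss IH; rewrite flatten_cat IH. Qed.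

Lemma items_out_cons (E : finType) blk (h : E -> nat) b its :
  items_out blk h (inl b :: its) = b :: items_out blk h its.
Proof. by []. Qed.

Lemma items_out_cat (E : finType) blk (h : E -> nat) its its' :
  items_out blk h (its ++ its') = items_out blk h its ++ items_out blk h its'.
Proof. by rewrite /items_out map_cat flatten_cat. Qed.

Lemma items_out_flatten (E : finType) blk (h : E -> nat) itss :
  items_out blk h (flatten itss) = flatten [seq items_out blk h its | its <- itss].
Proof. by elim: itss => //= its itss IH; rewrite items_out_cat IH. Qed.

Lemma items_out_bits (E : finType) blk (h : E -> nat) bs :
  items_out blk h (map inl bs) = bs.
Proof. by elim: bs => //= b bs IH; rewrite /items_out /= -/(items_out _ _ _) IH. Qed.

Section Encoding.

Variables (D J K : finType).
Local Notation F := {ffun D * J -> bool}.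
Local Notation place := (F * D * bool)%type.
Variables (bad : pred F) (fo : K -> J -> option bool).

(* Relative description of the preference lists: [(d, d')] stands for the cell
   at distance [delta d' - delta d]. *)
Definition neighborsA (k : K) (s : slot D J) : seq ((D * D) * slot D J) :=
  let: (j, (f, d, b)) := s in
  (if bad f && (b == ~~ f (d, j)) then
     let l := succ_lit (d, j) in [:: ((d, l.1), (l.2, (f, l.1, false)))]
   else [::]) ++
  (if fo k j != Some false then [:: ((d, d), s)] else [::]) ++
  (if fo k j != Some true then [:: ((d, d), (j, unturn s.2))] else [::]) ++
  [seq ((d, d), (j, p)) | p <- enum {: place} & (p != s.2) && (p != unturn s.2)].

Definition neighborsB (k : K) (s : slot D J) : seq ((D * D) * slot D J) :=
  let: (j, (f, d, b)) := s in
  (if bad f && ~~ b then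
     let l := pred_lit (d, j) in [:: ((d, l.1), (l.2, (f, l.1, ~~ f l)))]
   else [::]) ++
  (if fo k j != Some true then [:: ((d, d), (j, turn s.2))] else [::]) ++
  (if fo k j != Some false then [:: ((d, d), s)] else [::]) ++
  [seq ((d, d), (j, p)) | p <- enum {: place} & (p != s.2) && (p != turn s.2)].

Local Notation item := (bool + D * D)%type.

(** A node number in unary is [nslots] ones for each preceding cell, supplied by the counter [e.1],
    and then the constant rank of the slot. *)
Definition index_items (e : (D * D) * slot D J) : seq item :=
  inr e.1 :: map inl (enc_nat (enum_rank e.2)).

Definition node_itemsA (k : K) (s : slot D J) : seq item :=
  inl true :: flatten [seq inl true :: index_items e ++ [:: inl (~~ zero_slot s e.2)]
                       | e <- neighborsA k s] ++ [:: inl false].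

Definition node_itemsB (k : K) (s : slot D J) : seq item :=
  inl true :: flatten [seq inl true :: index_items e | e <- neighborsB k s] ++
  [:: inl false].

Definition cellA (k : K) : seq item :=
  flatten [seq node_itemsA k s | s <- enum (slot D J)].

Definition cellB (k : K) : seq item :=
  flatten [seq node_itemsB k s | s <- enum (slot D J)].

Variables (N : nat) (delta eps : D -> nat).
Hypothesis delta_eps : forall d, (eps d + delta d) %% N = 0.
Hypothesis delta_inj : forall d d', delta d = delta d' %[mod N] -> d = d'.
Hypothesis card_lits : 1 < #|{: D * J}|.
Variables (k0 : K) (ks : seq K).
Hypothesis size_ks : size ks = N.

Definition forced_at (v : 'I_N) : J -> option bool := fo (nth k0 ks v).
(** The way from one literal to another through the cell of their clause. For equal directions it is
    0 modulo [N], so the same format serves the edges inside a gadget. *)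
Definition offset (e : D * D) : nat := eps e.1 + delta e.2.

Definition word_instance : instance :=
  pareto_instance delta_eps delta_inj card_lits bad forced_at.

Local Notation abs v e := (shift v (offset e.1), e.2).

Lemma filter_gadget (v : 'I_N) j p q :
  [seq y <- gadget (v, (j, p)) | (y != (v, (j, p))) && (y != (v, (j, q)))] =
  [seq (v, (j, p')) | p' <- enum {: place} & (p' != p) && (p' != q)].
Proof.
rewrite /gadget filter_map; congr map; apply: eq_filter => p' /=.
by rewrite !xpair_eqE !eqxx.
Qed.

Lemma listA_neighbors v s :
  listA delta eps bad forced_at (v, s) = [seq abs v e | e <- neighborsA (nth k0 ks v) s].
Proof.
case: s => j [[f d] b]; rewrite /listA /neighborsA !map_cat.
congr (_ ++ (_ ++ (_ ++ _))).
- by rewrite /=; case: ifP.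
- by rewrite /allowT /forced_at /=; case: ifP => //= _; rewrite /offset /= shift_id.
- by rewrite /allowF /forced_at /=; case: ifP => //= _; rewrite /offset /= shift_id.
- rewrite /rest /bwd filter_gadget -map_comp; apply: eq_map => p /=.
  by rewrite /offset /= shift_id.
Qed.

Lemma listB_neighbors v s :
  listB delta eps bad forced_at (v, s) = [seq abs v e | e <- neighborsB (nth k0 ks v) s].
Proof.
case: s => j [[f d] b]; rewrite /listB /neighborsB !map_cat.
congr (_ ++ (_ ++ (_ ++ _))).
- by rewrite /=; case: ifP.
- by rewrite /allowF /forced_at /=; case: ifP => //= _; rewrite /offset /= shift_id.
- by rewrite /allowT /forced_at /=; case: ifP => //= _; rewrite /offset /= shift_id.
- rewrite /rest /fwd filter_gadget -map_comp; apply: eq_map => p /=.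
  by rewrite /offset /= shift_id.
Qed.

Lemma enum_nodes :
  enum 'I_(N * nslots D J) =
  flatten [seq [seq code_node (v, s) | s <- enum (slot D J)] | v <- enum 'I_N].
Proof.
apply: (inj_map val_inj); rewrite val_enum_ord map_flatten -map_comp.
rewrite -iota_blocks -(val_enum_ord N) -map_comp; congr flatten; apply: eq_map => v /=.
by rewrite /nslots -map_enum_rank -!map_comp.
Qed.

Lemma index_items_out v e :
  items_out (nslots D J) (rot_pos N offset (val v)) (index_items e) =
  enc_nat (code_node (abs v e) : 'I_(N * _)).
Proof.
rewrite /index_items /items_out /= -/(items_out _ _ _) items_out_bits.
by rewrite /enc_nat -rcons_cat -nseqD.
Qed.

Lemma enc_seq_nodes (f : 'I_(N * nslots D J) -> seq bool) (cell : K -> seq item) :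
  (forall v : 'I_N, flatten [seq true :: f (code_node (v, s)) | s <- enum (slot D J)] =
     items_out (nslots D J) (rot_pos N offset (val v)) (cell (nth k0 ks v))) ->
  enc_seq f (enum 'I_(N * nslots D J)) =
  cells_out N offset (nslots D J) cell 0 ks ++ [:: false].
Proof.
move=> H; rewrite /enc_seq enum_nodes (cells_out_flatten _ _ _ _ k0) size_ks.
congr (_ ++ _); rewrite map_flatten flatten_flatten -2!map_comp -(val_enum_ord N) -map_comp.
congr flatten; apply: eq_map => v /=.
by rewrite -H -map_comp.
Qed.

Lemma node_itemsA_out v s :
  true :: enc_seq (fun b : 'I_(N * nslots D J) => enc_nat b ++
      [:: ~~ zero_slot (node_of (code_node (v, s))).2 (node_of b).2])
    (map (@code_node N D J) (listA delta eps bad forced_at (node_of (code_node (v, s))))) =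
  items_out (nslots D J) (rot_pos N offset (val v)) (node_itemsA (nth k0 ks v) s).
Proof.
rewrite !code_nodeK listA_neighbors items_out_cons items_out_cat items_out_flatten.
congr (_ :: (flatten _ ++ _)); rewrite -2!map_comp -[in RHS]map_comp.
apply: eq_map => e.
rewrite -[LHS]/(true :: enc_nat (code_node (abs v e)) ++
                [:: ~~ zero_slot s (node_of (code_node (abs v e))).2]) code_nodeK.
rewrite -[RHS]/(items_out _ _ (inl true :: index_items e ++ [:: inl (~~ zero_slot s e.2)])).
by rewrite items_out_cons items_out_cat index_items_out.
Qed.

Lemma node_itemsB_out v s :
  true :: enc_seq (fun a : 'I_(N * nslots D J) => enc_nat a)
    (map (@code_node N D J) (listB delta eps bad forced_at (node_of (code_node (v, s))))) =
  items_out (nslots D J) (rot_pos N offset (val v)) (node_itemsB (nth k0 ks v) s).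
Proof.
rewrite !code_nodeK listB_neighbors items_out_cons items_out_cat items_out_flatten.
congr (_ :: (flatten _ ++ _)); rewrite -2!map_comp -[in RHS]map_comp.
apply: eq_map => e.
rewrite -[LHS]/(true :: enc_nat (code_node (abs v e))).
rewrite -[RHS]/(items_out _ _ (inl true :: index_items e)).
by rewrite items_out_cons index_items_out.
Qed.

Lemma enc_word_instance :
  enc_instance word_instance =
  cells_out N offset (nslots D J) cellA 0 ks ++ [:: false] ++
  cells_out N offset (nslots D J) cellB 0 ks ++ [:: false].
Proof.
rewrite /enc_instance catA; congr (_ ++ _); apply: enc_seq_nodes => v.
- rewrite items_out_flatten -[map (items_out _ _) _]map_comp; congr flatten.
  by apply: eq_map => s; apply: node_itemsA_out.
- rewrite items_out_flatten -[map (items_out _ _) _]map_comp; congr flatten.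
  by apply: eq_map => s; apply: node_itemsB_out.
Qed.

End Encoding.

(** * Local constraints as forbidden bit patterns *)

Section LocalConstraints.

Variables (D K Lt : finType) (k0 : K) (l0 : Lt) (P : {ffun D -> K * Lt} -> bool).

Local Notation J := (K + Lt)%type.

(** Values have one bit each, but no clause demands that exactly one be set: every bit vector
    decodes to some set value or to the default, so an arbitrary assignment already yields
    letters. *)
Definition decode_kind (X : J -> bool) : K := odflt k0 [pick k | X (inl k)].
Definition decode_letter (X : J -> bool) : Lt := odflt l0 [pick l | X (inr l)].

(** The clauses are the same at every cell. Cells differ by their kinds, which are forced; a clause
    whose pattern contradicts the actual kind bits is thereby satisfied. *)
Definition bad_pattern (f : {ffun D * J -> bool}) : bool :=
  ~~ P [ffun d => (decode_kind (fun j => f (d, j)), decode_letter (fun j => f (d, j)))].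

Definition force_kind (k : K) (j : J) : option bool :=
  if j is inl k' then Some (k' == k) else None.

Lemma eq_decode_letter X X' : X =1 X' -> decode_letter X = decode_letter X'.
Proof. by move=> H; congr odflt; apply: eq_pick => k; rewrite H. Qed.

Lemma decode_kind_eq k X : (forall k', X (inl k') = (k' == k)) -> decode_kind X = k.
Proof.
move=> H; rewrite /decode_kind; case: pickP => [k'|/(_ k)]; rewrite H ?eqxx //.
by move/eqP.
Qed.

Lemma decode_letter_eq l X : (forall l', X (inr l') = (l' == l)) -> decode_letter X = l.
Proof.
move=> H; rewrite /decode_letter; case: pickP => [k'|/(_ l)]; rewrite H ?eqxx //.
by move/eqP.
Qed.

(** The only pattern that an assignment can fail to avoid at a cell is that of its actual bits, and
    this one decodes to the actual window. *)
Lemma local_satisfiable (N : nat) (delta : D -> nat) (kd : 'I_N -> K) :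
  (exists X, satisfies delta bad_pattern (fun v => force_kind (kd v)) X) <->
  (exists Y : 'I_N -> Lt, forall u,
     P [ffun d => (kd (shift u (delta d)), Y (shift u (delta d)))]).
Proof.
split=> [[X [Hf Hc]]|[Y HY]].
  exists (fun v => decode_letter (X v)) => u; apply/negPn/negP => H.
  pose f : {ffun D * J -> bool} := [ffun dj => X (shift u (delta dj.1)) dj.2].
  have [|l] := Hc u f; last by rewrite ffunE eqxx.
  rewrite /bad_pattern; apply: contra H => H; congr (is_true (P _)) : H.
  apply/ffunP => d; rewrite !ffunE; congr pair.
    by apply: decode_kind_eq => k'; rewrite ffunE; apply: Hf.
  by apply: eq_decode_letter => j; rewrite ffunE.
exists (fun v j => match j with inl k => k == kd v | inr l => l == Y v end).
split=> [v [k|l] b //= [<-] //|u f].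
case: (pickP (fun l : D * J => match l.2 with
    | inl k => k == kd (shift u (delta l.1))
    | inr l' => l' == Y (shift u (delta l.1)) end != f l)) => [l Hl _|H].
  by exists l.
rewrite /bad_pattern => /negP []; have := HY u; congr (is_true (P _)).
have Hf d j : f (d, j) = match j with
    | inl k => k == kd (shift u (delta d))
    | inr l' => l' == Y (shift u (delta d)) end.
  by have := H (d, j) => /= /negbFE /eqP.
apply/ffunP => d; rewrite !ffunE; congr pair.
  by symmetry; apply: decode_kind_eq => k'; rewrite Hf.
by symmetry; apply: decode_letter_eq => k'; rewrite Hf.
Qed.

End LocalConstraints.

(** * The tableau of a machine *)

(* [KStep] marks all rows but the first; [KBit] and [KFree] mark the given and
   the guessed part of the input. *)
Inductive kind := KFirst | KBlank | KMark | KBit of bool | KFree | KStep.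

Definition kind_code (k : kind) : bool + (bool * bool + unit) :=
  match k with
  | KBit b => inl b
  | KFirst => inr (inl (false, false))
  | KBlank => inr (inl (false, true))
  | KMark => inr (inl (true, false))
  | KFree => inr (inl (true, true))
  | KStep => inr (inr tt)
  end.

Definition kind_decode (c : bool + (bool * bool + unit)) : kind :=
  match c with
  | inl b => KBit b
  | inr (inl (false, false)) => KFirst
  | inr (inl (false, true)) => KBlank
  | inr (inl (true, false)) => KMark
  | inr (inl (true, true)) => KFree
  | inr (inr _) => KStep
  end.

Lemma kind_codeK : cancel kind_code kind_decode. Proof. by case. Qed.

HB.instance Definition _ := Finite.copy kind (can_type kind_codeK).

(** The head cell of the first row carries an input bit; its column is recognised by the marked
    blank cell to its left. [First] marks the seam of the torus, where constraints between
    neighbours in a row are suspended. *)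
Inductive column := First | Mark | Head | Other.

Definition column_code (c : column) : bool * bool :=
  match c with
  | First => (false, false)
  | Mark => (false, true)
  | Head => (true, false)
  | Other => (true, true)
  end.

Definition column_decode (c : bool * bool) : column :=
  match c with
  | (false, false) => First
  | (false, true) => Mark
  | (true, false) => Head
  | (true, true) => Other
  end.

Lemma column_codeK : cancel column_code column_decode. Proof. by case. Qed.

HB.instance Definition _ := Finite.copy column (can_type column_codeK).

(** Applied to the free input cells, this extracts the guessed witness from a tiling. *)
Lemma bits_then_blanks (S : Type) (s : seq (option (bool + S))) :
  (forall i, i < size s -> if nth None s i is Some (inr _) then False else True) ->
  (forall i, i.+1 < size s -> nth None s i = None -> nth None s i.+1 = None) ->
  exists w j, s = [seq Some (inl b) | b <- w] ++ nseq j None.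
Proof.
elim: s => [|a s IH] H1 H2; first by exists [::], 0.
have [|i lt|w [j Es]] := IH; [by move=> i lt; apply: (H1 i.+1)|exact: (H2 i.+1)|].
case: a H1 H2 => [[b|z]|] H1 H2; first by exists (b :: w), j; rewrite Es.
  by case: (H1 0).
case: w Es => [|b w] Es; first by exists [::], j.+1; rewrite Es.
by have := H2 0; rewrite Es /= => /(_ isT erefl).
Qed.

Section Tableau.

Variable V : machine.
Hypothesis Vfree : oracle_free V.

Local Notation Q := (mstate V).
Local Notation ntp := (mtapes V).
Local Notation sym_t := (Defs.cell (msymb V)).
Local Notation syms := {ffun 'I_ntp -> sym_t}.
Local Notation inp := (input_tape V).

(* Tapes are laid out relative to their heads, so that all heads scan the column
   [Head] and a head move shifts the tape.  Every letter of a row carries the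
   state and all scanned symbols. *)
Definition letter : finType := (column * Q * syms * syms)%type.
Definition col (l : letter) : column := l.1.1.1.
Definition lstate (l : letter) : Q := l.1.1.2.
Definition scanned (l : letter) : syms := l.1.2.
Definition symbols (l : letter) : syms := l.2.

Arguments col : simpl never.
Arguments lstate : simpl never.
Arguments scanned : simpl never.
Arguments symbols : simpl never.

Definition blanks : syms := [ffun=> None].

Definition trans (q : Q) (a : syms) : Q * {ffun 'I_ntp -> sym_t * dir} :=
  match maction q with
  | Trans f => f a
  | _ => (q, [ffun i => (a i, Stay)])
  end.

Definition rejecting (q : Q) : bool := if maction q is Halt false then true else false.

Definition plain (l : letter) : bool := (col l != First) && (col l != Mark).

Definition ok_kind (k : kind) (l : letter) : bool :=
  match k with
  | KFirst => col l == First
  | KBlank => plain l && (symbols l == blanks)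
  | KMark => (col l == Mark) && (symbols l == blanks)
  | KBit b => plain l &&
      (symbols l == [ffun i => if i == inp then Some (inl b) else None])
  | KFree => [&& plain l, [forall i, (i != inp) ==> (symbols l i == None)]
                 & if symbols l inp is Some (inr _) then false else true]
  | KStep => true
  end.

Definition ok_cell (k : kind) (l : letter) : bool :=
  [&& ok_kind k l, (k != KStep) ==> (lstate l == mstart V),
      (col l == First) ==> (symbols l == blanks),
      (col l == Head) ==> (scanned l == symbols l) & ~~ rejecting (lstate l)].

Definition ok_row (k : kind) (l0 l1 : letter) : bool :=
  ((col l1 != First) ==> [&& lstate l0 == lstate l1, scanned l0 == scanned l1
                           & (col l1 == Head) == (col l0 == Mark)]) &&
  ((k == KFree) ==> (symbols l0 inp == None) ==> (symbols l1 inp == None)).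

(** The tape moves instead of the head: after a left move column [p] shows what column [p - 1] held,
    with the written symbol in place of the one at [Head]. *)
Definition shifted (l0 l1 l2 : letter) : syms :=
  [ffun i => let: (c, d) := (trans (lstate l1) (scanned l1)).2 i in
             let src := match d with MoveL => l0 | Stay => l1 | MoveR => l2 end in
             if col src == Head then c else symbols src i].

Definition ok_step (l0 l1 l2 : letter) (k : kind) (l3 : letter) : bool :=
  (k == KStep) ==>
  [&& col l3 == col l1, lstate l3 == (trans (lstate l1) (scanned l1)).1
    & (col l1 != First) ==> (symbols l3 == shifted l0 l1 l2)].

Definition ok_window (x0 x1 x2 x3 : kind * letter) : bool :=
  [&& ok_cell x1.1 x1.2, ok_row x1.1 x0.2 x1.2 & ok_step x0.2 x1.2 x2.2 x3.1 x3.2].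

Variables (x : seq bool) (m T : nat).

Definition given : seq bool := pair_bits x [::].
(** Within [T] steps a tape lists at most [T] cells left of its head and at most
    [size given + m + T.+1] from the head on, so column 0 and the column [width] just outside always
    read blank. *)
Definition hd : nat := T + 3.
Definition width : nat := hd + size given + m + T.+1.
Definition area : nat := width * T.+1.

Definition kinds : seq kind :=
  KFirst :: nseq T.+1 KBlank ++ KMark :: map KBit given ++ nseq m KFree ++
  nseq T.+1 KBlank ++ nseq (width * T) KStep.

Lemma size_kinds : size kinds = area.
Proof.
rewrite /kinds /= !size_cat /= !size_cat !size_nseq size_map /=.
rewrite size_cat !size_nseq /area mulnS.
by move: (width * T) => z; rewrite /width /hd; lia.
Qed.

(** Rows are joined end to end and the last one to the first. The left seam is neutralised by
    [First], the right end looks at the blank first cell of the next row, and the wrap from the last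
    row to the first is void because the first row has no [KStep]. *)
Definition tiling (Y : nat -> letter) : Prop :=
  forall v, v < area ->
  let at_ := fun i => (nth KStep kinds (i %% area), Y (i %% area)) in
  ok_window (at_ (v + area.-1)) (at_ v) (at_ (v + 1)) (at_ (v + width)).

Definition kind_of_column (v : nat) : kind :=
  if v == 0 then KFirst else if v < T.+2 then KBlank else if v == T.+2 then KMark
  else if v < hd + size given then KBit (nth false given (v - hd))
  else if v < hd + size given + m then KFree else if v < width then KBlank else KStep.

Lemma nth_kinds v : nth KStep kinds v = kind_of_column v.
Proof.
rewrite /kind_of_column /kinds; case: v => [|v] //.
rewrite -[LHS]/(nth KStep (nseq T.+1 KBlank ++ _) v).
rewrite nth_cat size_nseq nth_nseq -[v.+1 < T.+2]/(v < T.+1).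
case: (ltnP v T.+1) => lv; first by [].
have [-> | ne] := eqVneq v T.+1; first by rewrite subnn eqxx.
have -> : v.+1 == T.+2 = false by apply/negP => /eqP [] /eqP; rewrite (negPf ne).
have hv : hd <= v.+1 by rewrite /hd; lia.
have -> : v - T.+1 = (v.+1 - hd).+1 by rewrite /hd; lia.
rewrite -[LHS]/(nth KStep (map KBit given ++ _) (v.+1 - hd)) nth_cat size_map.
have -> : (v.+1 < hd + size given) = (v.+1 - hd < size given) by lia.
case: ltnP => l1; first by rewrite (nth_map false).
rewrite nth_cat size_nseq nth_nseq.
have -> : (v.+1 < hd + size given + m) = (v.+1 - hd - size given < m) by lia.
case: ltnP => l2 //; rewrite nth_cat size_nseq nth_nseq.
have -> : (v.+1 < width) = (v.+1 - hd - size given - m < T.+1) by rewrite /width; lia.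
by case: ltnP => l3 //; rewrite nth_nseq; case: ifP.
Qed.

Definition column_at (p : nat) : column :=
  if p == 0 then First else if p == T.+2 then Mark else if p == hd then Head else Other.

Definition tape_at (t : tape sym_t) (p : nat) : sym_t :=
  if p < hd then nth None (left_of t) (hd.-1 - p) else nth None (right_of t) (p - hd).

Lemma tape_at_hd t : tape_at t hd = scan None t.
Proof. by rewrite /tape_at ltnn subnn nth0. Qed.

Definition source (d : dir) (p : nat) : nat :=
  match d with MoveL => p.-1 | Stay => p | MoveR => p.+1 end.

Lemma write_move_at t c d p : 0 < p ->
  tape_at (write_move None t c d) p =
  if source d p == hd then c else tape_at t (source d p).
Proof.
have nb (s : seq sym_t) i : nth None (behead s) i = nth None s i.+1.
  by case: s => //=; rewrite !nth_nil.
case: t => l r p0; rewrite /tape_at /write_move; case: d => /=.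
- case: eqP => [E|ne].
    have -> : p < hd = false by lia.
    by have -> : p - hd = 1 by lia.
  case: (ltngtP p hd) => Hp.
  + have -> : p.-1 < hd by lia.
    by rewrite nb; congr nth; lia.
  + have -> : p.-1 < hd = false by lia.
    have -> : p - hd = (p.-1 - hd.+1).+2 by lia.
    by rewrite /= nb; congr nth; lia.
  + rewrite Hp subnn /= -nth0; have -> : hd.-1 < hd by rewrite /hd; lia.
    by rewrite subnn.
- case: eqP => [E|ne].
    have -> : p < hd by lia.
    by have -> : hd.-1 - p = 0 by lia.
  case: (ltnP p hd) => Hp.
    have -> : p.+1 < hd by lia.
    by have -> : hd.-1 - p = (hd.-1 - p.+1).+1 by lia.
  have -> : p.+1 < hd = false by lia.
  by rewrite nb; congr nth; lia.
- case: (ltngtP p hd) => Hp //; last by rewrite Hp subnn.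
  have -> : p - hd = (p - hd.+1).+1 by lia.
  by rewrite /= nb.
Qed.

(** * Runs of the verifier seen in columns *)

Section Config.

Variable w : seq bool.
Hypothesis size_w : size w <= m.

Local Notation start := (init V (pair_bits x w)).
Local Notation vstep := (step (fun=> [::]) (M := V)).
Definition conf (t : nat) : config V := iter t vstep start.
Definition conf_scan (t : nat) : syms := [ffun i => scan None (ctapes (conf t) i)].
Definition conf_letter (t p : nat) : letter :=
  (column_at p, cstate (conf t), conf_scan t, [ffun i => tape_at (ctapes (conf t) i) p]).

Lemma pair_given : pair_bits x w = given ++ w.
Proof. by rewrite /given /pair_bits -catA. Qed.

Lemma conf_stateS t : cstate (conf t.+1) = (trans (cstate (conf t)) (conf_scan t)).1.
Proof.
rewrite /conf /= -/(conf t) /step /trans /conf_scan.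
by case E: (maction _) => [b|q|f] //; have := Vfree E.
Qed.

Lemma conf_tapeS t i p : 0 < p ->
  let: (c, d) := (trans (cstate (conf t)) (conf_scan t)).2 i in
  tape_at (ctapes (conf t.+1) i) p =
  if source d p == hd then c else tape_at (ctapes (conf t) i) (source d p).
Proof.
move=> p0; rewrite /conf /= -/(conf t) /step /trans /conf_scan.
case E: (maction _) => [b|q|f]; last 1 first.
- by case E2: (_ i) => [c d] /=; rewrite ffunE E2; apply: write_move_at.
- by rewrite /= ffunE /= ffunE; case: eqP => [->|] //; rewrite tape_at_hd.
- by have := Vfree E.
Qed.

Lemma conf_size t i : size (left_of (ctapes (conf t) i)) <= t /\
  size (right_of (ctapes (conf t) i)) <= size (pair_bits x w) + t.+1.
Proof.
elim: t i => [|t IH] i.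
  by rewrite /conf /= ffunE /=; case: ifP => _ /=; rewrite ?size_map; split=> //; lia.
have [IH1 IH2] := IH i; rewrite /conf /= -/(conf t) /step.
case E: (maction _) => [b|q|f]; [lia|by have := Vfree E|].
rewrite /= ffunE; move: (f _).2 => g; case: (ctapes (conf t) i) IH1 IH2 => l r /= IH1 IH2.
by case: (g i) => c [] /=; rewrite !size_behead /=; split; lia.
Qed.

Lemma blank_left t i : t <= T -> tape_at (ctapes (conf t) i) 0 = None.
Proof.
move=> le; have [H _] := conf_size t i; rewrite /tape_at.
have -> : 0 < hd by rewrite /hd; lia.
by rewrite nth_default //; apply: leq_trans H _; rewrite /hd; lia.
Qed.

Lemma blank_right t i : t <= T -> tape_at (ctapes (conf t) i) width = None.
Proof.
move=> le; have [_ H] := conf_size t i; rewrite /tape_at.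
have -> : width < hd = false by rewrite /width; lia.
rewrite nth_default //; apply: leq_trans H _; rewrite pair_given size_cat /width; lia.
Qed.

Lemma conf_tape0 i p : tape_at (ctapes (conf 0) i) p =
  if (p < hd) || (i != inp) then None
  else nth None [seq Some (inl b) | b <- pair_bits x w] (p - hd).
Proof.
rewrite /conf /= ffunE /tape_at /=; case: ltnP => _ //=; first by rewrite nth_nil.
by case: eqP => //= _; rewrite nth_nil.
Qed.

Lemma symbols_conf t p i :
  symbols (conf_letter t p) i = tape_at (ctapes (conf t) i) p.
Proof. exact: ffunE. Qed.

End Config.

Lemma width_gt0 : 0 < width. Proof. by rewrite /width /hd; lia. Qed.

Lemma cell_lt_area t p : t <= T -> p < width -> t * width + p < area.
Proof.
move=> lt lp; apply: (@leq_trans (t.+1 * width)); first by rewrite mulSn addnC ltn_add2r.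
by rewrite /area mulnC leq_mul2l ltnS lt orbT.
Qed.

Lemma mod_area t p : t <= T -> p < width -> (t * width + p) %% area = t * width + p.
Proof. by move=> lt lp; rewrite modn_small // cell_lt_area. Qed.

Lemma prev_cell t p : t <= T -> 0 < p -> p < width ->
  (t * width + p + area.-1) %% area = t * width + p.-1.
Proof.
move=> lt p0 lp; have := cell_lt_area lt lp => H.
have -> : t * width + p + area.-1 = t * width + p.-1 + area by lia.
by rewrite modnDr mod_area //; lia.
Qed.

Lemma next_cell t p : t <= T -> p.+1 < width ->
  (t * width + p + 1) %% area = t * width + p.+1.
Proof. by move=> lt lp; rewrite -addnA addn1 mod_area. Qed.

Lemma next_row t : t < T -> (t * width + width.-1 + 1) %% area = t.+1 * width + 0.
Proof.
move=> lt; have w0 := width_gt0.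
have -> : t * width + width.-1 + 1 = t.+1 * width + 0 by rewrite mulSn; lia.
exact: mod_area.
Qed.

Lemma below_cell t p : t < T -> p < width ->
  (t * width + p + width) %% area = t.+1 * width + p.
Proof.
move=> lt lp; have -> : t * width + p + width = t.+1 * width + p by rewrite mulSn; lia.
exact: mod_area.
Qed.

Lemma below_wrap p : p < width -> (T * width + p + width) %% area = p.
Proof.
move=> lp.
have -> : T * width + p + width = 0 * width + p + area.
  by rewrite /area mulnS [T * _]mulnC; lia.
by rewrite modnDr mod_area.
Qed.

Lemma kind_row t p : t <= T -> p < width ->
  nth KStep kinds (t * width + p) = if t == 0 then kind_of_column p else KStep.
Proof.
move=> lt lp; rewrite nth_kinds; case: t lt => [|t] lt //=.
have H : width <= t.+1 * width + p by rewrite mulSn; lia.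
have Hw : hd + size given + m < width by rewrite /width; lia.
rewrite /kind_of_column; move: (t.+1 * width + p) H => v H.
by rewrite /hd in Hw *; do !case: ifP => //; lia.
Qed.

Lemma kind_row0_step p : p < width -> kind_of_column p <> KStep.
Proof. by move=> lp; rewrite /kind_of_column lp; do !case: ifP. Qed.

Lemma column_first p : (column_at p == First) = (p == 0).
Proof. by rewrite /column_at; do !case: ifP. Qed.

Lemma column_mark p : (column_at p == Mark) = (p == T.+2).
Proof.
rewrite /column_at; case: (p =P 0) => [->|_] //.
by case: (p =P T.+2) => // _; case: ifP.
Qed.

Lemma column_head p : (column_at p == Head) = (p == hd).
Proof.
rewrite /column_at; case: (p =P 0) => [->|_]; first by rewrite /hd addn3.
case: (p =P T.+2) => [->|_]; last by case: (p == hd).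
by rewrite /hd; case: eqP => //; lia.
Qed.

Lemma tiling_of_run w : size w <= m ->
  (forall t, t <= T -> ~~ rejecting (cstate (conf w t))) ->
  tiling (fun v => conf_letter w (v %/ width) (v %% width)).
Proof.
move=> sw Hr; set Y : nat -> letter := fun v => _; move=> v lv.
have w0 := width_gt0.
have [t [p [lt lp Ev]]] : exists t p, [/\ t <= T, p < width & v = t * width + p].
  exists (v %/ width), (v %% width); rewrite ltn_pmod // -divn_eq; split=> //.
  by rewrite -ltnS ltn_divLR // mulnC.
have YE t' p' : p' < width -> Y (t' * width + p') = conf_letter w t' p'.
  by move=> lp'; rewrite /Y divnMDl // divn_small // addn0 modnMDl modn_small.
rewrite Ev /ok_window /= mod_area // kind_row // YE //.
have l1 : col (conf_letter w t p) = column_at p by [].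
apply/and3P; split.
- apply/and5P; split.
  + case: eqP => // t0; subst t.
    have Es : symbols (conf_letter w 0 p) = [ffun i => if (p < hd) || (i != inp)
       then None else nth None [seq Some (inl b) | b <- pair_bits x w] (p - hd)].
      by apply/ffunP => i; rewrite symbols_conf conf_tape0 ffunE.
    have Hb : p < hd -> symbols (conf_letter w 0 p) == blanks.
      by move=> lph; apply/eqP/ffunP => i; rewrite Es !ffunE lph.
    rewrite /kind_of_column; case: eqP => [->|pn0] //.
    case: ltnP => l2.
      rewrite /= Hb ?andbT; last by rewrite /hd; lia.
      by rewrite /plain l1 column_first column_mark; apply/andP; split; lia.
    case: eqP => [Ep|pnT].
      by rewrite /= Hb ?andbT ?l1 ?column_mark ?Ep //; rewrite /hd; lia.
    have Hpl : plain (conf_letter w 0 p).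
      by rewrite /plain l1 column_first column_mark; apply/andP; split; lia.
    have hp : p < hd = false by rewrite /hd; lia.
    case: ltnP => l3.
      rewrite /= Hpl /= Es; apply/eqP/ffunP => i; rewrite !ffunE hp /=.
      case: eqP => //= _; have lg : p - hd < size given by lia.
      rewrite pair_given (nth_map false); last by rewrite (size_cat given); lia.
      by rewrite nth_cat lg.
    case: ltnP => l4.
      rewrite /= Hpl /= Es; apply/andP; split.
        by apply/forallP => i; apply/implyP => ne; rewrite ffunE ne orbT.
      rewrite ffunE hp eqxx /=.
      have [lw|lw] := ltnP (p - hd) (size (pair_bits x w)).
        by rewrite (nth_map false).
      by rewrite nth_default // size_map.
    rewrite lp /= Hpl /= Es; apply/eqP/ffunP => i; rewrite !ffunE hp /=.
    by case: eqP => //= _; rewrite nth_default // size_map pair_given (size_cat given); lia.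
  + by case: (t =P 0) => [->|_]; [apply/implyP => _; apply/eqP|rewrite eqxx].
  + apply/implyP; rewrite l1 column_first => /eqP ->.
    by apply/eqP/ffunP => i; rewrite symbols_conf ffunE blank_left.
  + apply/implyP; rewrite l1 column_head => /eqP ->.
    by apply/eqP/ffunP => i; rewrite symbols_conf tape_at_hd ffunE.
  + exact: Hr.
- apply/andP; split.
    apply/implyP; rewrite l1 column_first => pn0; have p0 : 0 < p by rewrite lt0n.
    rewrite prev_cell // YE; last by lia.
    rewrite !eqxx /= /col /= column_head column_mark; apply/eqP; rewrite /hd.
    by apply/eqP/eqP; lia.
  apply/implyP; case: (t =P 0) => // -> /eqP Ek.
  have [lpf lpm] : hd + size given <= p /\ p < hd + size given + m.
    move: Ek; rewrite /kind_of_column; do !case: ifP => //; lia.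
  have p0 : 0 < p by rewrite /hd in lpf; lia.
  rewrite prev_cell // YE; last by lia.
  rewrite !symbols_conf !conf_tape0 eqxx /= !orbF.
  have -> : p < hd = false by lia.
  (* [given] ends in a bit, so the cell left of the first free one is not blank and the condition on
     blanks is vacuous there. *)
  have [Ep|ne] := eqVneq p (hd + size given).
    have -> : p.-1 < hd = false.
      by rewrite Ep /given /pair_bits size_cat /= /hd; lia.
    rewrite pair_given (nth_map false) // (size_cat given) Ep /given /pair_bits size_cat /= /hd; lia.
  have -> : p.-1 < hd = false by lia.
  have [lw|lw] := ltnP (p.-1 - hd) (size (pair_bits x w)).
    by rewrite (nth_map false).
  by apply/implyP => _; rewrite nth_default // size_map; lia.
- apply/implyP; move: lt; rewrite leq_eqVlt => /orP [/eqP Et|lt].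
    rewrite Et below_wrap //.
    have := @kind_row 0 p (leq0n _) lp; rewrite mul0n add0n /= => -> /eqP Ek.
    by case: (kind_row0_step lp).
  move=> _; rewrite below_cell // YE //.
  rewrite /col /lstate /= eqxx conf_stateS eqxx /=.
  apply/implyP; rewrite column_first => pn0; have p0 : 0 < p by rewrite lt0n.
  apply/eqP/ffunP => i; rewrite !ffunE.
  have := conf_tapeS w t i p0.
  have -> : (trans (lstate (conf_letter w t p)) (scanned (conf_letter w t p))) =
            trans (cstate (conf w t)) (conf_scan w t) by [].
  case: ((trans _ _).2 i) => c d ->; case: d => /=.
  + rewrite prev_cell ?(ltnW lt) // YE; last by lia.
    by rewrite /col /= column_head /symbols /= ffunE.
  + have [lp1|lp1] := ltnP p.+1 width.
      rewrite next_cell ?(ltnW lt) // YE //.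
      by rewrite /col /= column_head /symbols /= ffunE.
    (* To the right of the last column lies the first cell of the next row, whose blank stands for
       the blank beyond the tableau. *)
    have -> : p = width.-1 by lia.
    rewrite next_row // YE //.
    rewrite symbols_conf blank_left // prednK // blank_right ?(ltnW lt) //.
    by have -> : width == hd = false by rewrite /width; lia.
  + by rewrite /col /= column_head /symbols /= ffunE.
Qed.

(** * From a tiling back to a run *)

Section RunOfTiling.

Variable Y : nat -> letter.
Hypothesis HY : tiling Y.

Local Notation at_ t p := (Y (t * width + p)).

Lemma tiling_cell t p : t <= T -> p < width ->
  ok_cell (if t == 0 then kind_of_column p else KStep) (at_ t p).
Proof.
move=> lt lp; have := HY (cell_lt_area lt lp).
by rewrite /= mod_area // kind_row // => /and3P [].
Qed.

Lemma tiling_row t p : t <= T -> 0 < p -> p < width ->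
  ok_row (if t == 0 then kind_of_column p else KStep) (at_ t p.-1) (at_ t p).
Proof.
move=> lt p0 lp; have := HY (cell_lt_area lt lp).
by rewrite /= mod_area // kind_row // prev_cell // => /and3P [].
Qed.

Lemma tiling_step t p : t < T -> p < width ->
  [/\ col (at_ t.+1 p) = col (at_ t p),
      lstate (at_ t.+1 p) = (trans (lstate (at_ t p)) (scanned (at_ t p))).1
    & 0 < p -> col (at_ t p) != First ->
      symbols (at_ t.+1 p) = shifted (at_ t p.-1) (at_ t p)
        (if p.+1 < width then at_ t p.+1 else at_ t.+1 0)].
Proof.
move=> lt lp; have lt' := ltnW lt; have := HY (cell_lt_area lt' lp).
rewrite /= mod_area // below_cell // [nth _ _ (t.+1 * _ + _)]kind_row // => /and3P [_ _].
case/and3P=> /eqP -> /eqP -> /implyP H; split=> // p0 /H /eqP ->.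
rewrite prev_cell //; case: ltnP => lp1; first by rewrite next_cell.
by have -> : p = width.-1 by [lia]; rewrite next_row.
Qed.

(* Rows agree on state and scanned symbols, which are read off at the head. *)
Lemma tiling_scanned t : t <= T ->
  (forall p, p < width -> col (at_ t p) = column_at p) ->
  forall p, p < width -> scanned (at_ t p) = symbols (at_ t hd).
Proof.
move=> lt Hc.
have H0 p : p < width -> scanned (at_ t p) = scanned (at_ t 0).
  elim: p => // p IH lp; rewrite -IH; last by lia.
  have /andP [/implyP] := tiling_row lt (ltn0Sn p) lp.
  by rewrite Hc // column_first => /(_ isT) /and3P [_ /eqP <-].
have hw : hd < width by rewrite /width; lia.
move=> p lp; rewrite (H0 _ lp) -(H0 _ hw).
have /and5P [_ _ _ /implyP H _] := tiling_cell lt hw.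
by apply/eqP/H; rewrite Hc // column_head.
Qed.

(** The kinds determine [First] and [Mark], and the mark determines [Head]. All symbols are
    prescribed except in the free cells, from which [w] is read. *)
Lemma tiling_first_row : exists2 w, size w <= m &
  forall p, p < width -> at_ 0 p = conf_letter w 0 p.
Proof.
have kc p : p < width -> ok_cell (kind_of_column p) (at_ 0 p).
  by move=> lp; have := tiling_cell (leq0n T) lp.
have kr p : 0 < p -> p < width -> ok_row (kind_of_column p) (at_ 0 p.-1) (at_ 0 p).
  by move=> p0 lp; have := tiling_row (leq0n T) p0 lp.
have Hcf p : p < width -> (col (at_ 0 p) == First) = (p == 0).
  move=> lp; have /and5P [H _ _ _ _] := kc p lp; move: H.
  rewrite /kind_of_column; case: eqP => [-> /eqP -> //|_].
  case: ifP => _; first by case/andP => /andP [/negPf ->].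
  case: ifP => _; first by case/andP => /eqP ->.
  case: ifP => _; first by case/andP => /andP [/negPf ->].
  case: ifP => _; first by case/and3P => /andP [/negPf ->].
  by rewrite lp => /andP [/andP [/negPf ->]].
have Hcm p : p < width -> (col (at_ 0 p) == Mark) = (p == T.+2).
  move=> lp; have /and5P [H _ _ _ _] := kc p lp; move: H.
  rewrite /kind_of_column; case: eqP => [-> /eqP -> //|_].
  case: ifP => lpT; first by case/andP => /andP [_ /negPf ->] _; lia.
  case: eqP => _; first by case/andP => /eqP ->.
  case: ifP => _; first by case/andP => /andP [_ /negPf ->].
  case: ifP => _; first by case/and3P => /andP [_ /negPf ->].
  by rewrite lp => /andP [/andP [_ /negPf ->]].
have Hc p : p < width -> col (at_ 0 p) = column_at p.
  case: p => [|p] lp.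
    by apply/eqP; rewrite Hcf.
  have /andP [/implyP + _] := kr p.+1 (ltn0Sn p) lp.
  rewrite Hcf // Hcm; last by lia.
  move=> /(_ isT) /and3P [_ _ /eqP Hh].
  have Eh : (p.+1 == hd) = (p == T.+2) by rewrite /hd addn3 eqSS.
  move: (Hcf _ lp) (Hcm _ lp) Hh; rewrite /column_at Eh.
  by case: (col _) => // _ H2 H3; rewrite -H2 -?H3.
have Hst p : p < width -> lstate (at_ 0 p) = mstart V.
  move=> lp; have /and5P [_ /implyP H _ _ _] := kc p lp.
  by apply/eqP/H/eqP; apply: kind_row0_step.
pose f0 := hd + size given.
pose s := [seq symbols (at_ 0 (f0 + i)) inp | i <- iota 0 m].
have ns i : i < m -> nth None s i = symbols (at_ 0 (f0 + i)) inp.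
  by move=> li; rewrite (nth_map 0) ?size_iota // nth_iota.
have kf i : i < m -> kind_of_column (f0 + i) = KFree /\ f0 + i < width.
  move=> li; rewrite /kind_of_column /f0 /width /hd; split; last by lia.
  by do !case: ifP => //; lia.
have szs : size s = m by rewrite size_map size_iota.
have [||w [j Es]] := @bits_then_blanks _ s.
- move=> i; rewrite szs => li; rewrite ns //; have [Ek lw] := kf i li.
  have /and5P [+ _ _ _ _] := kc _ lw; rewrite Ek => /and3P [_ _].
  by case: (symbols _ _) => [[]|].
- move=> i; rewrite szs => li; rewrite !ns //; last by lia.
  have [Ek lw] := kf _ li; move=> H.
  have p0 : 0 < f0 + i.+1 by rewrite addnS.
  have /andP [_ /implyP] := kr _ p0 lw; rewrite Ek => /(_ isT) /implyP.
  by rewrite addnS /= H => /(_ isT) /eqP.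
have sw : size w <= m by rewrite -szs Es size_cat size_map leq_addr.
exists w => //.
have Hsym p : p < width -> symbols (at_ 0 p) = symbols (conf_letter w 0 p).
  move=> lp; have /and5P [H _ Hf _ _] := kc p lp.
  have Ec i : symbols (conf_letter w 0 p) i = if (p < hd) || (i != inp) then None
      else nth None [seq Some (inl b) | b <- pair_bits x w] (p - hd).
    by rewrite symbols_conf conf_tape0.
  apply/ffunP => i; rewrite Ec; move: H; rewrite /kind_of_column.
  case: eqP => [Ep|pn0].
    by move: Hf; rewrite Hcf // Ep /= => /eqP -> _; rewrite ffunE /hd addn3.
  case: ltnP => l2.
    by case/andP => _ /eqP ->; rewrite ffunE; have -> : p < hd by rewrite /hd; lia.
  case: eqP => [Ep|pnT].
    by case/andP => _ /eqP ->; rewrite ffunE; have -> : p < hd by rewrite /hd; lia.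
  have hp : p < hd = false by rewrite /hd; lia.
  rewrite hp.
  case: ltnP => l3 /=.
    case/andP => _ /eqP ->; rewrite ffunE; case: eqP => //= _.
    have lg : p - hd < size given by lia.
    rewrite pair_given (nth_map false); last by rewrite (size_cat given); lia.
    by rewrite nth_cat lg.
  have Eg : nth None [seq Some (inl b) | b <- pair_bits x w] (p - hd) =
            nth None [seq Some (inl b) | b <- w] (p - f0) :> sym_t.
    rewrite pair_given map_cat nth_cat size_map.
    have -> : p - hd < size given = false by lia.
    by rewrite /f0 subnDA.
  case: ltnP => l4.
    case/and3P => _ /forallP Hn _; case: (i =P inp) => [->|/eqP ne] /=; last first.
      by have := Hn i; rewrite ne => /eqP.
    rewrite Eg; have Ep : p = f0 + (p - f0) by rewrite /f0; lia.
    rewrite {1}Ep -ns; last by rewrite /f0; lia.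
    rewrite Es nth_cat size_map; case: ltnP => // lw.
    by rewrite nth_nseq nth_default ?size_map //; case: ifP.
  rewrite lp => /andP [_ /eqP ->]; rewrite ffunE; case: eqP => //= _.
  by rewrite Eg nth_default // size_map /f0; lia.
move=> p lp.
have Hscan := tiling_scanned (leq0n T) Hc lp.
have hw : hd < width by rewrite /width; lia.
rewrite /conf_letter -(Hc p lp).
have -> : conf_scan w 0 = scanned (at_ 0 p).
  by rewrite Hscan Hsym //; apply/ffunP => i; rewrite !ffunE tape_at_hd.
have -> : [ffun i => tape_at (ctapes (conf w 0) i) p] = symbols (at_ 0 p).
  by rewrite Hsym.
have -> : cstate (conf w 0) = lstate (at_ 0 p) by rewrite Hst.
by rewrite /col /lstate /scanned /symbols; case: (Y _) => [[[]]].
Qed.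

(** Each row follows from the one above: [ok_step] gives columns, states and symbols, column 0 is
    blank by [ok_cell], and the scanned symbols are those at [Head]. *)
Lemma tiling_rows w : size w <= m -> (forall p, p < width -> at_ 0 p = conf_letter w 0 p) ->
  forall t p, t <= T -> p < width -> at_ t p = conf_letter w t p.
Proof.
move=> sw H0; elim=> [|t IH] p lt lp; first exact: H0.
have IHt q : q < width -> at_ t q = conf_letter w t q by apply: IH; lia.
have w0 := width_gt0.
have Hc q : q < width -> col (at_ t.+1 q) = column_at q.
  by move=> lq; have [-> _ _] := tiling_step lt lq; rewrite IHt.
have Hst : lstate (at_ t.+1 p) = cstate (conf w t.+1).
  by have [_ -> _] := tiling_step lt lp; rewrite IHt // conf_stateS.
have Hf : symbols (at_ t.+1 0) = blanks.
  have /and5P [_ _ /implyP H _ _] := tiling_cell lt w0.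
  by apply/eqP/H; rewrite Hc // column_first.
have Hsym q : q < width -> symbols (at_ t.+1 q) = symbols (conf_letter w t.+1 q).
  move=> lq; have [Eq|q0] := posnP q.
    by rewrite Eq Hf; apply/ffunP => i; rewrite !ffunE blank_left.
  have [_ _ ->//] := tiling_step lt lq; last first.
    by rewrite IHt // column_first -lt0n.
  apply/ffunP => i; rewrite !ffunE (IHt q) //.
  have := conf_tapeS w t i q0.
  have -> : (trans (lstate (conf_letter w t q)) (scanned (conf_letter w t q))) =
            trans (cstate (conf w t)) (conf_scan w t) by [].
  case: ((trans _ _).2 i) => c d ->; case: d => /=.
  + rewrite IHt; last by lia.
    by rewrite /col /= column_head /symbols /= ffunE.
  + have [lp1|lp1] := ltnP q.+1 width.
      by rewrite IHt // /col /= column_head /symbols /= ffunE.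
    have -> : q.+1 = width by lia.
    rewrite Hc // Hf ffunE blank_right //; last by lia.
    by have -> : width == hd = false by rewrite /width; lia.
  + by rewrite /col /= column_head /symbols /= ffunE.
have hw : hd < width by rewrite /width; lia.
rewrite /conf_letter -(Hc p lp) -Hst.
have -> : conf_scan w t.+1 = scanned (at_ t.+1 p).
  rewrite (tiling_scanned lt Hc lp) Hsym //.
  by apply/ffunP => i; rewrite !ffunE tape_at_hd.
have -> : [ffun i => tape_at (ctapes (conf w t.+1) i) p] = symbols (at_ t.+1 p).
  by rewrite Hsym.
by rewrite /col /lstate /scanned /symbols; case: (Y _) => [[[]]].
Qed.

End RunOfTiling.

(** Acceptance is expressed by banning rejecting states. The run has a verdict at time [T], so a
    tiling, which never rejects, accepts; conversely a rejecting state would persist up to time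
    [T]. *)
Theorem tiling_iff_accepted :
  (forall w, size w <= m -> verdict (conf w T) != None) ->
  (exists Y, tiling Y) <->
  (exists2 w, size w <= m & verdict (conf w T) = Some true).
Proof.
move=> Hhalt; split=> [[Y HY]|[w sw Hv]].
  have [w sw H0] := tiling_first_row HY; exists w => //.
  have w0 := width_gt0.
  have := tiling_cell HY (leqnn T) w0 => /and5P [_ _ _ _].
  rewrite (tiling_rows HY sw H0 (leqnn T) w0) /rejecting /lstate /=.
  by move: (Hhalt w sw); rewrite /verdict; case: (maction _) => // -[].
exists (fun v => conf_letter w (v %/ width) (v %% width)).
apply: tiling_of_run => // t lt; apply/negP => Hr.
have [e ET] : exists e, T = e + t by exists (T - t); lia.
have Es : forall e, conf w (e + t) = conf w t.
  elim=> // e' IH; rewrite /conf addSn /= -/(conf w (e' + t)) IH /step.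
  by move: Hr; rewrite /rejecting; case: (maction _).
move: Hv; rewrite ET Es /verdict.
by move: Hr; rewrite /rejecting; case: (maction _) => // -[].
Qed.

End Tableau.

(** * Instances with equal encodings *)

(** Unlike mere injectivity, unique decoding before an arbitrary rest passes to concatenations,
    hence to sequences and pairs. *)
Definition prefix_free T (enc : T -> seq bool) : Prop :=
  forall x y s s', enc x ++ s = enc y ++ s' -> x = y /\ s = s'.

Lemma enc_nat_prefix_free : prefix_free enc_nat.
Proof.
elim=> [|m IH] [|n] s s' //=; first by case=> ->.
by case=> H; have [-> ->] := IH _ _ _ H.
Qed.

Lemma enc_seq_cons T (enc : T -> seq bool) x s :
  enc_seq enc (x :: s) = true :: enc x ++ enc_seq enc s.
Proof. by rewrite /enc_seq /= catA. Qed.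

Lemma enc_seq_prefix_free T (enc : T -> seq bool) :
  prefix_free enc -> prefix_free (enc_seq enc).
Proof.
move=> Henc; elim=> [|x xs IH] [|y ys] s s'; rewrite ?enc_seq_cons //=.
- by case=> ->.
case; rewrite -!catA => H; have [-> {}H] := Henc _ _ _ _ H.
by have [|-> ->] := IH ys s s'; first rewrite /enc_seq -!catA.
Qed.

Lemma enc_seq_map T U (enc : U -> seq bool) (f : T -> U) s :
  enc_seq enc (map f s) = enc_seq (fun x => enc (f x)) s.
Proof. by rewrite /enc_seq -map_comp. Qed.

Definition enc_cost_edge (e : nat * bool) : seq bool := enc_nat e.1 ++ [:: e.2].

Lemma enc_cost_edge_prefix_free : prefix_free enc_cost_edge.
Proof.
case=> [m b] [n c] s s'; rewrite /enc_cost_edge -!catA.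
by move=> /enc_nat_prefix_free /= [-> [-> ->]].
Qed.

Definition listsA (G : instance) : seq (seq (nat * bool)) :=
  [seq [seq (val b, cost01 a b) | b <- prefA a] | a <- enum 'I_(nA G)].

Definition listsB (G : instance) : seq (seq nat) :=
  [seq [seq val a | a <- prefB b] | b <- enum 'I_(nB G)].

Lemma enc_instance_lists G :
  enc_instance G = enc_seq (enc_seq enc_cost_edge) (listsA G) ++
                   enc_seq (enc_seq enc_nat) (listsB G).
Proof.
rewrite /enc_instance !enc_seq_map; congr (_ ++ _).
  by rewrite /enc_seq; congr (flatten _ ++ _); apply: eq_map => a; rewrite /= -map_comp.
by rewrite /enc_seq; congr (flatten _ ++ _); apply: eq_map => b; rewrite /= -map_comp.
Qed.

(** The encoding fixes sizes, preference lists and hence edges, but costs on edges only. Matchings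
    use nothing else, so an answer for one instance carries over to the other. *)
Lemma enc_instance_transfer (G G' : instance) (M' : edge_set G') :
  enc_instance G = enc_instance G' -> min_cost_pareto M' ->
  exists M : edge_set G,
    [/\ min_cost_pareto M, cost M = cost M' & enc_edge_set M = enc_edge_set M'].
Proof.
rewrite !enc_instance_lists => /(enc_seq_prefix_free
  (enc_seq_prefix_free enc_cost_edge_prefix_free)) [EA].
rewrite -[enc_seq _ (listsB G)]cats0 -[enc_seq _ (listsB G')]cats0.
move=> /(enc_seq_prefix_free (enc_seq_prefix_free enc_nat_prefix_free)) [EB _].
case: G G' EA EB M' => [n1 n2 e pA pB c u1 u2 m1 m2] [n1' n2' e' pA' pB' c' u1' u2' m1' m2'].
rewrite /listsA /listsB /= => EA EB.
have En1 : n1 = n1' by have := congr1 size EA; rewrite !size_map -!enumT !size_enum_ord.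
have En2 : n2 = n2' by have := congr1 size EB; rewrite !size_map -!enumT !size_enum_ord.
subst n1' n2'.
have EAa a : [seq (val b, c a b) | b <- pA a] = [seq (val b, c' a b) | b <- pA' a].
  by move/eq_in_map: EA => /(_ a); rewrite mem_enum => /(_ isT).
have EpA : pA = pA'.
  apply: functional_extensionality => a.
  have := congr1 (map fst) (EAa a); rewrite -!map_comp => H.
  exact: (inj_map val_inj) H.
have EpB : pB = pB'.
  apply: functional_extensionality => b.
  by move/eq_in_map: EB => /(_ b); rewrite mem_enum => /(_ isT); apply: (inj_map val_inj).
subst pA' pB'.
have Ee : e = e'.
  by apply: functional_extensionality => a; apply: functional_extensionality => b; rewrite -m1.
subst e'.
have Ec a b : e a b -> c a b = c' a b.
  move=> Hab; move/eq_in_map: (EAa a) => /(_ b); rewrite m1 => /(_ Hab) [].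
  by [].
pose G := Instance c u1 u2 m1 m2; pose G' := Instance c' u1' u2' m1' m2'.
rewrite -/G -/G' => M' [HP Hmin].
have Hcost (M : edge_set G) : is_matching M -> cost M = cost (M : edge_set G').
  by case=> He _; apply: eq_bigr => f /He Hf; rewrite /= Ec.
(* Pareto-optimality involves edges and preferences only, and these are shared, so the two
   statements are convertible. *)
have HP0 : pareto_optimal (M' : edge_set G) by exact: HP.
exists M'; split=> //; last exact: Hcost HP0.1.
split=> // M HM; rewrite (Hcost _ HP0.1) (Hcost _ HM.1); exact: Hmin.
Qed.

(** * Scanning the answer *)

Section EdgeScanner.

Variables (S : nat) (S0 : 0 < S) (z : 'I_S -> 'I_S -> bool).

Definition residue (n : nat) : 'I_S := Ordinal (ltn_pmod n S0).

(* The automaton reads an encoded edge set and keeps the residues modulo [S] of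
   the numbers of the current edge. *)
Definition edge_state : finType := option ('I_S + 'I_S * 'I_S).

Definition edge_next (d : edge_state) (b : bool) : edge_state + bool :=
  match d, b with
  | None, true => inl (Some (inl (residue 0)))
  | None, false => inr true
  | Some (inl i), true => inl (Some (inl (residue i.+1)))
  | Some (inl i), false => inl (Some (inr (i, residue 0)))
  | Some (inr (i, j)), true => inl (Some (inr (i, residue j.+1)))
  | Some (inr (i, j)), false => if z i j then inl None else inr false
  end.

Definition edge_fin (d : edge_state) : bool := false.

Lemma residueS n : residue (residue n).+1 = residue n.+1.
Proof. by apply: val_inj; rewrite /= -addn1 modnDml addn1. Qed.

Lemma scan_first n m y :
  scan_verdict edge_next edge_fin (Some (inl (residue n))) (enc_nat m ++ y) =
  scan_verdict edge_next edge_fin (Some (inr (residue (n + m), residue 0))) y.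
Proof.
by elim: m n => [|m IH] n; rewrite ?addn0 // addnS -addSn -IH /= residueS.
Qed.

Lemma scan_second i n m y :
  scan_verdict edge_next edge_fin (Some (inr (i, residue n))) (enc_nat m ++ y) =
  if z i (residue (n + m)) then scan_verdict edge_next edge_fin None y else false.
Proof.
elim: m n => [|m IH] n; first by rewrite addn0 /=; case: (z _ _).
by rewrite addnS -addSn -IH /= residueS.
Qed.

Lemma scan_edges n1 n2 (es : seq ('I_n1 * 'I_n2)) :
  scan_verdict edge_next edge_fin None
    (enc_seq (fun e : 'I_n1 * 'I_n2 => enc_nat e.1 ++ enc_nat e.2) es) =
  all (fun e : 'I_n1 * 'I_n2 => z (residue e.1) (residue e.2)) es.
Proof.
elim: es => [|e es IH]; first by [].
rewrite enc_seq_cons -catA -[LHS]/(scan_verdict edge_next edge_fin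
  (Some (inl (residue 0))) _) scan_first scan_second !add0n IH /=.
by case: (z _ _).
Qed.

End EdgeScanner.

Lemma size_enc_edge_set (G : instance) (M : edge_set G) :
  size (enc_edge_set M) <= nA G * nB G * (nA G + nB G + 3) + 1.
Proof.
rewrite /enc_edge_set /enc_seq size_cat leq_add2r.
have H : size (enum M) <= nA G * nB G.
  by rewrite -cardE (leq_trans (max_card _)) // card_prod !card_ord.
apply: leq_trans (leq_mul H (leqnn _)).
elim: (enum M) => //= -[a b] s IH; rewrite size_cat mulSn -addSn.
apply: leq_add IH; rewrite /= size_cat !size_rcons !size_nseq.
by have := ltn_ord a; have := ltn_ord b; lia.
Qed.

Lemma cost_eq0 (G : instance) (M : edge_set G) (z : nat -> nat -> bool) :
  (forall a b, @cost01 G a b = ~~ z a b) ->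
  (cost M == 0) = all (fun e : 'I_(nA G) * 'I_(nB G) => z e.1 e.2) (enum M).
Proof.
move=> Hz; rewrite /cost sum_nat_eq0; apply/forallP/allP => [H e|H e].
  by rewrite mem_enum => He; have := H e; rewrite He Hz eqb0 negbK.
by apply/implyP => He; rewrite Hz eqb0 negbK H // mem_enum.
Qed.

(** One look at the answer tape thus tells whether the approximate value is 0. *)
Lemma enc_binary_nil v : (enc_binary v == [::]) = (v == 0).
Proof.
case: v => // v; rewrite /enc_binary /=; case: (pos_of_nat v v) => //.
Qed.

(** * The reduction *)

Lemma horner_nat_mono (p : {poly nat}) a b : a <= b -> p.[a]%R <= p.[b]%R.
Proof.
move=> le; rewrite /horner; elim: (polyseq p) => //= c s IH.
by rewrite leq_add2r; apply: leq_mul.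
Qed.

Lemma eq_cells_out (E K : finType) N (off off' : E -> nat) blk (cell : K -> seq (bool + E)) v ks :
  off =1 off' -> cells_out N off blk cell v ks = cells_out N off' blk cell v ks.
Proof.
move=> H; elim: ks v => //= k ks IH v; rewrite IH; congr (_ ++ _).
rewrite /items_out; congr flatten; apply: eq_map => -[b|e] //.
by rewrite /rot_pos H.
Qed.

Section Reduction.

Variables (V : machine) (pV p : {poly nat}).

Local Notation D := (bool * bool)%type.
Definition dprev : D := (false, false).
Definition dcur : D := (false, true).
Definition dnext : D := (true, false).
Definition dbelow : D := (true, true).

Definition pgiven : {poly nat} := ('X + 'X + polyC 2)%R.
(** The extra step provides two rows even where [pV] vanishes; with a single row the cell below
    would be the cell itself, and the offsets would not be distinct. *)
Definition ptime : {poly nat} := (pV \Po (pgiven + p) + polyC 1)%R.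
(** Without subtraction in [{poly nat}], width and area less one get polynomials of their own; the
    latter is the offset of the previous cell on the torus. *)
Definition pwidth1 : {poly nat} := (ptime + polyC 3 + pgiven + p + ptime)%R.
Definition pwidth : {poly nat} := (pwidth1 + polyC 1)%R.
Definition parea1 : {poly nat} := (pwidth1 * (ptime + polyC 1) + ptime)%R.
Definition parea : {poly nat} := (parea1 + polyC 1)%R.

Definition pdelta (d : D) : {poly nat} :=
  match d with
  | (false, false) => parea1
  | (false, true) => polyC 0
  | (true, false) => polyC 1
  | (true, true) => pwidth
  end.

Definition peps (d : D) : {poly nat} :=
  match d with
  | (false, false) => polyC 1
  | (false, true) => polyC 0
  | (true, false) => parea1
  | (true, true) => (pwidth * ptime)%R
  end.

Section Size.

Variable n : nat.

Definition steps : nat := (pV.[n + n + 2 + p.[n]]%R).+1.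
Definition width1 : nat := steps + 3 + (n + n + 2) + p.[n]%R + steps.

Definition hornerNE := (hornerD, hornerM, hornerC, hornerX, horner_comp, natrDE, natrME).

Lemma ptimeE : ptime.[n]%R = steps.
Proof. by rewrite /ptime /pgiven !hornerNE addn1. Qed.

Lemma pwidth1E : pwidth1.[n]%R = width1.
Proof. by rewrite /pwidth1 4!hornerD ptimeE /pgiven !hornerNE. Qed.

Lemma pwidthE : pwidth.[n]%R = width1.+1.
Proof. by rewrite /pwidth hornerD pwidth1E !hornerNE addn1. Qed.

Lemma parea1E : parea1.[n]%R = width1 * steps.+1 + steps.
Proof. by rewrite /parea1 hornerD hornerM pwidth1E hornerD ptimeE !hornerNE addn1. Qed.

Lemma pareaE : parea.[n]%R = width1.+1 * steps.+1.
Proof. by rewrite /parea hornerD parea1E !hornerNE mulSn; lia. Qed.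

Lemma delta_eps_mod d : ((peps d).[n]%R + (pdelta d).[n]%R) %% parea.[n]%R = 0.
Proof.
have E1 : (width1 * steps.+1 + steps).+1 = width1.+1 * steps.+1 by rewrite mulSn; lia.
case: d => [] [] []; rewrite /= pareaE ?hornerM ?parea1E ?pwidthE ?ptimeE ?hornerNE.
- have -> : width1.+1 * steps + width1.+1 = width1.+1 * steps.+1 by rewrite mulnS addnC.
  exact: modnn.
- by rewrite addn1 E1 modnn.
- exact: mod0n.
- by rewrite add1n E1 modnn.
Qed.

Lemma delta_inj_mod d d' :
  (pdelta d).[n]%R = (pdelta d').[n]%R %[mod parea.[n]%R] -> d = d'.
Proof.
have s0 : 0 < steps by [].
have w0 : 3 < width1 by rewrite /width1; lia.
have lt e : (pdelta e).[n]%R < parea.[n]%R.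
  by case: e => [] [] []; rewrite /= pareaE ?hornerC ?pwidthE ?parea1E; nia.
rewrite !modn_small //.
by case: d d' => [] [] [] [[] []] //=; rewrite ?hornerC ?pwidthE ?parea1E; nia.
Qed.

End Size.

Local Notation Lt := (letter V).
Local Notation J := (kind + Lt)%type.

Definition letter0 : Lt := (First, mstart V, blanks V, blanks V).

Definition window_ok (w : {ffun D -> kind * Lt}) : bool :=
  ok_window (w dprev) (w dcur) (w dnext) (w dbelow).

Definition bad : pred {ffun D * J -> bool} := bad_pattern KStep letter0 window_ok.

Definition fixed : kind -> J -> option bool := @force_kind _ _.

Lemma card_lits : 1 < #|{: D * J}|.
Proof.
rewrite !card_prod card_bool; apply: (@leq_trans (2 * 2 * 1)) => //.
by rewrite leq_mul2l; apply/card_gt0P; exists (inl KStep).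
Qed.

Definition segments1 : seq ({poly nat} * kind) :=
  [:: (polyC 1, KFirst); ((ptime + polyC 1)%R, KBlank); (polyC 1, KMark)].

(** The first two bits are the separator by which [pair_bits] ends [x]; together with the doubled
    bits from [input_kinds] they spell [given]. *)
Definition segments2 : seq ({poly nat} * kind) :=
  [:: (polyC 1, KBit false); (polyC 1, KBit true); (p, KFree);
      ((ptime + polyC 1)%R, KBlank); ((pwidth * ptime)%R, KStep)].

Definition input_kinds (b : bool) : seq kind := [:: KBit b; KBit b].

Definition poffset (e : D * D) : {poly nat} := (peps e.1 + pdelta e.2)%R.

Definition reduction : cmd (var (D * D)%type) :=
  emission parea poffset (nslots D J) (cellA bad fixed) (cellB bad fixed)
    segments1 segments2 input_kinds.

Definition reduction_time : nat -> nat :=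
  emission_time parea poffset (nslots D J) (cellA bad fixed) (cellB bad fixed)
    segments1 segments2 input_kinds.

Section Input.

Variable x : seq bool.
Local Notation n := (size x).

Lemma size_given : size (given x) = n + n + 2.
Proof.
rewrite /given /pair_bits size_cat /=; congr (_ + _).
by elim: x => //= b s ->; lia.
Qed.

Lemma width_eq : width x p.[n]%R (steps n) = (width1 n).+1.
Proof. by rewrite /width /hd size_given /width1; lia. Qed.

Lemma area_eq : area x p.[n]%R (steps n) = parea.[n]%R.
Proof. by rewrite /area width_eq pareaE. Qed.

Lemma word_kinds : word segments1 segments2 input_kinds x = kinds x p.[n]%R (steps n).
Proof.
have E1 : ((ptime + polyC 1).[n])%R = (steps n).+1.
  by rewrite hornerD ptimeE hornerC natrDE addn1.
have E2 : ((pwidth * ptime).[n])%R = (width1 n).+1 * steps n.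
  by rewrite hornerM pwidthE ptimeE.
rewrite /word /reps_word /= E1 E2 !hornerC /kinds width_eq.
move: (steps n) ((width1 n).+1 * steps n) => t a.
rewrite /= -!catA /= cats0; congr [:: _, _ & _ ++ _ :: _].
rewrite /given /pair_bits map_cat -!catA; congr (_ ++ _).
by elim: (x) => //= b s ->.
Qed.

Definition reduction_instance : instance :=
  word_instance bad fixed (@delta_eps_mod n) (@delta_inj_mod n) card_lits KStep
    (kinds x p.[n]%R (steps n)).

Lemma reduction_run : exists2 s, out s = enc_instance reduction_instance
  & run reduction (empty_store _ x) (reduction_time n) s.
Proof.
have sW : size (word segments1 segments2 input_kinds x) = parea.[n]%R.
  by rewrite word_kinds size_kinds area_eq.
have N0 : 0 < parea.[n]%R by rewrite pareaE.
have [s Hs Hrun] := run_emission poffset (nslots D J) (cellA bad fixed) (cellB bad fixed) N0 sW.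
exists s => //; rewrite Hs /emission_out enc_word_instance; last first.
  by rewrite size_kinds area_eq.
rewrite word_kinds.
have Eoff : (fun e => (poffset e).[n]%R) =1
    offset (fun d => (pdelta d).[n]%R) (fun d => (peps d).[n]%R).
  by move=> e; rewrite /poffset hornerD.
by rewrite !(eq_cells_out _ _ _ _ _ Eoff).
Qed.

Lemma reduction_tiling :
  (exists X, satisfies (fun d => (pdelta d).[n]%R) bad
     (forced_at fixed KStep (kinds x p.[n]%R (steps n)) (N := parea.[n]%R)) X) <->
  (exists Y, tiling (V := V) x p.[n]%R (steps n) Y).
Proof.
apply: iff_trans (local_satisfiable KStep letter0 window_ok (fun d => (pdelta d).[n]%R)
  (fun v : 'I_(parea.[n]%R) => nth KStep (kinds x p.[n]%R (steps n)) v)) _.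
have a1 : (area x p.[n]%R (steps n)).-1 = parea1.[n]%R.
  by rewrite area_eq pareaE parea1E mulSn addSn addnC.
have wE : width x p.[n]%R (steps n) = pwidth.[n]%R by rewrite width_eq pwidthE.
split=> [[Y HY]|[Y HY]].
  exists (fun v => if insub v is Some o then Y o else letter0) => v; rewrite a1 wE area_eq.
  move=> lv; have := HY (Ordinal lv); rewrite /window_ok !ffunE /= !hornerC addn0.
  have E m : (if insub ((v + m) %% parea.[n]%R) is Some o then Y o else letter0) =
             Y (shift (Ordinal lv) m).
    by rewrite -[(v + m) %% _]/(val (shift (Ordinal lv) m)) valK.
  by rewrite !E; have := E 0; rewrite addn0 => ->.
exists (fun v => Y (val v)) => u.
have lu : u < area x p.[n]%R (steps n) by rewrite area_eq.
have := HY _ lu; rewrite a1 wE area_eq /window_ok !ffunE /= !hornerC addn0.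
by [].
Qed.

End Input.

Variables (Lv : language).
Hypothesis Vfree : oracle_free V.
Hypothesis V_decides : decides_within (fun=> [::]) V Lv pV.

Lemma halted_iter (c : config V) e b : verdict c = Some b ->
  iter e (step (fun=> [::]) (M := V)) c = c.
Proof.
rewrite /verdict => H; elim: e => //= e ->; rewrite /step.
by case: (maction _) H.
Qed.

(** A halted configuration no longer changes, so the bound computed for the longest witness serves
    all shorter ones. *)
Lemma verdict_steps x w : size w <= p.[size x]%R ->
  exists2 b, verdict (conf V x w (steps (size x))) = Some b & (b <-> Lv (pair_bits x w)).
Proof.
move=> sw; have [b Hb HL] := V_decides (pair_bits x w); exists b => //.
have le : pV.[size (pair_bits x w)]%R <= steps (size x).
  rewrite leqW //; apply: horner_nat_mono.
  by rewrite pair_given (size_cat (given x)) size_given leq_add2l.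
by rewrite /conf -(subnK le) iterD (halted_iter _ Hb).
Qed.

Lemma reduction_correct x (M : edge_set (reduction_instance x)) : min_cost_pareto M ->
  cost M = 0 <-> (exists2 w, size w <= p.[size x]%R & Lv (pair_bits x w)).
Proof.
move=> HM; apply: iff_trans (zero_cost_pareto_satisfiable dcur HM) _.
apply: iff_trans (reduction_tiling x) _.
have Hhalt w : size w <= p.[size x]%R -> verdict (conf V x w (steps (size x))) != None.
  by move=> /verdict_steps [b ->].
apply: iff_trans (tiling_iff_accepted Vfree Hhalt) _.
split=> -[w sw]; have [b Hb HL] := verdict_steps sw; rewrite ?Hb => H; exists w => //.
  by apply/HL; case: H.
by rewrite Hb; move/HL: H => ->.
Qed.

End Reduction.

(* The costs depend on the indices modulo [S] only, which makes the cost of the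
   answer checkable by an automaton. *)
Lemma NP_reduction (L : language) : in_NP L ->
  exists (W : finType) (c : cmd W) (S : nat) (S0 : 0 < S) (z : 'I_S -> 'I_S -> bool)
         (T : nat -> nat) (B : nat -> nat) (inst : seq bool -> instance),
  [/\ poly_bounded T, poly_bounded B,
      forall x, exists2 s, out s = enc_instance (inst x)
                         & run c (empty_store _ x) (T (size x)) s,
      forall x, nA (inst x) = B (size x) /\ nB (inst x) = B (size x)
    & forall x, (forall a b, @cost01 (inst x) a b = ~~ z (residue S0 a) (residue S0 b)) /\
        forall M : edge_set (inst x), min_cost_pareto M -> cost M = 0 <-> L x].
Proof.
case=> Lv [p [[V [pV [Vfree HV]]] HL]].
pose J : finType := (kind + letter V)%type.
have S0 : 0 < nslots (bool * bool)%type J.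
  by apply/card_gt0P; exists (inl KStep, ([ffun=> false], dcur, false)).
exists (var (bool * bool * (bool * bool))%type), (reduction V pV p), _, S0.
exists (fun i j => zero_slot (enum_val i) (enum_val j)).
exists (reduction_time V pV p), (fun n => (parea pV p).[n]%R * nslots (bool * bool)%type J).
exists (reduction_instance V pV p); split.
- exact: emission_time_bounded.
- exact: poly_boundedM (poly_bounded_horner _) (poly_bounded_const _).
- exact: reduction_run.
- by [].
move=> x; split=> [a b|M HM].
  have En (i : 'I_((parea pV p).[size x]%R * nslots (bool * bool)%type J)) :
      (node_of i).2 = enum_val (residue S0 i).
    by rewrite /node_of /=; congr enum_val; apply: val_inj.
  by rewrite -[cost01 a b]/(~~ zero_slot (node_of a).2 (node_of b).2) !En.
apply: iff_trans (reduction_correct Vfree HV HM) _.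
by split=> /HL.
Qed.

(** * The two oracle machines *)

Lemma query_machine_decides (W D : finType) (c : cmd W) (d0 : D) next fin
    (oracle : seq bool -> seq bool) (L : language) (T B : nat -> nat) (q : {poly nat}) :
  (forall n, T n + T n + B n + 5 <= q.[n]%R) ->
  (forall x, exists s, [/\ run c (empty_store _ x) (T (size x)) s,
      scan_time next d0 (oracle (out s)) <= B (size x)
    & scan_verdict next fin d0 (oracle (out s)) <-> L x]) ->
  decides_within oracle (query_machine c d0 next fin) L q.
Proof.
move=> Hq H x; have [s [[t Ht Hex] Hscan HL]] := H x.
exists (scan_verdict next fin d0 (oracle (out s))) => //.
apply: (query_machine_correct fin Hex); apply: leq_trans (Hq (size x)).
by rewrite -addnn leq_add2r leq_add // leq_add.
Qed.

Lemma min_cost_pareto_NP_hard : NP_hard min_cost_pareto_problem.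
Proof.
move=> L /NP_reduction [W [c [S [S0 [z [T [B [inst [HT HB Hrun Hn Hx]]]]]]]]].
pose time n := T n + T n + (B n * B n * (B n + B n + 3) + 1).+1 + 5.
have [q Hq] : poly_bounded time.
  by apply: (@poly_bounded_le _ (fun n => T n + T n + (B n * B n * (B n + B n + 3) + 2) + 5));
    [move=> n; rewrite /time -addnS|poly_bound].
exists (query_machine c (None : edge_state S) (edge_next S0 z) (@edge_fin S)), q.
move=> oracle Hor.
apply: (@query_machine_decides _ _ _ _ _ _ _ _ T
  (fun n => (B n * B n * (B n + B n + 3) + 1).+1)) => // x.
have [s Hs Hsr] := Hrun x; exists s; rewrite Hs.
have [|G [M [EG EM HM]]] := Hor (enc_instance (inst x)).
  have [M HM] := min_cost_pareto_exists (inst x).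
  by exists (enc_edge_set M), (inst x), M.
have [M1 [HM1 _ EM1]] := enc_instance_transfer EG HM.
have [Hcost HL] := Hx x; have [EA EB] := Hn x.
rewrite EM -EM1; split=> //.
  apply: leq_trans (scan_time_le _ _ _) _; rewrite ltnS.
  by apply: leq_trans (size_enc_edge_set M1) _; rewrite EA EB.
rewrite scan_edges -(@cost_eq0 _ M1 (fun i j => z (residue S0 i) (residue S0 j))) //.
by split=> [/eqP /(HL _ HM1)|/(HL _ HM1) /eqP].
Qed.

(** At optimum 0 the upper bound forces the answer 0, and at a positive optimum the lower bound
    keeps it positive; so comparing the answer with 0 decides [L]. *)
Lemma approx_min_cost_pareto_NP_hard (R : realFieldType) (alpha : nat -> R) :
  (forall n : nat, (1 <= alpha n)%R) -> NP_hard (approx_min_cost_pareto_problem alpha).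
Proof.
move=> Ha L /NP_reduction [W [c [S [S0 [z [T [B [inst [HT HB Hrun Hn Hx]]]]]]]]].
have [q Hq] : poly_bounded (fun n => T n + T n + 1 + 5) by poly_bound.
exists (query_machine c tt (fun _ _ => inr false) (fun=> true)), q => oracle Hor.
apply: (@query_machine_decides _ _ _ _ _ _ _ _ T (fun=> 1)) => // x.
have [s Hs Hsr] := Hrun x; exists s; rewrite Hs.
have [|G [M [v [EG -> HM Hlow Hup]]]] := Hor (enc_instance (inst x)).
  have [M HM] := min_cost_pareto_exists (inst x).
  (* The exact optimum is itself an admissible answer because [alpha] is at least 1, so the oracle
     is bound to reply correctly. *)
  exists (enc_binary (cost M)), (inst x), M, (cost M); split=> //.
  by rewrite Num.Theory.ler_peMl // Num.Theory.ler0n.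
have [M1 [HM1 EC _]] := enc_instance_transfer EG HM.
have [_ HL] := Hx x.
have Hv : (v == 0) = (cost M == 0).
  apply/eqP/eqP => [Ev|EM]; first by apply/eqP; rewrite -leqn0 -Ev.
  move: Hup; rewrite EM GRing.mulr0 Num.Theory.lern0 => /eqP; exact.
split=> //; first by case: (enc_binary v).
have -> : scan_verdict (fun _ _ => inr false) (fun=> true) tt (enc_binary v) = (v == 0).
  by rewrite -enc_binary_nil; case: (enc_binary v).
by rewrite Hv -EC; split=> [/eqP /(HL _ HM1)|/(HL _ HM1) /eqP].
Qed.

Theorem theorem8 :
  NP_hard min_cost_pareto_problem /\
  forall (R : realFieldType) (alpha : nat -> R),
    (forall n : nat, (1 <= alpha n)%R) ->
    NP_hard (approx_min_cost_pareto_problem alpha).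
Proof.
split; first exact: min_cost_pareto_NP_hard.
exact: approx_min_cost_pareto_NP_hard.
Qed.
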